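(* Let $N\ge 3$, $\zeta=(\zeta_0,\ldots,\zeta_k)\in\mathbb{C}^{k+1}$ and $\zeta(z)=\sum_{i\ge0}\zeta_iz^i$. Define $c_i\in\mathbb{C}[\mathfrak{so}_N]^{\mathrm{SO}_N}\simeq S(\mathfrak{so}_N)^{\mathrm{SO}_N}$ by $\sum_i(-1)^ic_it^{2i}=c(t)$, where $$c(t):=\mathrm{Res}_{z=0}\ \zeta(z^{-2})\,\frac{\det(1+t^2A^2)^{1/2}}{\det(1+z^2A^2)^{1/2}}\,\frac{z^{-1}dz}{1-t^{-2}z^2}.$$ (a) If $N=2n$, the Poisson center of $H^{\mathrm{cl}}_\zeta(\mathfrak{so}_{2n},V_{2n})$ is a polynomial algebra in free generators $\{\tau_1+c_1,\ldots,\tau_n+c_n\}$. (b) If $N=2n+1$, the Poisson center of $H^{\mathrm{cl}}_\zeta(\mathfrak{so}_{2n+1},V_{2n+1})$ is a polynomial algebra in free generators $\{\tau_1+c_1,\ldots,\tau_n+c_n,\widehat\tau_{n+1}\}$.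
   Context: The ground field is $\mathbb{C}$. $V_N=\mathbb{C}^N$ with $(x,y)=x^{T}y$; $\mathfrak{so}_N$ is the Lie algebra of skew-symmetric $N\times N$ matrices. Identification of polynomial functions with symmetric algebras: $B\in\mathfrak{so}_N$ is identified with the function $A\mapsto\frac12\mathrm{tr}(AB)$ on $\mathfrak{so}_N$ and $x\in V_N$ with the function $v\mapsto(x,v)$ on $V_N$; thus $\mathbb{C}[\mathfrak{so}_N]\simeq S(\mathfrak{so}_N)$ and, for $\mathfrak a_N:=\mathfrak{so}_N\ltimes V_N$, polynomial functions of $(A,v)\in\mathfrak{so}_N\oplus V_N$ (identified with $\mathfrak a_N^*$) form $S(\mathfrak a_N)=S(\mathfrak{so}_N\oplus V_N)$. The Poisson algebra $H^{\mathrm{cl}}_\zeta(\mathfrak{so}_N,V_N)$ is $S(\mathfrak{so}_N\oplus V_N)$ as an algebra, with the Poisson bracket determined by $\{A,B\}=[A,B]$, $\{A,x\}=A(x)$ for $A,B\in\mathfrak{so}_N$, $x\in V_N$, and $\{x,y\}=\sum_j\zeta_j\gamma_{2j+1}(x,y)$ for $x,y\in V_N$, where $\gamma_{2j+1}(x,y)\in\mathbb{C}[\mathfrak{so}_N]\simeq S(\mathfrak{so}_N)$ are defined by $$(x,A(1+\tau^2A^2)^{-1}y)\det(1+\tau^2A^2)^{-1/2}=\sum_{j\ge0}\gamma_{2j+1}(x,y)(A)\tau^{2j}.$$ Here $\det(1+\tau^2A^2)^{\pm1/2}$ is the power series in $\tau^2$ with constant term 1. The Poisson center of a Poisson algebra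 $P$ is $\{a\in P:\{a,b\}=0\ \forall b\in P\}$. Define $p_j(A)$ by $\det(I_N+tA)=\sum_{j=0}^Np_j(A)t^j$, $b_0(A)=I_N$, and $b_k(A)=\sum_{j=0}^k(-1)^jp_j(A)A^{k-j}$ for $k>0$. Put $\psi_k(A,v)=(v,b_{2k}(A)v)$, and let $\tau_k\in S(\mathfrak a_N)$ be the element corresponding to $\psi_{k-1}$. For $N=2n+1$, $\widehat\psi_n(A,v)$ is the Pfaffian of the skew-symmetric matrix $\begin{pmatrix}A&v\\-v^{T}&0\end{pmatrix}$ of size $2n+2$ (so $\widehat\psi_n^2=\psi_n$), and $\widehat\tau_{n+1}\in S(\mathfrak a_{2n+1})$ is the corresponding element. In the formula for $c(t)$, $1/(1-t^{-2}z^2)$ is expanded as $\sum_{k\ge0}t^{-2k}z^{2k}$ and $\mathrm{Res}_{z=0}f(z)dz$ is the coefficient of $z^{-1}$; $c(t)$ is a Laurent series in $t^2$, and only $c_i$ with $i\ge1$ are used. *)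

(* Defs.v *)
From HB Require Import structures.
From mathcomp Require Import all_boot all_order all_fingroup all_algebra.
From mathcomp Require Import classical_sets cardinality fsbigop reals.
From mathcomp Require Import complex mpoly zify ring.

Set Implicit Arguments.
Unset Strict Implicit.
Unset Printing Implicit Defensive.

Import GRing.Theory.
Local Open Scope ring_scope.

(* A power series over S is its sequence of coefficients. *)

Section PowerSeries.
Variables (K : fieldType) (S : comAlgType K).
Implicit Types f g : nat -> S.

Definition ser_mul f g : nat -> S :=
  fun m => \sum_(i < m.+1) f i * g (m - i)%N.

Definition ser_one : nat -> S := fun m => (m == 0)%:R.

(* Course-of-values recursion: the m-th coefficient is [step] applied to the
   sequence of the m previous ones. *)
Fixpoint ser_prefix (step : seq S -> S) m : seq S :=
  if m is p.+1 then
    rcons (ser_prefix step p) (step (ser_prefix step p)) else [::].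

Definition ser_rec step : nat -> S := fun m => step (ser_prefix step m).

(* For f 0 = 1: the series g with f g = 1. *)
Definition ser_inv f : nat -> S := ser_rec (fun s =>
  if size s is m.+1 then - \sum_(i < m.+1) f (m.+1 - i)%N * s`_i else 1).

(* For f 0 = 1: the series g with g 0 = 1 and g g = f. *)
Definition ser_sqrt f : nat -> S := ser_rec (fun s =>
  if size s is m.+1
  then 2^-1 *: (f m.+1 - \sum_(i < m) s`_i.+1 * s`_(m - i)) else 1).

Lemma size_ser_prefix step m : size (ser_prefix step m) = m.
Proof. by elim: m => //= m IH; rewrite size_rcons IH. Qed.

Lemma nth_ser_prefix step m i :
  (i < m)%N -> (ser_prefix step m)`_i = ser_rec step i.
Proof.
elim: m => //= m IH; rewrite ltnS nth_rcons size_ser_prefix => le_im.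
by case: ltngtP le_im => [lt_im _||-> _] //; rewrite IH.
Qed.

Lemma ser_inv0 f : ser_inv f 0 = 1. Proof. by []. Qed.

Lemma ser_sqrt0 f : ser_sqrt f 0 = 1. Proof. by []. Qed.

Lemma ser_invP f : f 0%N = 1 -> ser_mul f (ser_inv f) =1 ser_one.
Proof.
move=> f0 [|m]; rewrite /ser_mul /ser_one.
  by rewrite big_ord1 f0 mul1r subnn.
rewrite (reindex_inj rev_ord_inj) /= big_ord_recr /= subnn f0 mul1r.
rewrite subn0 {2}/ser_inv /ser_rec size_ser_prefix.
apply/eqP; rewrite subr_eq0; apply/eqP; apply: eq_bigr => i _.
by rewrite nth_ser_prefix // !subSS subKn // ltnW.
Qed.

Lemma ser_sqrtP f : (2 : K) != 0 -> f 0%N = 1 ->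
  ser_mul (ser_sqrt f) (ser_sqrt f) =1 f.
Proof.
move=> nz2 f0 [|m]; rewrite /ser_mul.
  by rewrite big_ord1 mul1r f0.
rewrite big_ord_recl big_ord_recr /= /bump /= subn0 add1n subnn.
rewrite ser_sqrt0 mul1r mulr1.
set T := \sum_(i < m) _.
have -> : ser_sqrt f m.+1 = 2^-1 *: (f m.+1 - T).
  rewrite {1}/ser_sqrt /ser_rec size_ser_prefix; congr (_ *: (_ - _)).
  apply: eq_bigr => i _.
  by rewrite !nth_ser_prefix // ?ltnS ?leq_subr // add1n subSS.
by rewrite addrCA -scalerDl -mulr2n -(mulr_natr (2^-1) 2) mulVf // scale1r addrC subrK.
Qed.

End PowerSeries.

(* Formal sums of monomials z^a t^b, given by the coefficient at (a, b). *)

Section FormalSums.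
Variables (K : fieldType) (S : comAlgType K).

Definition fsum := int -> int -> S.

(* Each coefficient of the products formed below is a finite sum, see
   [cPoly_explicit]; the \sum over the set of all pairs of exponents is
   by convention 0 where infinitely many terms are nonzero. *)
Definition fsum_mul (F G : fsum) : fsum := fun a b =>
  \sum_(p \in [set: int * int]) F p.1 p.2 * G (a - p.1) (b - p.2).

(* f(z^r t^s); for (r, s) != (0, 0), z^a t^b = (z^r t^s)^m is only possible
   with m <= |a| + |b|. *)
Definition fsum_at (f : nat -> S) (r s : int) : fsum := fun a b =>
  \sum_(m < (absz a + absz b).+1 | (a == r *+ m) && (b == s *+ m)) f m.

(* The coefficients, as a series in t, of Res_{z=0} F dz. *)
Definition residue_z (F : fsum) : int -> S := F (-1).

Implicit Types (f : nat -> S) (G : fsum).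

Lemma fsum_atE f (r s : int) m : (r != 0) || (s != 0) ->
  fsum_at f r s (r *+ m) (s *+ m) = f m.
Proof.
move=> nz; have lt_m : (m < (absz (r *+ m) + absz (s *+ m)).+1)%N by nia.
rewrite /fsum_at (big_pred1 (Ordinal lt_m)) // => i /=; rewrite -val_eqE /=.
by apply/idP/idP; nia.
Qed.

Lemma fsum_at_eq0 f r s a b :
  (forall m, (a, b) != (r *+ m, s *+ m)) -> fsum_at f r s a b = 0.
Proof.
move=> ne; rewrite /fsum_at big_pred0 // => i; apply/negP => /andP[/eqP ea /eqP eb].
by case/eqP: (ne i); rewrite -ea -eb.
Qed.

Lemma fsum_mul_at f G (r s a b : int) M : (r != 0) || (s != 0) ->
  (forall m, (M <= m)%N -> f m * G (a - r *+ m) (b - s *+ m) = 0) ->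
  fsum_mul (fsum_at f r s) G a b =
  \sum_(m < M) f m * G (a - r *+ m) (b - s *+ m).
Proof.
move=> nz big0; rewrite /fsum_mul.
rewrite (@fsbigE _ _ _ _ _ [seq (r *+ m, s *+ m) | m <- iota 0 M]) //.
- rewrite big_map -[M in iota _ M]subn0 -/(index_iota 0 M) big_mkcond big_mkord.
  by apply: eq_bigr => m _ /=; rewrite mem_setT fsum_atE.
- rewrite map_inj_uniq ?iota_uniq // => i j []; nia.
- move=> [c d] _ /= nin; pose M' := (absz c + absz d).+1.
  have [/existsP[m /andP[/= /eqP cE /eqP dE]]|/existsPn ne] :=
      boolP [exists m : 'I_M', (c == r *+ m) && (d == s *+ m)].
    rewrite cE dE fsum_atE // big0 // leqNgt; apply: contra nin => lt_mM.
    by apply/mapP; exists (m : nat); rewrite ?mem_iota // cE dE.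
  by rewrite /fsum_at big_pred0 ?mul0r // => m; apply/negbTE/ne.
Qed.
End FormalSums.

Section MatrixFunctions.
Variables (K : fieldType) (S : comAlgType K) (N : nat).
Implicit Types (A : 'M[S]_N) (v : 'cV[S]_N).

Definition dot (x y : 'cV[S]_N) : S := (x^T *m y) 0 0.

(* det (I + t A) = \sum_j charcoef A j * t^j *)
Definition charcoef A (j : nat) : S :=
  (\det (1%:M + 'X *: map_mx polyC A))`_j.

(* det (1 + tau^2 A^2)^(1/2) and det (1 + tau^2 A^2)^(-1/2), as power series
   in tau^2. *)
Definition det_sqrt A : nat -> S := ser_sqrt (charcoef (A ^+ 2)).
Definition det_sqrtV A : nat -> S := ser_inv (det_sqrt A).

Lemma charcoef0 A : charcoef A 0 = 1.
Proof.
rewrite /charcoef -horner_coef0 -/(horner_eval 0 _) -det_map_mx.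
rewrite map_mxD map_mxZ map_mx1 /= /horner_eval hornerX scale0r addr0 det1 //.
Qed.

Lemma det_sqrtP A : (2 : K) != 0 ->
  ser_mul (det_sqrt A) (det_sqrt A) =1 charcoef (A ^+ 2).
Proof. by move=> nz2; apply: ser_sqrtP; rewrite ?charcoef0. Qed.

Lemma det_sqrtVP A : ser_mul (det_sqrt A) (det_sqrtV A) =1 ser_one S.
Proof. exact: ser_invP. Qed.

(* gamma j x y A is gamma_{2j+1}(x, y)(A); the inverse (1 + tau^2 A^2)^-1 is
   expanded as a geometric series. *)
Definition gamma (j : nat) (x y : 'cV[K]_N) A : S :=
  ser_mul (fun l => dot (map_mx (in_alg S) x)
                        (A *m (- A ^+ 2) ^+ l *m map_mx (in_alg S) y))
          (det_sqrtV A) j.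

Definition bmx A (k : nat) : 'M[S]_N :=
  if k is 0 then 1%:M
  else \sum_(j < k.+1) ((-1) ^+ j * charcoef A j) *: A ^+ (k - j).

Definition psi (k : nat) A v : S := dot v (bmx A k.*2 *m v).

(* For d even: the sum over all permutations counts each perfect matching
   2^(d/2) (d/2)! times. *)
Definition pfaffian d (M : 'M[S]_d) : S :=
  ((2 ^ d./2 * (d./2)`!)%:R^-1 : K) *:
  \sum_(s : 'S_d) (-1) ^+ s *
    \prod_(p : 'I_d * 'I_d | ~~ odd p.1 && (p.2 == p.1.+1 :> nat))
      M (s p.1) (s p.2).

Definition psihat A v : S := pfaffian (block_mx A v (- v^T) 0).

(* For zeta = [:: zeta_0; ...; zeta_k]: the factors are zeta(z^-2), the square
   root of det (1 + t^2 A^2), the inverse square root of det (1 + z^2 A^2),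
   z^-1 and 1 / (1 - t^-2 z^2); the coefficient at b is that of t^b. *)
Definition cseries (zeta : seq K) A : int -> S :=
  residue_z
    (fsum_mul (fsum_at (fun i => (zeta`_i)%:A) (-2) 0)
    (fsum_mul (fsum_at (det_sqrt A) 0 2)
    (fsum_mul (fsum_at (det_sqrtV A) 2 0)
    (fsum_mul (fsum_at (fun m => (m == 1)%:R) (-1) 0)
              (fsum_at (fun=> 1) 2 (-2)))))).

Definition cPoly (zeta : seq K) A (i : nat) : S :=
  (-1) ^+ i * cseries zeta A (2 * i)%:Z.

Lemma cPoly_explicit (zeta : seq K) A i : cPoly zeta A i =
  (-1) ^+ i * \sum_(m < size zeta)
     zeta`_m *: \sum_(e < m.+1) det_sqrtV A e * det_sqrt A (i + m - e)%N.
Proof.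
rewrite /cPoly /cseries /residue_z; congr (_ * _).
have geoE a b : fsum_mul (fsum_at (fun m => (m == 1)%:R) (-1) 0)
    (fsum_at (fun=> 1 : S) 2 (-2)) a b = fsum_at (fun=> 1) 2 (-2) (a + 1) b.
  rewrite (fsum_mul_at (M := 2)) //; last by move=> [|[|m]] //; rewrite mul0r.
  rewrite !big_ord_recr big_ord0 /= add0r mul0r add0r mul1r mulr1n.
  by rewrite opprK mul0rn subr0.
rewrite (fsum_mul_at (M := (size zeta))) //; last first.
  by move=> m le_m; rewrite nth_default // scale0r mul0r.
apply: eq_bigr => m _; rewrite -scalerAl mul1r; congr (_ *: _).
rewrite mul0rn subr0.
have HE q : fsum_mul (fsum_at (det_sqrtV A) 2 0) (fsum_mul
    (fsum_at (fun m => (m == 1)%:R) (-1) 0) (fsum_at (fun=> 1) 2 (-2)))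
    (-1 - (-2) *+ m) ((2 * i)%:Z - 2 *+ q) =
    \sum_(e < m.+1 | q == (i + m - e)%N) det_sqrtV A e.
  have zE e : ((m < e) || (q != i + m - e))%N ->
      fsum_at (fun=> 1 : S) 2 (-2) (-1 - -2 *+ m - 2 *+ e + 1)
       ((2 * i)%:Z - 2 *+ q - 0 *+ e) = 0.
    by move=> ne; apply: fsum_at_eq0 => l; apply/eqP => -[]; lia.
  rewrite (fsum_mul_at (M := m.+1)) //; last first.
    by move=> e lt_me; rewrite geoE zE ?lt_me ?mulr0.
  rewrite [RHS]big_mkcond; apply: eq_bigr => -[e /= lt_em] _; rewrite geoE.
  case: eqP => [qE|/eqP ne]; last by rewrite zE ?ne ?orbT ?mulr0.
  rewrite (_ : _ + 1 = 2 *+ (m - e)%N); last by lia.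
  rewrite (_ : _ - 0 *+ e = (-2) *+ (m - e)%N); last by lia.
  by rewrite fsum_atE ?mulr1.
rewrite (fsum_mul_at (M := (i + m).+1)) //; last first.
  move=> q lt_q; rewrite mul0rn subr0 HE big_pred0 ?mulr0 // => -[e le_e] /=.
  by apply/negbTE; lia.
under eq_bigr do rewrite mul0rn subr0 HE mulr_sumr.
rewrite (exchange_big_dep xpredT) //=; apply: eq_bigr => -[e lt_e] _ /=.
have lt_q : (i + m - e < (i + m).+1)%N by lia.
by rewrite (big_pred1 (Ordinal lt_q)) /= 1?mulrC // => q; rewrite -val_eqE.
Qed.
End MatrixFunctions.

Section PoissonAlgebra.
Variables (K : fieldType) (N : nat).

(* Coordinates of (A, v) in so_N + V_N: the A_ij with i < j and the v_i. *)
Definition coord_idx : finType :=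
  ({p : 'I_N * 'I_N | (p.1 < p.2)%N} + 'I_N)%type.

(* Polynomial functions of (A, v), identified with S(so_N + V_N) through
   [so_elt] and [vec_elt]. *)
Definition Sa : comAlgType K := {mpoly K[#|coord_idx|]}.

Definition poly_coord (s : coord_idx) : Sa := 'X_(enum_rank s).

(* The generic point (A, v): the value there of a polynomial expression in
   (A, v) is the corresponding element of Sa. *)
Definition genA : 'M[Sa]_N :=
  let U := \matrix_(i, j)
    oapp (fun p : {p : 'I_N * 'I_N | (p.1 < p.2)%N} => poly_coord (inl p)) 0
         (insub (i, j)) in
  U - U^T.

Definition genv : 'cV[Sa]_N := \col_i poly_coord (inr i).

(* B in so_N as the function A |-> tr (A B) / 2 *)
Definition so_elt (B : 'M[K]_N) : Sa :=
  2^-1 *: \tr (genA *m map_mx (in_alg Sa) B).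

(* x in V_N as the function v |-> (x, v) *)
Definition vec_elt (x : 'cV[K]_N) : Sa := dot (map_mx (in_alg Sa) x) genv.

(* The elements of so_N and V_N that the coordinates are, see [coord_so] and
   [coord_vec]. *)
Definition so_basis (p : {p : 'I_N * 'I_N | (p.1 < p.2)%N}) : 'M[K]_N :=
  delta_mx (val p).2 (val p).1 - delta_mx (val p).1 (val p).2.
Definition vec_basis (i : 'I_N) : 'cV[K]_N := delta_mx i 0.

Definition Hcl_VV (zeta : seq K) (x y : 'cV[K]_N) : Sa :=
  \sum_(j < size zeta) zeta`_j *: gamma j x y genA.

Definition Hcl_coord (zeta : seq K) (s t : coord_idx) : Sa :=
  match s, t with
  | inl p, inl q =>
      so_elt (so_basis p *m so_basis q - so_basis q *m so_basis p)
  | inl p, inr i => vec_elt (so_basis p *m vec_basis i)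
  | inr i, inl p => - vec_elt (so_basis p *m vec_basis i)
  | inr i, inr j => Hcl_VV zeta (vec_basis i) (vec_basis j)
  end.

(* The antisymmetric biderivation with the above values on coordinates;
   [Hcl_bracket_so_so], [Hcl_bracket_so_vec] and [Hcl_bracket_vec_vec] are its
   defining relations. *)
Definition Hcl_bracket (zeta : seq K) (f g : Sa) : Sa :=
  \sum_s \sum_t mderiv (enum_rank s) f * mderiv (enum_rank t) g
                * Hcl_coord zeta s t.

Definition Poisson_center (br : Sa -> Sa -> Sa) (a : Sa) : Prop :=
  forall b, br a b = 0.

Definition tau (k : nat) : Sa := psi k.-1 genA genv.
Definition tauhat : Sa := psihat genA genv.
Definition celt (zeta : seq K) (i : nat) : Sa := cPoly zeta genA i.

Lemma genAE i j : genA i j =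
  oapp (fun p => poly_coord (inl p)) 0 (insub (i, j)) -
  oapp (fun p => poly_coord (inl p)) 0 (insub (j, i)).
Proof. by rewrite !mxE. Qed.

Lemma genA_skew : genA^T = - genA.
Proof. by apply/matrixP => i j; rewrite mxE [RHS]mxE !genAE opprB. Qed.

Lemma so_elt_is_linear : linear so_elt.
Proof.
move=> a B C; rewrite /so_elt map_mxD mulmxDr mxtraceD scalerDr; congr (_ + _).
rewrite scalerA mulrC -scalerA; congr (_ *: _).
rewrite !/mxtrace scaler_sumr; apply: eq_bigr => i _.
rewrite !mxE scaler_sumr; apply: eq_bigr => j _.
by rewrite !mxE -!scalerAr !mulr1 scalerA.
Qed.
HB.instance Definition _ := GRing.isLinear.Build K _ _ _ _ so_elt_is_linear.

Lemma so_eltZ a (B : 'M[K]_N) : so_elt (a *: B) = a *: so_elt B.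
Proof. exact: linearZ. Qed.

Lemma vec_elt_is_linear : linear vec_elt.
Proof.
move=> a x y; rewrite /vec_elt /dot !mxE scaler_sumr -big_split.
by apply: eq_bigr => i _; rewrite !mxE -!scalerAl !mul1r scalerDl scalerA.
Qed.
HB.instance Definition _ := GRing.isLinear.Build K _ _ _ _ vec_elt_is_linear.

Lemma vec_eltZ a (x : 'cV[K]_N) : vec_elt (a *: x) = a *: vec_elt x.
Proof. exact: linearZ. Qed.

Lemma coord_so p : (2 : K) != 0 -> so_elt (so_basis p) = poly_coord (inl p).
Proof.
move=> nz2; rewrite /so_elt /so_basis map_mxB !map_delta_mx mulmxBr raddfB /=.
have trE i j : \tr (genA *m delta_mx j i) = genA i j.
  rewrite /mxtrace (bigD1 i) //= big1 ?addr0 => [|k neki].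
    rewrite mxE (bigD1 j) //= big1 ?addr0 => [|k nekj].
      by rewrite [delta_mx _ _ _ _]mxE !eqxx mulr1.
    by rewrite [delta_mx _ _ _ _]mxE (negbTE nekj) mulr0.
  by rewrite mxE big1 // => l _; rewrite [delta_mx _ _ _ _]mxE (negbTE neki) andbF mulr0.
case: p => -[i j] /= lt_ij; rewrite !trE !genAE.
rewrite insubT /= insubF /= ?subr0 ?sub0r ?opprK; last first.
  by apply/negbTE; rewrite -leqNgt ltnW.
by rewrite -mulr2n -scaler_nat scalerA mulVf // scale1r.
Qed.

Lemma coord_vec i : vec_elt (vec_basis i) = poly_coord (inr i).
Proof.
rewrite /vec_elt /dot mxE (bigD1 i) //= big1 ?addr0 => [|k neki].
  by rewrite !mxE !eqxx rmorph1 mul1r.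
by rewrite !mxE (negbTE neki) rmorph0 mul0r.
Qed.

Lemma skew_sum (B : 'M[K]_N) : (2 : K) != 0 -> B^T = - B ->
  B = \sum_p B (val p).2 (val p).1 *: so_basis p.
Proof.
move=> nz2 skB; have Bji i j : B j i = - B i j.
  by move/matrixP: skB => /(_ i j); rewrite !mxE.
have Bii i : B i i = 0.
  apply/eqP; rewrite -(mulrI_eq0 _ (mulfI nz2)) mulr_natl mulr2n {1}Bji.
  by rewrite addNr.
have sumE i j : \sum_(p : {p : 'I_N * 'I_N | (p.1 < p.2)%N})
    (val p == (i, j))%:R = (i < j)%N%:R :> K.
  have [lt_ij|ge_ij] := boolP (i < j)%N.
    rewrite (bigD1 (exist _ (i, j) lt_ij)) //= eqxx big1 ?addr0 // => p ne.
    by move: ne; rewrite -val_eqE => /negbTE->.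
  rewrite big1 // => -[p /= lt_p] _; case: eqP => // pE.
  by rewrite pE /= (negbTE ge_ij) in lt_p.
apply/matrixP => i j; rewrite summxE.
under eq_bigr => p _.
  have -> : (B (val p).2 (val p).1 *: so_basis p) i j =
      ((val p == (i, j))%:R + (val p == (j, i))%:R) * B i j.
    case: p => -[k l] /= lt_kl; rewrite !mxE !xpair_eqE mulrDl mulrBr addrC.
    rewrite (eq_sym i l) (eq_sym j k) (eq_sym i k) (eq_sym j l) -mulrN.
    congr (_ + _); last first.
      by rewrite andbC; case: andP => [[/eqP-> /eqP->]|_]; rewrite ?mulr1 ?mul1r ?mulr0 ?mul0r.
    case: andP => [[/eqP-> /eqP->]|_]; rewrite ?oppr0 ?mulr0 ?mul0r //.
    by rewrite mulrN1 mul1r Bji opprK.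
  over.
rewrite -mulr_suml big_split /= !sumE.
have [|_|/val_inj->] := ltngtP i j; rewrite ?addr0 ?add0r ?mul1r //.
by rewrite Bii mulr0.
Qed.

Lemma Hcl_bracket_coord zeta (s t : coord_idx) :
  Hcl_bracket zeta (poly_coord s) (poly_coord t) = Hcl_coord zeta s t.
Proof.
have mdE u w : mderiv (enum_rank u) (poly_coord w) = (u == w)%:R :> Sa.
  rewrite mderivX mnm1E (inj_eq enum_rank_inj) eq_sym.
  case: eqP => [->|_]; last by rewrite scale0r.
  by rewrite scale1r (_ : (_ - _)%MM = 0%MM) ?mpolyX0 //; apply/mnmP => i; rewrite mnmBE subnn mnm0E.
rewrite /Hcl_bracket (bigD1 s) //= (bigD1 t) //= !big1 ?addr0.
- by rewrite !mdE !eqxx !mul1r.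
- by move=> u ne; rewrite big1 // => w _; rewrite !mdE (negbTE ne) !mul0r.
- by move=> u ne; rewrite !mdE (negbTE ne) mulr0 mul0r.
Qed.

Lemma Hcl_bracket_linearl zeta g : linear (Hcl_bracket zeta ^~ g : Sa -> Sa).
Proof.
move=> a f f'; rewrite /Hcl_bracket scaler_sumr -big_split; apply: eq_bigr => s _.
rewrite /= scaler_sumr -big_split; apply: eq_bigr => t _ /=.
by rewrite linearP /= !mulrDl -!scalerAl.
Qed.

Lemma Hcl_bracket_linearr zeta f : linear (Hcl_bracket zeta f : Sa -> Sa).
Proof.
move=> a g g'; rewrite /Hcl_bracket scaler_sumr -big_split; apply: eq_bigr => s _.
rewrite /= scaler_sumr -big_split; apply: eq_bigr => t _ /=.
by rewrite linearP /= mulrDr mulrDl -scalerAr -!scalerAl.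
Qed.

Lemma Hcl_bracketMl zeta (f f' g : Sa) :
  Hcl_bracket zeta (f * f') g =
  f * Hcl_bracket zeta f' g + Hcl_bracket zeta f g * f'.
Proof.
rewrite /Hcl_bracket mulr_sumr mulr_suml -big_split; apply: eq_bigr => s _.
rewrite /= mulr_sumr mulr_suml -big_split; apply: eq_bigr => t _ /=.
by rewrite mderivM; ring.
Qed.

Lemma Hcl_bracketMr zeta (f g g' : Sa) :
  Hcl_bracket zeta f (g * g') =
  g * Hcl_bracket zeta f g' + Hcl_bracket zeta f g * g'.
Proof.
rewrite /Hcl_bracket mulr_sumr mulr_suml -big_split; apply: eq_bigr => s _.
rewrite /= mulr_sumr mulr_suml -big_split; apply: eq_bigr => t _ /=.
by rewrite mderivM; ring.
Qed.

HB.instance Definition _ (zeta : seq K) (f : Sa) :=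
  GRing.isLinear.Build K Sa Sa _ (Hcl_bracket zeta f)
    (@Hcl_bracket_linearr zeta f).

Lemma Hcl_bracketZr zeta a (f g : Sa) :
  Hcl_bracket zeta f (a *: g) = a *: Hcl_bracket zeta f g.
Proof. exact: linearZ. Qed.

Lemma Hcl_bracket_suml zeta (I : finType) (a : I -> K) (F : I -> Sa) g :
  Hcl_bracket zeta (\sum_i a i *: F i) g =
  \sum_i a i *: Hcl_bracket zeta (F i) g.
Proof.
pose h := GRing.isLinear.Build K _ _ _ _ (Hcl_bracket_linearl zeta g).
pose hl : {linear Sa -> Sa} := HB.pack (Hcl_bracket zeta ^~ g : Sa -> Sa) h.
rewrite -[LHS]/(hl _) linear_sum; apply: eq_bigr => i _.
by rewrite linearZ.
Qed.

Lemma so_elt_sum (B : 'M[K]_N) : (2 : K) != 0 -> B^T = - B ->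
  so_elt B = \sum_p B (val p).2 (val p).1 *: poly_coord (inl p).
Proof.
move=> nz2 skB; rewrite {1}(skew_sum nz2 skB) linear_sum.
by apply: eq_bigr => p _; rewrite linearZ /= coord_so.
Qed.

Lemma vec_sum (x : 'cV[K]_N) : x = \sum_i x i 0 *: vec_basis i.
Proof.
rewrite {1}(matrix_sum_delta x); apply: eq_bigr => i _.
by rewrite big_ord1.
Qed.

Lemma vec_elt_sum (x : 'cV[K]_N) : vec_elt x = \sum_i x i 0 *: poly_coord (inr i).
Proof.
rewrite {1}(vec_sum x) linear_sum.
by apply: eq_bigr => p _; rewrite linearZ /= coord_vec.
Qed.

Lemma Hcl_bracket_so_so zeta (B C : 'M[K]_N) : (2 : K) != 0 -> B^T = - B -> C^T = - C ->
  Hcl_bracket zeta (so_elt B) (so_elt C) = so_elt (B *m C - C *m B).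
Proof.
move=> nz2 skB skC; rewrite [so_elt B]so_elt_sum // Hcl_bracket_suml.
rewrite {2}(skew_sum nz2 skB) {3}(skew_sum nz2 skB).
rewrite mulmx_suml mulmx_sumr -sumrB linear_sum; apply: eq_bigr => p _ /=.
rewrite -scalemxAl -scalemxAr -scalerBr so_eltZ; congr (_ *: _).
rewrite so_elt_sum // linear_sum.
rewrite {2}(skew_sum nz2 skC) {3}(skew_sum nz2 skC).
rewrite mulmx_suml mulmx_sumr -sumrB linear_sum; apply: eq_bigr => q _ /=.
rewrite -scalemxAl -scalemxAr -scalerBr so_eltZ Hcl_bracketZr; congr (_ *: _).
by rewrite Hcl_bracket_coord.
Qed.

Lemma Hcl_bracket_so_vec zeta (B : 'M[K]_N) x : (2 : K) != 0 -> B^T = - B ->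
  Hcl_bracket zeta (so_elt B) (vec_elt x) = vec_elt (B *m x).
Proof.
move=> nz2 skB; rewrite so_elt_sum // Hcl_bracket_suml {2}(skew_sum nz2 skB).
rewrite mulmx_suml linear_sum; apply: eq_bigr => p _ /=.
rewrite -scalemxAl vec_eltZ; congr (_ *: _).
rewrite vec_elt_sum {2}(vec_sum x) mulmx_sumr !linear_sum; apply: eq_bigr => i _ /=.
by rewrite -scalemxAr vec_eltZ Hcl_bracketZr Hcl_bracket_coord.
Qed.

Lemma gamma_linearl (S : comAlgType K) j y (A : 'M[S]_N) : linear (fun x => gamma j x y A).
Proof.
move=> a x x'; rewrite /gamma /ser_mul scaler_sumr -big_split /=.
apply: eq_bigr => l _; rewrite scalerAl -mulrDl; congr (_ * _).
rewrite /dot !mxE scaler_sumr -big_split /=; apply: eq_bigr => i _.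
by rewrite !mxE rmorphD rmorphM /= mulrDl -mulrA mulr_algl.
Qed.

Lemma gamma_skew (S : comAlgType K) j x y (A : 'M[S]_N) : A^T = - A ->
  gamma j x y A = - gamma j y x A :> S.
Proof.
move=> skA; rewrite /gamma /ser_mul -sumrN; apply: eq_bigr => l _.
rewrite -[RHS]mulNr; congr (_ * _); rewrite /dot.
set X := map_mx _ x; set Y := map_mx _ y; set B := _ ^+ _.
have MT : (- A ^+ 2)^T = - A ^+ 2.
  have -> : A ^+ 2 = A *m A by [].
  by rewrite linearN /= trmx_mul skA mulNmx mulmxN opprK.
have BT : B^T = B.
  rewrite /B; elim: (l : nat) => [|m IH]; first by rewrite !expr0 trmx1.
  by rewrite {1}exprS trmx_mul IH MT [RHS]exprSr.
have comAB : A *m B = B *m A.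
  by apply: commrX; apply: commrN; apply: commrX.
have -> (u : 'M[S]_1) : u 0 0 = u^T 0 0 by rewrite mxE.
by rewrite !trmx_mul trmxK BT skA !mulmxN mulNmx [LHS]mxE comAB !mulmxA.
Qed.

Lemma Hcl_VV_skew zeta (x y : 'cV[K]_N) : Hcl_VV zeta x y = - Hcl_VV zeta y x.
Proof.
rewrite /Hcl_VV -sumrN; apply: eq_bigr => j _.
by rewrite (gamma_skew _ _ _ genA_skew) scalerN.
Qed.

Lemma Hcl_VV_linearl zeta (y : 'cV[K]_N) : linear (Hcl_VV zeta ^~ y).
Proof.
move=> a x x'; rewrite /Hcl_VV scaler_sumr -big_split; apply: eq_bigr => j _ /=.
by rewrite gamma_linearl scalerDr !scalerA mulrC.
Qed.

Lemma Hcl_VV_suml zeta (y x : 'cV[K]_N) :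
  Hcl_VV zeta x y = \sum_i x i 0 *: Hcl_VV zeta (vec_basis i) y.
Proof.
pose h := GRing.isLinear.Build K _ _ _ _ (Hcl_VV_linearl zeta y).
pose hl : {linear 'cV[K]_N -> Sa} := HB.pack (Hcl_VV zeta ^~ y : _ -> Sa) h.
rewrite -[LHS]/(hl _) {1}(vec_sum x) linear_sum; apply: eq_bigr => i _.
by rewrite linearZ.
Qed.

Lemma Hcl_bracket_vec_vec zeta (x y : 'cV[K]_N) :
  Hcl_bracket zeta (vec_elt x) (vec_elt y) = Hcl_VV zeta x y.
Proof.
rewrite [vec_elt x]vec_elt_sum Hcl_bracket_suml Hcl_VV_suml.
apply: eq_bigr => i _; congr (_ *: _).
rewrite vec_elt_sum Hcl_VV_skew Hcl_VV_suml linear_sum -sumrN.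
apply: eq_bigr => j _.
by rewrite /= Hcl_bracketZr Hcl_bracket_coord -scalerN -Hcl_VV_skew.
Qed.

Lemma Hcl_bracket_antisym zeta (f g : Sa) :
  Hcl_bracket zeta f g = - Hcl_bracket zeta g f.
Proof.
rewrite /Hcl_bracket exchange_big -sumrN; apply: eq_bigr => s _.
rewrite -sumrN; apply: eq_bigr => t _ /=; rewrite -mulrN mulrC [_ * mderiv _ f]mulrC.
rewrite [LHS]mulrC; congr (_ * _).
case: s t => [p|i] [q|j] /=; rewrite ?opprK //.
- by rewrite -[RHS]scaleN1r -so_eltZ scaleN1r opprB.
- exact: Hcl_VV_skew.
Qed.
End PoissonAlgebra.

(* The subset P of a polynomial ring is the subalgebra generated by the entries
   of g, and these are algebraically independent. *)
Definition free_polynomial_generators (K : fieldType) (n m : nat)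
    (P : {mpoly K[n]} -> Prop) (g : m.-tuple {mpoly K[n]}) : Prop :=
  injective (fun q : {mpoly K[m]} => q \mPo g) /\
  (forall a, P a <-> exists q : {mpoly K[m]}, a = q \mPo g).

(* Main.v *)
(* Centrality of tau_k + c_k: bracketing with x in V_N moves A by v x^T - x v^T,
   and the resulting variations of psi_{k-1} and of c_k, both read off the
   series (1 + u A^2)^-1 det (1 + u A^2)^(+-1/2), cancel by telescoping; that of
   the Pfaffian follows from Pf (g M g^T) = det g Pf M.

   Completeness for zeta = 0 is by induction from N to N + 2. Fix isotropic e, f
   in C^2 with (e, f) = 1. The points with v = e and A f = 0 form a copy of
   so_N + V_N, and restriction to them maps the center for N + 2 to the center
   for N, killing tau_1 and sending tau_{k+2} to - tau_{k+1} and the Pfaffian to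
   a nonzero multiple of the Pfaffian. The torus generated by e f^T - f e^T
   bounds the degree in v of the restriction by that of the function. A central
   function whose restriction vanishes is zero wherever (v, v) = 0, by moving v
   to a multiple of e with exp of an element of so_{N+2} and then A by the
   translations v u^T - u v^T; hence it is divisible by tau_1.

   For general zeta, the component of highest degree in v of a central function
   is central for zeta = 0, so it can be removed by subtracting a polynomial in
   the tau_k + c_k and the Pfaffian, whose components of highest degree are
   those of the generators for zeta = 0; the same remark gives independence.

   Elements of Sa are evaluated at points (A, v) over arbitrary commutative
   algebras, in particular over polynomial rings, so that one-parameter groups
   become polynomial paths and the formal derivative replaces analysis. *)

Require Import Defs.
From HB Require Import structures.
From mathcomp Require Import all_boot all_order all_fingroup all_algebra.
From mathcomp Require Import boolp reals complex mpoly zify ring.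

Set Implicit Arguments.
Unset Strict Implicit.
Unset Printing Implicit Defensive.

Import Order.TTheory GRing.Theory Num.Theory.
Local Open Scope ring_scope.

(** * Evaluation and derivations *)

(** Degree bookkeeping shapes the induction. On the slice the vector w of V_n sits inside the matrix
    [sl A w], so restriction could turn degree in A into degree in v; the torus excludes this. Once
    deg (rho h) <= deg h is known, a lift of an expression for rho h can be subtracted without
    raising the degree, the quotient by tau_1 has degree smaller by 2, and the recursion stops. This
    is why [gens_generate] bounds the weighted degree of the polynomial that it produces (weight 2
    for each tau_k, 1 for the Pfaffian). The same bound keeps the correction for general zeta in the
    right degree. Freeness is carried along with generation: it also shows that the scalar by which
    the Pfaffian restricts is nonzero. Steps of 2 preserve parity; the bases are N = 0, where only
    constants exist, and N = 1, where the Pfaffian is the single coordinate v. At N = 2 the cone is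
    a pair of lines, and the open condition (f, v) != 0 would miss one of them, so that line needs
    its own argument. *)

Lemma mpoly_var_ind (R : comNzRingType) n (P : {mpoly R[n]} -> Prop) :
  (forall c, P c%:MP) -> (forall p q, P p -> P q -> P (p + q)) ->
  (forall i p, P p -> P ('X_i * p)) -> forall p, P p.
Proof.
move=> PC PD PX; have PM d m c : mdeg m = d -> P (c *: 'X_[m]).
  elim: d m => [|d IH] m.
    move/eqP; rewrite mdeg_eq0 => /eqP->.
    by rewrite mpolyX0 alg_mpolyC.
  move=> dm; have [i mi] : exists i, m i != 0%N.
    apply/existsP; apply: contra_eqT dm => /existsPn m0.
    rewrite (_ : m = 0%MM) ?mdeg0 //; apply/mnmP => i.
    by move: (m0 i); rewrite negbK mnm0E => /eqP.
  have mE : m = (U_(i) + (m - U_(i)))%MM.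
    by rewrite addmC submK // lep1mP.
  move: dm; rewrite mE mdegD mdeg1 add1n => -[dm].
  by rewrite mpolyXD scalerAr; apply: PX; apply: IH.
elim/mpolyind => [|c m p _ _ Pp]; first by rewrite -mpolyC0; apply: PC.
by apply: PD => //; apply: PM.
Qed.

Section Kpoly.
Variables (K : fieldType) (S : comAlgType K).

(** The usual scalars of [{poly S}] lie in [S]. This copy has scalars in [K], so it is again an
    algebra over which elements of [Sa] can be evaluated, and the construction iterates. *)
Definition kpoly : Type := {poly S}.
HB.instance Definition _ := GRing.ComNzRing.on kpoly.
Definition kscale (c : K) (p : kpoly) : kpoly := (c%:A : S) *: (p : {poly S}).
Fact kscaleA a b v : kscale a (kscale b v) = kscale (a * b) v.
Proof. by rewrite /kscale scalerA -in_algE -rmorphM. Qed.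
Fact kscale1 : left_id 1 kscale.
Proof. by move=> p; rewrite /kscale scale1r scale1r. Qed.
Fact kscaleDr : right_distributive kscale +%R.
Proof. by move=> c p q; rewrite /kscale scalerDr. Qed.
Fact kscaleDl v : {morph kscale^~ v : a b / a + b}.
Proof. by move=> a b; rewrite /kscale !scalerDl. Qed.
HB.instance Definition _ := GRing.Zmodule_isLmodule.Build K kpoly
  kscaleA kscale1 kscaleDr kscaleDl.
Fact kscaleAl (a : K) (u v : kpoly) : a *: (u * v) = (a *: u) * v.
Proof. exact: (scalerAl (a%:A : S) (u : {poly S}) v). Qed.
HB.instance Definition _ := GRing.Lmodule_isLalgebra.Build K kpoly kscaleAl.
HB.instance Definition _ := GRing.Lalgebra_isComAlgebra.Build K kpoly.

Lemma kpoly_algE (c : K) : c%:A = (c%:A : S)%:P :> kpoly.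
Proof.
by rewrite -[LHS]/((c%:A : S) *: (1 : {poly S})) alg_polyC.
Qed.
End Kpoly.

Section Derivation.
Variables (K : fieldType) (S : comAlgType K).

(** A predicate on bare functions, since it is used for brackets, partial derivatives, formal
    derivatives and their coefficientwise extensions alike. *)
Definition derivation (D : S -> S) :=
  [/\ {morph D : x y / x + y}, forall a b, D (a * b) = D a * b + a * D b
    & forall c : K, D c%:A = 0].

Variables (D : S -> S) (derD : derivation D).

Lemma derD' : {morph D : x y / x + y}. Proof. by case: derD. Qed.
Lemma derM a b : D (a * b) = D a * b + a * D b. Proof. by case: derD. Qed.
Lemma derC (c : K) : D c%:A = 0. Proof. by case: derD. Qed.
Lemma der0 : D 0 = 0. Proof. by have := derC 0; rewrite scale0r. Qed.
Lemma der1 : D 1 = 0. Proof. by have := derC 1; rewrite scale1r. Qed.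
Lemma derN a : D (- a) = - D a.
Proof. by apply/eqP; rewrite -addr_eq0 -derD' addNr der0. Qed.
Lemma derZ (c : K) a : D (c *: a) = c *: D a.
Proof. by rewrite -mulr_algl derM derC mul0r add0r mulr_algl. Qed.
Lemma der_sum I (r : seq I) (P : pred I) F :
  D (\sum_(i <- r | P i) F i) = \sum_(i <- r | P i) D (F i).
Proof. exact: (big_morph D derD' der0). Qed.
Lemma der_nat n : D n%:R = 0.
Proof. by elim: n => [|n IH]; rewrite ?der0 // mulrS derD' der1 IH addr0. Qed.
Lemma der_sign n : D ((-1) ^+ n) = 0.
Proof. by rewrite -signr_odd; case: (odd n); rewrite ?expr0 ?derN ?der1 ?oppr0. Qed.

Lemma derMx m n p (A : 'M[S]_(m, n)) (B : 'M[S]_(n, p)) :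
  map_mx D (A *m B) = map_mx D A *m B + A *m map_mx D B.
Proof.
apply/matrixP => i j; rewrite !mxE der_sum -big_split; apply: eq_bigr => k _.
by rewrite !mxE derM.
Qed.

Lemma derDx m n (A B : 'M[S]_(m, n)) : map_mx D (A + B) = map_mx D A + map_mx D B.
Proof. by apply/matrixP => i j; rewrite !mxE derD'. Qed.

Lemma derNx m n (A : 'M[S]_(m, n)) : map_mx D (- A) = - map_mx D A.
Proof. by apply/matrixP => i j; rewrite !mxE derN. Qed.

Lemma derZx m n (a : S) (A : 'M[S]_(m, n)) :
  map_mx D (a *: A) = D a *: A + a *: map_mx D A.
Proof. by apply/matrixP => i j; rewrite !mxE derM. Qed.

Lemma der1x n : map_mx D (1%:M : 'M[S]_n) = 0.
Proof. by apply/matrixP => i j; rewrite !mxE der_nat. Qed.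

Lemma derTx m n (A : 'M[S]_(m, n)) : map_mx D A^T = (map_mx D A)^T.
Proof. by rewrite map_trmx. Qed.

Lemma der_algx m n (A : 'M[K]_(m, n)) : map_mx D (map_mx (in_alg S) A) = 0.
Proof. by apply/matrixP => i j; rewrite !mxE derC. Qed.

End Derivation.

Section Eval.
Variables (K : fieldType) (N : nat).
Local Notation idx := (coord_idx N).
Local Notation Sa := (Sa K N).

Definition ev (S : comAlgType K) (P : idx -> S) (f : Sa) : S :=
  mmap (in_alg S) (fun k => P (enum_val k)) f.
HB.instance Definition _ (S : comAlgType K) (P : idx -> S) :=
  GRing.RMorphism.copy (ev P) (mmap (in_alg S) (fun k => P (enum_val k))).

Lemma Sa_ind (Q : Sa -> Prop) :
  (forall c : K, Q c%:A) -> (forall p q, Q p -> Q q -> Q (p + q)) ->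
  (forall s p, Q p -> Q (poly_coord K s * p)) -> forall p, Q p.
Proof.
move=> QC QD QX; elim/mpoly_var_ind => // [c|i p Qp].
  by rewrite -alg_mpolyC; apply: QC.
by have := QX (enum_val i) p Qp; rewrite /poly_coord enum_valK.
Qed.

Variable S : comAlgType K.
Implicit Types (P : idx -> S) (A : 'M[S]_N) (v : 'cV[S]_N).

Lemma ev_coord P s : ev P (poly_coord K s) = P s.
Proof. by rewrite /ev mmapX mmap1U enum_rankK. Qed.

Lemma ev_alg P (c : K) : ev P c%:A = c%:A.
Proof. by rewrite alg_mpolyC /ev mmapC. Qed.

Lemma eq_ev P P' : P =1 P' -> ev P =1 ev P'.
Proof.
move=> eP f; elim/Sa_ind: f => [c|p q IHp IHq|s p IH]; first by rewrite !ev_alg.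
  by rewrite !rmorphD /= IHp IHq.
by rewrite !rmorphM /= !ev_coord eP IH.
Qed.

Lemma mderiv_coord s t : mderiv (enum_rank s) (poly_coord K t) = (s == t)%:R :> Sa.
Proof.
rewrite mderivX mnm1E (inj_eq enum_rank_inj) eq_sym.
case: eqP => [->|_]; last by rewrite scale0r.
rewrite scale1r (_ : (_ - _)%MM = 0%MM) ?mpolyX0 //.
by apply/mnmP => i; rewrite mnmBE subnn mnm0E.
Qed.

(** The differential of [f] at the point [P], applied to the tangent vector [Q]. *)
Definition dev P (Q : idx -> S) (f : Sa) : S :=
  \sum_s ev P (mderiv (enum_rank s) f) * Q s.

Lemma dev_alg P Q (c : K) : dev P Q c%:A = 0.
Proof. by rewrite /dev big1 // => s _; rewrite alg_mpolyC mderivC rmorph0 mul0r. Qed.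

Lemma devD P Q f g : dev P Q (f + g) = dev P Q f + dev P Q g.
Proof.
by rewrite /dev -big_split; apply: eq_bigr => s _ /=; rewrite mderivD rmorphD mulrDl.
Qed.

Lemma devM P Q f g : dev P Q (f * g) = dev P Q f * ev P g + ev P f * dev P Q g.
Proof.
rewrite /dev mulr_suml mulr_sumr -big_split; apply: eq_bigr => s _ /=.
by rewrite mderivM rmorphD !rmorphM /= mulrDl mulrA [X in X + _]mulrAC.
Qed.

Lemma dev_coord P Q s : dev P Q (poly_coord K s) = Q s.
Proof.
rewrite /dev (bigD1 s) //= mderiv_coord eqxx rmorph1 mul1r big1 ?addr0 // => t /negPf ne.
by rewrite mderiv_coord ne rmorph0 mul0r.
Qed.

Lemma eq_dev P Q Q' f : Q =1 Q' -> dev P Q f = dev P Q' f.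
Proof. by move=> eQ; apply: eq_bigr => s _; rewrite eQ. Qed.

(** Both sides are additive, satisfy Leibniz over [ev P] and kill constants, so agreement on
    coordinates suffices. *)
Lemma chain_rule D P f : derivation D -> D (ev P f) = dev P (D \o P) f.
Proof.
move=> dD; elim/Sa_ind: f => [c|p q IHp IHq|s p IH].
- by rewrite ev_alg derC // dev_alg.
- by rewrite rmorphD /= derD' // devD IHp IHq.
- by rewrite rmorphM /= derM // devM ev_coord dev_coord IH.
Qed.

(** Only entries above the diagonal are read, so evaluating [genA] here returns [A] only when [A] is
    skew. *)
Definition pt A v : idx -> S := fun s =>
  match s with inl p => A (val p).1 (val p).2 | inr i => v i 0 end.

Lemma skew_ji A i j : A^T = - A -> A j i = - A i j.
Proof. by move/matrixP/(_ i j); rewrite !mxE. Qed.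

Lemma skew_ii A i : (2 : K) != 0 -> A^T = - A -> A i i = 0.
Proof.
move=> nz2 skA; have : (2 : K) *: A i i = 0.
  by rewrite scaler_nat mulr2n {1}(skew_ji _ _ skA) addNr.
by move/(congr1 (fun x => 2^-1 *: x)); rewrite scalerA mulVf // scale1r scaler0.
Qed.

Lemma ev_genA A v : (2 : K) != 0 -> A^T = - A -> map_mx (ev (pt A v)) (genA K N) = A.
Proof.
move=> nz2 skA; apply/matrixP => i j; rewrite mxE genAE.
have [lt_ij|lt_ji|/val_inj->] := ltngtP i j.
- by rewrite insubT insubF /= ?subr0 ?ev_coord // ltnNge ltnW.
- rewrite insubF ?insubT /= ?sub0r ?rmorphN /=; last by rewrite ltnNge ltnW.
  by rewrite ev_coord /= (skew_ji i j skA) opprK.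
- by rewrite subrr rmorph0 skew_ii.
Qed.

Lemma ev_genv A v : map_mx (ev (pt A v)) (genv K N) = v.
Proof. by apply/colP => i; rewrite !mxE ev_coord. Qed.

End Eval.

Section EvalGen.
Variables (K : fieldType) (N : nat).

Lemma ev_mor (S T : comAlgType K) (h : {rmorphism S -> T}) (P : coord_idx N -> S) f :
  (forall c : K, h c%:A = c%:A) -> h (ev P f) = ev (h \o P) f.
Proof.
move=> hC; elim/Sa_ind: f => [c|p q IHp IHq|s p IH]; first by rewrite !ev_alg hC.
  by rewrite !rmorphD /= IHp IHq.
by rewrite !rmorphM /= !ev_coord IH.
Qed.

Lemma map_pt (S T : comAlgType K) (h : S -> T) (A : 'M[S]_N) (v : 'cV[S]_N) :
  h \o pt A v =1 pt (map_mx h A) (map_mx h v).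
Proof. by case=> [p|i]; rewrite /= mxE. Qed.

Lemma ev_pt_mor (S T : comAlgType K) (h : {rmorphism S -> T}) (A : 'M[S]_N) (v : 'cV[S]_N) f :
  (forall c : K, h c%:A = c%:A) ->
  h (ev (pt A v) f) = ev (pt (map_mx h A) (map_mx h v)) f.
Proof. by move=> hC; rewrite (ev_mor _ _ hC) (eq_ev (map_pt _ _ _)). Qed.

Lemma pt_gen : pt (genA K N) (genv K N) =1 @poly_coord K N.
Proof.
case=> [[[i j] /= lt_ij]|i] /=; last by rewrite mxE.
by rewrite genAE insubT insubF /= ?subr0 // ltnNge ltnW.
Qed.

Lemma ev_gen f : ev (pt (genA K N) (genv K N)) f = f.
Proof.
rewrite (eq_ev pt_gen); elim/Sa_ind: f => [c|p q IHp IHq|s p IH].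
- by rewrite ev_alg.
- by rewrite rmorphD /= IHp IHq.
- by rewrite rmorphM /= ev_coord IH.
Qed.

Lemma mor_ev (T : comAlgType K) (h : {rmorphism Sa K N -> T}) f :
  (forall c : K, h c%:A = c%:A) ->
  h f = ev (pt (map_mx h (genA K N)) (map_mx h (genv K N))) f.
Proof. by move=> hC; rewrite -{1}[f]ev_gen (ev_mor _ _ hC) (eq_ev (map_pt _ _ _)). Qed.
End EvalGen.

(** * Power series, and derivatives of characteristic coefficients *)

Section Series.
Variables (K : fieldType) (S : comAlgType K).
Implicit Types f g h : nat -> S.

Definition ser_shift f : nat -> S := fun m => if m is p.+1 then f p else 0.

(** A coefficient depends only on truncations, so commutativity and associativity are inherited from
    polynomials. *)
Lemma ser_mul_poly n f g m : (m < n)%N ->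
  ser_mul f g m = ((\poly_(i < n) f i) * (\poly_(i < n) g i))`_m.
Proof.
move=> lt_mn; rewrite coefM; apply: eq_bigr => -[i /= lt_i] _.
by rewrite !coef_poly (leq_trans lt_i) // (leq_ltn_trans (leq_subr _ _)).
Qed.

Lemma ser_mulC f g : ser_mul f g = ser_mul g f.
Proof. by apply/funext => m; rewrite !(@ser_mul_poly m.+1) // mulrC. Qed.

Lemma ser_mulA f g h : ser_mul f (ser_mul g h) = ser_mul (ser_mul f g) h.
Proof.
apply/funext => m; pose q k := \poly_(i < m.+1) (k i : S).
have E k l r : ser_mul k (ser_mul l r) m = (q k * (q l * q r))`_m.
  rewrite coefM; apply: eq_bigr => -[i /= lt_i] _.
  by rewrite coef_poly lt_i (@ser_mul_poly m.+1) // ltnS leq_subr.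
by rewrite [in RHS]ser_mulC !E mulrA mulrC.
Qed.

Lemma ser_mul1 f : ser_mul (ser_one S) f = f.
Proof.
apply/funext => m; rewrite /ser_mul big_ord_recl /= big1 ?addr0 ?subn0 ?mul1r //.
by move=> i _; rewrite /ser_one /= mul0r.
Qed.

Lemma ser_mul_shift f g : ser_mul (ser_shift f) g = ser_shift (ser_mul f g).
Proof.
apply/funext => -[|m]; rewrite /ser_mul /=; first by rewrite big_ord1 mul0r.
by rewrite big_ord_recl /= mul0r add0r; apply: eq_bigr => i _; rewrite subSS.
Qed.

Lemma ser_mulDr f g h : ser_mul f (g \+ h) = ser_mul f g \+ ser_mul f h.
Proof.
apply/funext => m; rewrite /ser_mul /= -big_split; apply: eq_bigr => i _.
exact: mulrDr.
Qed.

Lemma ser_mulDl f g h : ser_mul (g \+ h) f = ser_mul g f \+ ser_mul h f.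
Proof. by rewrite ser_mulC ser_mulDr !(ser_mulC f). Qed.

Lemma ser_mulNr f g : ser_mul f (\- g) = \- ser_mul f g.
Proof.
by apply/funext => m; rewrite /ser_mul /= -sumrN; apply: eq_bigr => i _; rewrite mulrN.
Qed.

Lemma der_ser_mul D f g : derivation D ->
  D \o ser_mul f g = ser_mul (D \o f) g \+ ser_mul f (D \o g).
Proof.
move=> dD; apply/funext => m; rewrite /ser_mul /= der_sum // -big_split.
by apply: eq_bigr => i _; rewrite derM.
Qed.

(** With constant term 1, each new coefficient of a square is twice the new coefficient of the root
    plus terms in earlier ones. *)
Lemma ser_sqrt_uniq f g : (2 : K) != 0 -> f 0%N = 1 -> g 0%N = 1 ->
  ser_mul f f = ser_mul g g -> f = g.
Proof.
move=> nz2 f0 g0 efg; apply/funext => m.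
elim: m {-2}m (leqnn m) => [[|//]|M IH m]; first by rewrite f0 g0.
rewrite leq_eqVlt => /predU1P[->|]; last exact: IH.
have E h : ser_mul h h M.+1 =
    h 0%N * h M.+1 + (\sum_(i < M) h i.+1 * h (M - i)%N + h M.+1 * h 0%N).
  rewrite /ser_mul big_ord_recl big_ord_recr /= subn0 /bump /= add1n subnn.
  by congr (_ + (_ + _)); apply: eq_bigr => i _; rewrite add1n subSS.
move/(congr1 (fun h => h M.+1)): efg; rewrite !E f0 g0 !mul1r !mulr1.
have -> : \sum_(i < M) f i.+1 * f (M - i)%N = \sum_(i < M) g i.+1 * g (M - i)%N.
  by apply: eq_bigr => -[i /= lt_i] _; rewrite !IH // leq_subr.
rewrite addrCA [in RHS]addrCA => /addrI.
rewrite -!mulr2n => /(congr1 (fun x => 2^-1 *: x)).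
by rewrite -!scaler_nat !scalerA mulVf // !scale1r.
Qed.
End Series.

Section DetDerivation.
Variables (K : fieldType) (S : comAlgType K).

Lemma der_prod D (I : finType) (F : I -> S) : derivation D ->
  D (\prod_i F i) = \sum_i \prod_j (if j == i then D (F j) else F j).
Proof.
move=> dD.
have H (r : seq I) : uniq r -> D (\prod_(i <- r) F i) =
    \sum_(i <- r) \prod_(j <- r) (if j == i then D (F j) else F j).
  elim: r => [|i r IH] /=; first by rewrite !big_nil der1.
  case/andP => nir ur; rewrite !big_cons derM // IH // eqxx; congr (_ + _).
    by congr (_ * _); rewrite !big_seq; apply: eq_bigr => j jr; case: eqP jr nir => // -> ->.
  rewrite mulr_sumr !big_seq; apply: eq_bigr => j jr; rewrite big_cons.
  by case: eqP jr nir => // -> ->.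
by rewrite H ?index_enum_uniq.
Qed.

(** Jacobi's formula: differentiate one row at a time and expand along that row. *)
Lemma der_det D n (M : 'M[S]_n) : derivation D ->
  D (\det M) = \tr (\adj M *m map_mx D M).
Proof.
move=> dD; pose Mr i := \matrix_(k, l) (if k == i then D (M k l) else M k l).
transitivity (\sum_i \det (Mr i)).
  rewrite /determinant der_sum // exchange_big; apply: eq_bigr => s _ /=.
  rewrite derM // der_sign // mul0r add0r der_prod // mulr_sumr.
  by apply: eq_bigr => i _; congr (_ * _); apply: eq_bigr => j _; rewrite mxE.
rewrite mxtrace_mulC; apply: eq_bigr => i _.
rewrite (expand_det_row _ i) !mxE; apply: eq_bigr => j _.
rewrite !mxE eqxx; congr (_ * (_ * \det _)); apply/matrixP => k l.
by rewrite !mxE eq_sym (negPf (neq_lift _ _)).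
Qed.
End DetDerivation.

Section KpolyDerivation.
Variables (K : fieldType) (S : comAlgType K).

Lemma derivation_map D : derivation D ->
  derivation (map_poly D : kpoly S -> kpoly S).
Proof.
move=> dD; have D0 := der0 dD.
have cE (p : {poly S}) i : (map_poly D p)`_i = D p`_i by rewrite coef_map_id0.
split=> [p q|p q|c].
- by apply/polyP => i; rewrite coefD !cE coefD derD'.
- apply/polyP => i; rewrite coefD !coefM cE coefM der_sum // -big_split.
  by apply: eq_bigr => j _; rewrite derM // !cE.
- apply/polyP => i; rewrite kpoly_algE cE coefC coef0.
  by case: ifP => _; rewrite ?derC ?der0.
Qed.

Lemma derivation_deriv : derivation (@deriv S : kpoly S -> kpoly S).
Proof.
split=> [p q|p q|c]; first exact: derivD.
- exact: derivM.
- by rewrite kpoly_algE derivC.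
Qed.
End KpolyDerivation.

Section CharCoef.
Variables (K : fieldType) (S : comAlgType K) (N : nat).
Implicit Types A : 'M[S]_N.

Definition chpoly A : kpoly S := \det (1%:M + 'X *: map_mx polyC A).

Lemma bmxS A k : bmx A k.+1 = A *m bmx A k + ((-1) ^+ k.+1 * charcoef A k.+1)%:M.
Proof.
have bE l : bmx A l = \sum_(j < l.+1) ((-1) ^+ j * charcoef A j) *: A ^+ (l - j).
  case: l => //; rewrite big_ord1 !expr0 charcoef0 mul1r scale1r //.
rewrite !bE big_ord_recr /= subnn expr0 scalemx1; congr (_ + _).
rewrite mulmx_sumr; apply: eq_bigr => -[i /= lt_i] _.
by rewrite -scalemxAr subSn ?exprS.
Qed.

(** Comparing coefficients in (1 + tA) adj (1 + tA) = det (1 + tA) gives the recursion [bmxS] up to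
    sign. *)
Lemma coef_adj A k :
  map_mx (coefp k) (\adj (1%:M + 'X *: map_mx polyC A)) = (-1) ^+ k *: bmx A k.
Proof.
set M := _ + _; pose c l := map_mx (coefp l) (\adj M).
have E l : c l + (if l is l'.+1 then A *m c l' else 0) = (charcoef A l)%:M.
  have := mul_mx_adj M; move/(congr1 (map_mx (coefp l))).
  rewrite -[X in _ = X]/(map_mx _ _) mulmxDl mul1mx -scalemxAl => eM.
  apply/matrixP => i j; move/matrixP/(_ i j): eM; rewrite !mxE /= coefD.
  rewrite coefMn coefXM => <-; congr (_ + _); case: l => [|l] /=; rewrite !mxE //.
  by rewrite coef_sum; apply: eq_bigr => q _; rewrite !mxE coefCM.
rewrite -/(c k); elim: k => [|k IH].
  by have := E 0%N; rewrite addr0 => ->; rewrite charcoef0 expr0 scale1r.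
have := E k.+1; rewrite IH => /(canRL (addrK _)) ->.
rewrite bmxS scalerDr scale_scalar_mx mulrA -expr2 sqrr_sign mul1r.
by rewrite exprS mulN1r scaleNr scalemxAr addrC.
Qed.

(** Jacobi's formula for 1 + tA, with [D] acting on coefficients and killing t. *)
Lemma der_charcoef D A k : derivation D ->
  D (charcoef A k.+1) = (-1) ^+ k * \tr (bmx A k *m map_mx D A).
Proof.
move=> dD; have dD' := derivation_map dD.
have -> : D (charcoef A k.+1) = (map_poly D (chpoly A))`_k.+1.
  by rewrite coef_map_id0 // der0.
rewrite /chpoly (der_det _ dD').
have -> : map_mx (map_poly D : kpoly S -> kpoly S) (1%:M + 'X *: map_mx polyC A) =
    'X *: map_mx polyC (map_mx D A).
  apply/matrixP => i j; rewrite !mxE; apply/polyP => l.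
  rewrite coef_map_id0 ?der0 // !coefD !coefXM coefMn !coefC derD' //.
  case: l => [|[|l]] /=; rewrite ?mul0rn ?(der0 dD) ?add0r ?addr0 //.
  exact: der_nat.
rewrite -mxtraceZ scalemxAl -coef_adj -scalemxAr mxtraceZ coefXM /= /mxtrace coef_sum.
apply: eq_bigr => i _; rewrite !mxE coef_sum; apply: eq_bigr => j _.
by rewrite !mxE coefMC.
Qed.

Lemma coef_comp_scaleX (p : {poly S}) a k : (p \Po (a *: 'X))`_k = a ^+ k * p`_k.
Proof.
rewrite comp_polyE (eq_bigr (fun i : 'I_(size p) => (p`_i * a ^+ i) *: 'X^i)).
  rewrite -(poly_def _ (fun i => p`_i * a ^+ i)) coef_poly mulrC.
  by case: ltnP => // le_pk; rewrite nth_default // mulr0.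
by move=> i _; rewrite exprZn scalerA.
Qed.

Lemma charcoef_scale (a : S) A k : charcoef (a *: A) k = a ^+ k * charcoef A k.
Proof.
rewrite /charcoef -coef_comp_scaleX -/(comp_poly _ _) -det_map_mx.
apply: (congr1 (fun M : 'M[{poly S}]_N => (\det M)`_k)).
apply/matrixP => i j; rewrite !mxE /= rmorphD rmorphMn rmorphM /= !rmorph1.
by rewrite comp_polyM comp_polyX comp_polyC -mul_polyC mulrA [_ * a%:P]mulrC.
Qed.

Lemma charcoef_tr A k : charcoef A^T k = charcoef A k.
Proof.
rewrite /charcoef -[in RHS]det_tr.
apply: (congr1 (fun M : 'M[{poly S}]_N => (\det M)`_k)).
by rewrite linearD /= trmx1 linearZ /= map_trmx.
Qed.

(** Transposition leaves det (1 + tA) unchanged, and here it replaces t by -t. *)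
Lemma charcoef_skew_odd A k : (2 : K) != 0 -> A^T = - A -> odd k -> charcoef A k = 0.
Proof.
move=> nz2 skA oddk; have := charcoef_tr A k.
rewrite skA -scaleN1r charcoef_scale -signr_odd oddk expr1 mulN1r.
move/eqP; rewrite eq_sym -addr_eq0 -mulr2n -scaler_nat => /eqP.
by move/(congr1 (fun x => 2^-1 *: x)); rewrite scalerA mulVf // scale1r scaler0.
Qed.

(* (det (1 + tA))^2 = det (1 + tA) det (1 - tA) = det (1 - t^2 A^2). *)
Lemma det_sqrtE A k : (2 : K) != 0 -> A^T = - A ->
  det_sqrt A k = (-1) ^+ k * charcoef A k.*2.
Proof.
move=> nz2 skA.
have P0 : odd_poly (chpoly A) = 0.
  apply/polyP => i; rewrite coef_odd_poly coef0 -/(charcoef A _).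
  by rewrite charcoef_skew_odd //= odd_double.
have PE : even_poly (chpoly A) \Po 'X^2 = chpoly A.
  by rewrite -[RHS]poly_even_odd P0 comp_poly0 mul0r addr0.
have PP : chpoly A * chpoly A = (chpoly (A ^+ 2) \Po (- 1 *: 'X)) \Po 'X^2.
  have {2}-> : chpoly A = \det (1%:M - 'X *: map_mx polyC A).
    by rewrite /chpoly -det_tr linearD /= trmx1 linearZ /= map_trmx skA map_mxN scalerN.
  rewrite -det_mulmx mulmxDl mul1mx mulmxBr mulmx1 addrA subrK.
  rewrite -scalemxAl -scalemxAr scalerA -map_mxM /= -comp_polyA.
  rewrite comp_polyZ comp_polyX -/(comp_poly _ _) -det_map_mx; congr (\det _).
  rewrite rmorphD /= map_mx1 map_mxZ /=; congr (_ + _).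
  apply/matrixP => i j; rewrite !mxE /= comp_polyC comp_polyX.
  by rewrite scaleN1r mulNr.
have QQ : even_poly (chpoly A) * even_poly (chpoly A) = chpoly (A ^+ 2) \Po (- 1 *: 'X).
  apply/polyP => i; move: PP; rewrite -{1 2}PE -comp_polyM => /(congr1 (coefp i.*2)).
  by rewrite /= !coef_comp_poly_Xn // -mul2n dvdn_mulr // mulKn.
suff -> : det_sqrt A = fun j => (-1) ^+ j * charcoef A j.*2 by [].
apply: ser_sqrt_uniq => //; first by rewrite expr0 charcoef0 mul1r.
apply/funext => {}k; rewrite (ser_sqrtP nz2 (charcoef0 _)) /ser_mul.
have := congr1 (coefp k) QQ; rewrite /= coef_comp_scaleX coefM => e.
have -> : charcoef (A ^+ 2) k = (-1) ^+ k * ((-1) ^+ k * (chpoly (A ^+ 2))`_k).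
  by rewrite mulrA -expr2 sqrr_sign mul1r.
rewrite -e {e}.
rewrite mulr_sumr; apply: eq_bigr => -[i /= lt_i] _; rewrite !coef_even_poly.
rewrite -{1}(subnKC (ltnSE lt_i)) exprD -!/(charcoef A _).
by rewrite -!mulrA; congr (_ * _); rewrite mulrCA.
Qed.
End CharCoef.

Lemma mulr2n_eq0_unit (K : fieldType) (S : comAlgType K) (a : S) :
  (2 : K) != 0 -> a + a = 0 -> a = 0.
Proof.
move=> nz2 /(congr1 (fun z : S => (2^-1 : K) *: z)).
by rewrite -mulr2n -scaler_nat scalerA mulVf // scale1r scaler0.
Qed.

(** * Centrality of the generators *)

Section Dot.
Variables (K : fieldType) (S : comAlgType K) (N : nat).
Implicit Types (x y z v : 'cV[S]_N) (M : 'M[S]_N).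

Lemma dotC x y : dot x y = dot y x.
Proof. by rewrite /dot -[in RHS](trmxK x) -trmx_mul [RHS]mxE. Qed.

Lemma dotDr x y z : dot x (y + z) = dot x y + dot x z.
Proof. by rewrite /dot mulmxDr mxE. Qed.

Lemma dotNr x y : dot x (- y) = - dot x y.
Proof. by rewrite /dot mulmxN mxE. Qed.

Lemma dotZr a x y : dot x (a *: y) = a * dot x y.
Proof. by rewrite /dot -scalemxAr mxE. Qed.

Lemma dotDl x y z : dot (y + z) x = dot y x + dot z x.
Proof. by rewrite -!(dotC x) dotDr. Qed.

Lemma dotNl x y : dot (- y) x = - dot y x.
Proof. by rewrite -!(dotC x) dotNr. Qed.

Lemma dotZl a x y : dot (a *: y) x = a * dot y x.
Proof. by rewrite -!(dotC x) dotZr. Qed.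

Lemma dotBr x y z : dot x (y - z) = dot x y - dot x z.
Proof. by rewrite dotDr dotNr. Qed.

Lemma dot0r x : dot x 0 = 0. Proof. by rewrite /dot mulmx0 mxE. Qed.

Lemma dot0l x : dot 0 x = 0. Proof. by rewrite dotC dot0r. Qed.

Lemma dot_sumr x I (r : seq I) (P : pred I) (F : I -> 'cV[S]_N) :
  dot x (\sum_(i <- r | P i) F i) = \sum_(i <- r | P i) dot x (F i).
Proof. exact: (big_morph (dot x) (dotDr x) (dot0r x)). Qed.

Lemma dot_trmx x M y : dot x (M *m y) = dot (M^T *m x) y.
Proof. by rewrite /dot trmx_mul trmxK mulmxA. Qed.

Lemma mul_dot m (x : 'cV[S]_m) y z : x *m y^T *m z = dot y z *: x.
Proof. by rewrite -mulmxA [_ *m z]mx11_scalar mul_mx_scalar. Qed.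

Lemma tr_dot M x y : \tr (M *m (x *m y^T)) = dot y (M *m x).
Proof. by rewrite mulmxA mxtrace_mulC /mxtrace big_ord1. Qed.

Lemma dot_skew M x y : M^T = - M -> dot x (M *m y) = - dot y (M *m x).
Proof. by move=> skM; rewrite dot_trmx skM mulNmx dotNl dotC. Qed.

Lemma dot_skew0 M x : (2 : K) != 0 -> M^T = - M -> dot x (M *m x) = 0.
Proof.
move=> nz2 skM; apply: (mulr2n_eq0_unit nz2).
by rewrite {2}(dot_skew x x skM) subrr.
Qed.

Lemma der_dot D x y : derivation D ->
  D (dot x y) = dot (map_mx D x) y + dot x (map_mx D y).
Proof.
move=> dD; have := derMx dD x^T y; move/matrixP/(_ 0 0).
by rewrite -map_trmx [in LHS]mxE => ->; rewrite mxE.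
Qed.

Lemma der_sumx D I (r : seq I) (P : pred I) (F : I -> 'M[S]_N) : derivation D ->
  map_mx D (\sum_(i <- r | P i) F i) = \sum_(i <- r | P i) map_mx D (F i).
Proof.
move=> dD; apply: (big_morph (map_mx D)) => [B C|]; first exact: derDx.
by apply/matrixP => i j; rewrite !mxE der0.
Qed.

Lemma derXx D M l : derivation D -> map_mx D (M ^+ l.+1) =
  \sum_(i < l.+1) M ^+ i *m map_mx D M *m M ^+ (l - i).
Proof.
move=> dD; elim: l => [|l IH]; first by rewrite big_ord1 !expr0 mul1mx mulmx1.
rewrite exprS derMx // IH [in RHS]big_ord_recl expr0 mul1mx subn0; congr (_ + _).
by rewrite mulmx_sumr; apply: eq_bigr => i _; rewrite exprS !mulmxA.
Qed.
End Dot.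

(** * Variation of psi and of the c_k *)

Section SkewSeries.
Variables (K : fieldType) (S : comAlgType K) (N : nat) (A : 'M[S]_N).
Hypothesis nz2 : (2 : K) != 0.
Hypothesis skA : A^T = - A.
Implicit Types (f g : nat -> S) (x y v : 'cV[S]_N).

(* The coefficients of f (1 + u A^2)^-1, as a series in u. *)
Definition resolv f k : 'M[S]_N := \sum_(i < k.+1) f i *: (- A ^+ 2) ^+ (k - i).

Lemma resolv0 f : resolv f 0 = (f 0%N)%:M.
Proof. by rewrite /resolv big_ord1 expr0 scalemx1. Qed.

Lemma sqAS l : (- A ^+ 2) ^+ l.+1 = - (A *m A *m (- A ^+ 2) ^+ l).
Proof. by rewrite exprS mulNr. Qed.

Lemma resolvS f k : resolv f k.+1 = (f k.+1)%:M - A *m A *m resolv f k.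
Proof.
rewrite /resolv big_ord_recr /= subnn expr0 scalemx1 addrC; congr (_ + _).
rewrite mulmx_sumr -sumrN; apply: eq_bigr => -[i /= lt_i] _.
by rewrite -scalemxAr -scalerN subSn // sqAS.
Qed.

Lemma resolv_functional (phi : 'M[S]_N -> S) f k :
  {morph phi : M M' / M + M'} -> (forall a M, phi (a *: M) = a * phi M) ->
  phi (resolv f k) = ser_mul f (fun l => phi ((- A ^+ 2) ^+ l)) k.
Proof.
move=> phiD phiZ; have phi0 : phi 0 = 0 by rewrite -(scale0r 0) phiZ mul0r.
by rewrite (big_morph phi phiD phi0); apply: eq_bigr => i _; rewrite phiZ.
Qed.

Lemma sqA_sym l : ((- A ^+ 2) ^+ l)^T = (- A ^+ 2) ^+ l.
Proof.
have H : (- A ^+ 2)^T = - A ^+ 2.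
  by rewrite -[A ^+ 2]/(A *m A) linearN /= trmx_mul skA mulNmx mulmxN opprK.
elim: l => [|l IH]; first by rewrite !expr0 trmx1.
by rewrite {1}exprS trmx_mul IH H [RHS]exprSr.
Qed.

Lemma comm_sqA l : A *m (- A ^+ 2) ^+ l = (- A ^+ 2) ^+ l *m A.
Proof. by apply: commrX; apply: commrN; apply: commrX. Qed.

Lemma resolv_sym f k : (resolv f k)^T = resolv f k.
Proof.
by rewrite linear_sum; apply: eq_bigr => i _; rewrite linearZ /= sqA_sym.
Qed.

Lemma comm_resolv f k : A *m resolv f k = resolv f k *m A.
Proof.
rewrite mulmx_sumr mulmx_suml; apply: eq_bigr => i _.
by rewrite -scalemxAr -scalemxAl comm_sqA.
Qed.

Lemma signr_double k : (-1) ^+ k.*2 = 1 :> S.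
Proof. by rewrite -signr_odd odd_double. Qed.

(** Two steps of [bmxS] make one step of [resolvS], because the odd characteristic coefficients
    vanish. Thus psi_k is, up to sign, the coefficient of u^k in det (1 + uA^2)^(1/2) (v, (1 +
    uA^2)^-1 v). *)
Lemma bmx_resolv k : (-1) ^+ k *: bmx A k.*2 = resolv (det_sqrt A) k.
Proof.
elim: k => [|k IH]; first by rewrite resolv0 expr0 scale1r.
rewrite resolvS -IH det_sqrtE // doubleS !bmxS.
rewrite charcoef_skew_odd //= ?odd_double // mulr0 raddf0 addr0.
rewrite scalerDr scale_scalar_mx !exprS !mulN1r opprK.
rewrite signr_double mul1r addrC; congr (_ + _).
by rewrite scaleNr -!scalemxAr !mulmxA.
Qed.

Variable D : S -> S.
Hypothesis dD : derivation D.
Local Notation DA := (map_mx D A).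

(** The logarithmic derivative of det (1 + uA^2)^(1/2) is u tr (A (1 + uA^2)^-1 DA). It is read off
    from [der_charcoef] in even degree. *)
Lemma der_det_sqrt : D \o det_sqrt A =
  ser_shift (fun k => \tr (A *m resolv (det_sqrt A) k *m DA)).
Proof.
apply/funext => -[|k] /=; first by rewrite /det_sqrt ser_sqrt0 der1.
rewrite det_sqrtE // derM // der_sign // mul0r add0r doubleS der_charcoef //.
rewrite -bmx_resolv bmxS charcoef_skew_odd //= ?odd_double // mulr0 raddf0 addr0.
rewrite -scalemxAr -scalemxAl mxtraceZ mulrA; congr (_ * _).
by rewrite !exprS signr_double mulr1 mulrN1 mulN1r opprK.
Qed.

Let r l := \tr (A *m (- A ^+ 2) ^+ l *m DA).

Lemma tr_resolv f k : \tr (A *m resolv f k *m DA) = ser_mul f r k.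
Proof.
apply: (resolv_functional (phi := fun M => \tr (A *m M *m DA))) => [M M'|a M].
  by rewrite mulmxDr mulmxDl mxtraceD.
by rewrite -scalemxAr -scalemxAl mxtraceZ.
Qed.

(* Logarithmic derivative: d f = 1 gives d Df = - f Dd. *)
Lemma der_det_sqrtV : D \o det_sqrtV A =
  ser_shift (fun k => - \tr (A *m resolv (det_sqrtV A) k *m DA)).
Proof.
pose d := det_sqrt A; pose f := det_sqrtV A.
have df : ser_mul d f = ser_one S by apply/funext => k; apply: det_sqrtVP.
have Dd : D \o d = ser_shift (ser_mul d r).
  rewrite der_det_sqrt; congr ser_shift; apply/funext => k; exact: tr_resolv.
have E : ser_mul d (D \o f) = \- ser_mul (D \o d) f.
  have := congr1 (fun h => D \o h) df; rewrite der_ser_mul // => e.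
  apply/funext => k; have /= := congr1 (fun h => h k) e.
  rewrite /ser_one der_nat // => /eqP; rewrite addrC addr_eq0 => /eqP.
  exact.
rewrite -[LHS]ser_mul1 -df [ser_mul d f]ser_mulC -ser_mulA E Dd ser_mul_shift.
rewrite [ser_mul (ser_mul d r) f]ser_mulC ser_mulA [ser_mul f d]ser_mulC df ser_mul1.
rewrite ser_mulNr [ser_mul f (ser_shift r)]ser_mulC ser_mul_shift ser_mulC.
by apply/funext => -[|k] /=; rewrite ?oppr0 // tr_resolv.
Qed.

(** The telescoping: the derivative of the term added at n + 1 is the difference of two consecutive
    traces, because [resolvS] lets a factor A^2 pass from one resolvent to the other. At n = m the
    second index has come down to k, independently of m. *)
Lemma der_cPoly_sum k m n : (n <= m)%N ->
  D (\sum_(e < n.+1) det_sqrtV A e * det_sqrt A (k.+1 + m - e)%N) =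
  \tr (A *m resolv (det_sqrtV A) n *m resolv (det_sqrt A) (k + m - n) *m DA).
Proof.
have Dd l : D (det_sqrt A l.+1) = \tr (A *m resolv (det_sqrt A) l *m DA).
  by have := congr1 (fun h => h l.+1) der_det_sqrt.
have Df l : D (det_sqrtV A l.+1) = - \tr (A *m resolv (det_sqrtV A) l *m DA).
  by have := congr1 (fun h => h l.+1) der_det_sqrtV.
have f0 : det_sqrtV A 0 = 1 by [].
elim: n => [|n IH] lt_nm.
  rewrite big_ord1 f0 mul1r !subn0 addSn Dd resolv0 f0.
  by rewrite mulmx1.
rewrite big_ord_recr /= derD' // IH 1?ltnW // derM // Df.
have -> : (k.+1 + m - n.+1 = (k + m - n.+1).+1)%N by lia.
have -> : (k + m - n = (k + m - n.+1).+1)%N by lia.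
rewrite Dd !resolvS; set F := resolv _ n; set l := (_ - _)%N.
set G := resolv _ l; set a := det_sqrtV _ _; set b := det_sqrt _ _.
have E : A *m F *m (A *m A *m G) = A *m (A *m A *m F) *m G.
  have cF : F *m A = A *m F by rewrite comm_resolv.
  by rewrite !mulmxA -(mulmxA A F) cF !mulmxA -(mulmxA (A *m A) F) cF !mulmxA.
rewrite !(mulmxBr, mulmxBl) !raddfB /= E !mul_mx_scalar -!scalemxAl !mxtraceZ.
by ring.
Qed.

Lemma der_cPoly (zeta : seq K) k : D (cPoly zeta A k.+1) =
  (-1) ^+ k.+1 * \sum_(m < size zeta) zeta`_m *:
    \tr (A *m resolv (det_sqrtV A) m *m resolv (det_sqrt A) k *m DA).
Proof.
rewrite cPoly_explicit derM // der_sign // mul0r add0r; congr (_ * _).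
rewrite der_sum //; apply: eq_bigr => m _; rewrite derZ //; congr (_ *: _).
by rewrite der_cPoly_sum // addnK.
Qed.

(* With DA = x v^T - v x^T up to sign, this is the invariance of psi under the translations of A. *)
Lemma der_resolv_translation x v k : DA = v *m x^T - x *m v^T ->
  dot v (map_mx D (resolv (det_sqrt A) k) *m v) = 0.
Proof.
move=> eDA; pose R l := (- A ^+ 2) ^+ l.
pose al l := dot x (A *m R l *m v); pose be l := dot v (R l *m v).
have Rs l : (R l)^T = R l := sqA_sym l.
have ARsk l : (A *m R l)^T = - (A *m R l).
  by rewrite trmx_mul Rs skA mulmxN -comm_sqA.
have RA l y z : dot y (R l *m (A *m z)) = - dot z (A *m R l *m y).
  by rewrite mulmxA -comm_sqA [LHS](dot_skew _ _ (ARsk l)).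
(* Leibniz on a power gives products of two pairings. Those with a factor (v, A R_j v) vanish by
   skewness; the remaining ones form the convolution of [al] and [be], twice. *)
have DR : (fun l => dot v (map_mx D (R l) *m v)) =
    ser_shift (\- (ser_mul al be \+ ser_mul al be)).
  apply/funext => -[|l]; first by rewrite /R expr0 /= der1x // mul0mx dot0r.
  rewrite /R derXx // mulmx_suml dot_sumr [in LHS]/=.
  rewrite {1}ser_mulC /= /ser_mul -big_split -sumrN; apply: eq_bigr => i _ /=.
  have H M w : dot v (M *m DA *m w) = dot x w * dot v (M *m v) - dot v w * dot v (M *m x).
    by rewrite eDA mulmxBr mulmxBl !mulmxA !mul_dot dotBr !dotZr.
  have -> : map_mx D (- A ^+ 2) = - (DA *m A + A *m DA).
    by rewrite derNx // -[A ^+ 2]/(A *m A) derMx.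
  rewrite mulmxN !mulNmx dotNr; congr (- _).
  rewrite mulmxDr !mulmxDl dotDr -/(R _) !mulmxA -mulmxA -[R i *m DA *m A *m _]mulmxA.
  rewrite -[_ *m (- A ^+ 2) ^+ _ *m v]mulmxA !H !mulmxA -/(R _).
  rewrite -[dot v (R i *m A *m v)]/(dot v (R i *m A *m v)).
  have vAv j : dot v (A *m R j *m v) = 0 by rewrite (dot_skew0 _ nz2 (ARsk j)).
  rewrite -!comm_sqA -!/(R _) !vAv (dot_skew v x (ARsk i)) -/(al _) -/(al _) -/(be _) -/(be _).
  by rewrite mul0r subr0 mulr0 add0r mulrN opprK mulrC [be _ * al i]mulrC.
(* The trace against the rank-two matrix DA is 2 [al] by skewness, so the determinant factor
   contributes the opposite of [DR]. *)
have Dd : D \o det_sqrt A = ser_shift (ser_mul (det_sqrt A) (al \+ al)).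
  rewrite der_det_sqrt; congr ser_shift; apply/funext => l; rewrite /= tr_resolv.
  congr (ser_mul _ _ l); apply/funext => i; rewrite /r eDA mulmxBr raddfB /= !tr_dot.
  by rewrite [X in _ - X](dot_skew _ _ (ARsk i)) opprK.
transitivity ((ser_mul (D \o det_sqrt A) be \+
    ser_mul (det_sqrt A) (fun l => dot v (map_mx D (R l) *m v))) k).
  rewrite /ser_mul /= -big_split /resolv der_sumx // mulmx_suml dot_sumr.
  apply: eq_bigr => i _ /=; rewrite derZx // mulmxDl dotDr -!scalemxAl !dotZr.
  by [].
rewrite DR Dd ser_mul_shift [ser_mul _ (ser_shift _)]ser_mulC ser_mul_shift.
case: k => [|k] /=; first by rewrite addr0.
set d := det_sqrt A; have -> : al \+ al = ser_mul (ser_one S) (al \+ al) by rewrite ser_mul1.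
rewrite ser_mul1 -ser_mulA ser_mulDl [ser_mul (\- _) d]ser_mulC ser_mulNr /=.
by rewrite subrr.
Qed.

(** [G] stands for the matrix of the bracket on V_N. By [der_resolv_translation] only the two outer
    vectors v contribute, and equally, since b_{2k} is symmetric. *)
Lemma der_psi (G : 'M[S]_N) x v k : G^T = - G ->
  DA = v *m x^T - x *m v^T -> map_mx D v = - (G *m x) ->
  D (psi k A v) = dot x (G *m bmx A k.*2 *m v) *+ 2.
Proof.
move=> skG eDA eDv.
have bE : bmx A k.*2 = (-1) ^+ k *: resolv (det_sqrt A) k.
  by rewrite -bmx_resolv scalerA -expr2 sqrr_sign scale1r.
rewrite /psi der_dot // derMx // dotDr eDv.
have -> : dot v (map_mx D (bmx A k.*2) *m v) = 0.
  by rewrite bE derZx // der_sign // scale0r add0r -scalemxAl dotZr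
    (der_resolv_translation k eDA) mulr0.
have bT : (bmx A k.*2)^T = bmx A k.*2 by rewrite bE linearZ /= resolv_sym.
have Ex w : dot (- (G *m x)) w = dot x (G *m w).
  by rewrite [RHS]dot_trmx skG mulNmx.
by rewrite add0r [X in _ + X]dot_trmx bT [X in _ + X]dotC Ex mulmxA mulr2n.
Qed.

End SkewSeries.

Section InfinitesimalRotation.
Variables (K : fieldType) (S : comAlgType K) (N : nat) (A B : 'M[S]_N) (v : 'cV[S]_N).
Hypothesis nz2 : (2 : K) != 0.
Hypothesis skA : A^T = - A.
Hypothesis skB : B^T = - B.
Variable D : S -> S.
Hypothesis dD : derivation D.
Hypothesis DA : map_mx D A = A *m B - B *m A.
Hypothesis Dv : map_mx D v = - (B *m v).

Lemma tr_comm (M : 'M[S]_N) : A *m M = M *m A -> \tr (M *m (A *m B - B *m A)) = 0.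
Proof.
move=> cM; rewrite mulmxBr raddfB /= mulmxA -cM [X in _ - X]mxtrace_mulC.
by rewrite -!mulmxA [X in _ - X]mxtrace_mulC -!mulmxA subrr.
Qed.

Lemma comm_bmx k : A *m bmx A k = bmx A k *m A.
Proof.
elim: k => [|k IH]; first by rewrite mulmx1 mul1mx.
by rewrite bmxS mulmxDr mulmxDl scalar_mxC {1}IH !mulmxA.
Qed.

Lemma der_charcoef_rot k : D (charcoef A k) = 0.
Proof.
case: k => [|k]; first by rewrite charcoef0 der1.
by rewrite der_charcoef // DA tr_comm ?mulr0 // comm_bmx.
Qed.

Lemma der_bmx_rot k : map_mx D (bmx A k) = bmx A k *m B - B *m bmx A k.
Proof.
elim: k => [|k IH]; first by rewrite der1x // mul1mx mulmx1 subrr.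
rewrite bmxS derDx // derMx // IH DA.
set c := _%:M; have -> : map_mx D c = 0.
  apply/matrixP => i j; rewrite !mxE; case: eqP => _; rewrite ?mulr0n ?der0 //.
  by rewrite mulr1n derM // der_sign // der_charcoef_rot mulr0 mul0r addr0.
have cB : B *m c = c *m B by rewrite scalar_mxC.
rewrite addr0 (mulmxDl _ c B) (mulmxDr B) cB [X in _ = _ - X]addrC opprD addrA addrK.
by rewrite mulmxBl mulmxBr !mulmxA [LHS]addrC [LHS]addrA subrK.
Qed.

Lemma der_psi_rot k : D (psi k A v) = 0.
Proof.
have H w : dot (B *m v) w = - dot v (B *m w).
  by rewrite -[in LHS](trmxK B) -dot_trmx skB mulNmx dotNr.
rewrite /psi der_dot // derMx // Dv der_bmx_rot dotNl H opprK.
by rewrite mulmxN mulmxBl !mulmxA dotDr dotBr dotNr; ring.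
Qed.

Lemma der_cPoly_rot (zeta : seq K) k : D (cPoly zeta A k.+1) = 0.
Proof.
rewrite der_cPoly // big1 ?mulr0 // => m _; rewrite DA tr_comm ?scaler0 //.
by rewrite !mulmxA -[in RHS]mulmxA -comm_resolv // !mulmxA -[in RHS](mulmxA A) -comm_resolv // !mulmxA.
Qed.
End InfinitesimalRotation.

Lemma resolv_comm (K : fieldType) (S : comAlgType K) N (A M : 'M[S]_N) f k :
  A *m M = M *m A -> resolv A f k *m M = M *m resolv A f k.
Proof.
move=> cM; rewrite mulmx_sumr mulmx_suml; apply: eq_bigr => i _.
rewrite -scalemxAr -scalemxAl; congr (_ *: _); elim: (_ - _)%N => [|l IH].
  by rewrite !expr0 mul1mx mulmx1.
by rewrite !sqAS mulNmx mulmxN -!mulmxA IH !mulmxA -(mulmxA A) cM !mulmxA cM.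
Qed.

Lemma resolv_prod_skew (K : fieldType) (S : comAlgType K) N (A : 'M[S]_N) f g k l :
  A^T = - A -> (A *m resolv A f k *m resolv A g l)^T = - (A *m resolv A f k *m resolv A g l).
Proof.
move=> skA; rewrite !trmx_mul !resolv_sym // skA !mulmxN; congr (- _).
rewrite -comm_resolv mulmxA -comm_resolv -!mulmxA; congr (_ *m _).
by rewrite resolv_comm // comm_resolv.
Qed.

Section Commutator.
Variables (R : comPzRingType) (N : nat).
Implicit Types A B C : 'M[R]_N.

Lemma comm_skew A B : A^T = - A -> B^T = - B ->
  (A *m B - B *m A)^T = - (A *m B - B *m A).
Proof.
by move=> skA skB; rewrite linearB /= !trmx_mul skA skB !mulNmx !mulmxN !opprK opprB.
Qed.

Lemma tr_commA A B C : \tr (A *m (B *m C - C *m B)) = \tr ((A *m B - B *m A) *m C).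
Proof.
rewrite mulmxBr mulmxBl !raddfB /= -mulmxA [\tr (A *m (C *m B))]mxtrace_mulC.
by rewrite [\tr (B *m A *m C)]mxtrace_mulC -!mulmxA [\tr (C *m _)]mxtrace_mulC -mulmxA.
Qed.
End Commutator.

Section Brackets.
Variables (K : fieldType) (N : nat) (zeta : seq K).
Hypothesis nz2 : (2 : K) != 0.
Local Notation Sa := (Sa K N).
Local Notation A := (genA K N).
Local Notation v := (genv K N).
Local Notation "M %:S" := (map_mx (in_alg Sa) M) (at level 2, left associativity, format "M %:S").
Local Notation br := (@Hcl_bracket K N zeta).

Lemma derivation_bracket f : derivation (br f).
Proof.
have D1 : br f 1 = 0.
  by have := Hcl_bracketMr zeta f 1 1; rewrite !mulr1 mul1r -{1}[br f 1]addr0 => /addrI.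
split=> [g h|g h|c]; first exact: linearD.
- by rewrite Hcl_bracketMr addrC.
- by rewrite Hcl_bracketZr D1 scaler0.
Qed.

Lemma so_elt_entry (M : 'M[Sa]_N) i j : M^T = - M ->
  2^-1 *: \tr (M *m (delta_mx j i - delta_mx i j)%:S) = M i j.
Proof.
move=> skM; have trE k l : \tr (M *m (delta_mx l k)%:S) = M k l.
  rewrite map_delta_mx /mxtrace (bigD1 k) //= big1 ?addr0 => [|m ne].
    rewrite mxE (bigD1 l) //= big1 ?addr0 => [|m ne].
      by rewrite mxE !eqxx mulr1.
    by rewrite mxE (negPf ne) mulr0.
  by rewrite mxE big1 // => q _; rewrite mxE (negPf ne) andbF mulr0.
rewrite map_mxB mulmxBr raddfB /= !trE (skew_ji i j skM) opprK -mulr2n.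
by rewrite -scaler_nat scalerA mulVf // scale1r.
Qed.

(** The order of the two terms is the one for which the associated function tr (AB) / 2 is A_ij
    rather than - A_ij. *)
Definition so_mx i j : 'M[K]_N := delta_mx j i - delta_mx i j.

Lemma so_mx_skew i j : (so_mx i j)^T = - so_mx i j.
Proof. by rewrite linearB /= !trmx_delta opprB. Qed.

Lemma genA_so_elt i j : A i j = so_elt (so_mx i j).
Proof. by rewrite /so_elt so_elt_entry // genA_skew. Qed.

Lemma genv_vec_elt i : v i 0 = vec_elt (vec_basis K i).
Proof. by rewrite coord_vec mxE. Qed.

Lemma bracket_so_A (B : 'M[K]_N) : B^T = - B ->
  map_mx (br (so_elt B)) A = A *m B%:S - B%:S *m A.
Proof.
move=> skB; have skB' : B%:S^T = - B%:S by rewrite map_trmx skB map_mxN.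
apply/matrixP => i j; rewrite mxE genA_so_elt Hcl_bracket_so_so ?so_mx_skew //.
rewrite -so_elt_entry; last exact: comm_skew (genA_skew K N) skB'.
by rewrite /so_elt map_mxB !map_mxM tr_commA.
Qed.

Lemma bracket_so_v (B : 'M[K]_N) : B^T = - B ->
  map_mx (br (so_elt B)) v = - (B%:S *m v).
Proof.
move=> skB; apply/colP => i; rewrite mxE genv_vec_elt Hcl_bracket_so_vec //.
rewrite /vec_elt map_mxM /= dotC dot_trmx map_trmx skB map_mxN mulNmx dotNl mxE.
congr (- _); rewrite dotC /dot /vec_basis map_delta_mx trmx_delta -rowE.
by rewrite mxE.
Qed.

(** The Gram matrix of the bracket on V_N: {x, y} = x^T G y. *)
Definition Gmx : 'M[Sa]_N :=
  \sum_(j < size zeta) (zeta`_j)%:A *: (A *m resolv A (det_sqrtV A) j).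

Lemma Gmx_skew : Gmx^T = - Gmx.
Proof.
rewrite linear_sum -sumrN; apply: eq_bigr => j _.
by rewrite linearZ /= trmx_mul resolv_sym ?genA_skew // mulmxN scalerN comm_resolv.
Qed.

Lemma gamma_dot j x y : gamma j x y A = dot x%:S (A *m resolv A (det_sqrtV A) j *m y%:S).
Proof.
rewrite /gamma ser_mulC; symmetry.
apply: (@resolv_functional _ _ _ _ (fun M => dot x%:S (A *m M *m y%:S))) => [M M'|a M].
  by rewrite mulmxDr mulmxDl dotDr.
by rewrite -scalemxAr -scalemxAl dotZr.
Qed.

Lemma Hcl_VV_dot x y : Hcl_VV zeta x y = dot x%:S (Gmx *m y%:S).
Proof.
rewrite /Gmx mulmx_suml dot_sumr; apply: eq_bigr => j _.
by rewrite gamma_dot -scalemxAl dotZr mulr_algl.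
Qed.

Lemma bracket_vec_A x : map_mx (br (vec_elt x)) A = v *m x%:S^T - x%:S *m v^T.
Proof.
apply/matrixP => i j; rewrite mxE genA_so_elt Hcl_bracket_antisym.
rewrite Hcl_bracket_so_vec ?so_mx_skew // mulmxBl linearB /= opprB.
have E k l : vec_elt (delta_mx k l *m x) = (x l 0)%:A * v k 0.
  rewrite -(mul_delta_mx (0 : 'I_1)) -mulmxA -rowE [row l x]mx11_scalar.
  by rewrite mul_mx_scalar vec_eltZ -genv_vec_elt mxE mulr_algl.
rewrite !E !mxE !big_ord1 !mxE.
by rewrite mulrC.
Qed.

Lemma bracket_vec_v x : map_mx (br (vec_elt x)) v = - (Gmx *m x%:S).
Proof.
apply/colP => i; rewrite mxE genv_vec_elt Hcl_bracket_vec_vec Hcl_VV_dot.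
rewrite dot_trmx Gmx_skew mulNmx dotNl mxE; congr (- _).
rewrite /dot /vec_basis map_delta_mx mxE (bigD1 i) //= big1 ?addr0 => [|j ne].
  by rewrite mxE [delta_mx _ _ _ _]mxE !eqxx mulr1.
by rewrite [delta_mx _ _ _ _]mxE (negPf ne) mulr0.
Qed.

Lemma bracket_coord (a : coord_idx N) :
  (exists2 B, B^T = - B & poly_coord K a = so_elt B) \/
  exists x, poly_coord K a = vec_elt x.
Proof.
case: a => [p|i]; [left; exists (so_basis K p); rewrite ?coord_so //|right].
  by rewrite linearB /= !trmx_delta opprB.
by exists (vec_basis K i); rewrite coord_vec.
Qed.

Lemma Hcl_bracket_dev f g :
  Hcl_bracket zeta f g = dev (@poly_coord K N) (fun s => br f (poly_coord K s)) g.
Proof.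
by rewrite -(chain_rule _ _ (derivation_bracket f)) -(eq_ev (@pt_gen K N)) ev_gen.
Qed.

(** Bracketing with a fixed element is a derivation, hence determined by its values on coordinates,
    which are of the form [so_elt B] or [vec_elt x]. *)
Lemma Poisson_centerP f : Poisson_center br f <->
  (forall B : 'M[K]_N, B^T = - B -> br (so_elt B) f = 0) /\
  (forall x : 'cV[K]_N, br (vec_elt x) f = 0).
Proof.
split=> [cf|[cB cx] g].
  by split=> *; rewrite Hcl_bracket_antisym cf oppr0.
rewrite Hcl_bracket_dev /dev big1 // => s _.
rewrite Hcl_bracket_antisym; case: (bracket_coord s) => [[B skB ->]|[x ->]].
  by rewrite cB // oppr0 mulr0.
by rewrite cx oppr0 mulr0.
Qed.

Lemma central_tau_celt k : Poisson_center br (tau K N k.+1 + celt N zeta k.+1).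
Proof.
apply/Poisson_centerP; split=> [B skB|x].
  have dB := derivation_bracket (so_elt B).
  have skB' : B%:S^T = - B%:S by rewrite map_trmx skB map_mxN.
  rewrite derD' // (der_psi_rot skB' dB (bracket_so_A skB) (bracket_so_v skB)).
  by rewrite (der_cPoly_rot nz2 _ dB (bracket_so_A skB)) ?addr0 // genA_skew.
have dx := derivation_bracket (vec_elt x).
rewrite derD' // (der_psi nz2 (genA_skew K N) dx k Gmx_skew (bracket_vec_A x) (bracket_vec_v x)).
rewrite /celt (der_cPoly nz2 (genA_skew K N) dx) bracket_vec_A.
pose F := resolv A (det_sqrtV A); pose d := resolv A (det_sqrt A) k.
have -> : bmx A k.*2 = (-1) ^+ k *: d.
  by rewrite /d -bmx_resolv ?genA_skew // scalerA -expr2 sqrr_sign scale1r.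
rewrite /Gmx mulmx_suml mulmx_suml dot_sumr -sumrMnl mulr_sumr -big_split big1 //= => m _.
(* Skewness makes the two rank-one terms of the trace equal, giving the factor 2 already present in
   [der_psi]; the signs (-1)^k and (-1)^(k+1) then cancel the two variations. *)
have skM : (A *m F m *m d)^T = - (A *m F m *m d).
  exact: resolv_prod_skew (genA_skew K N).
rewrite mulmxBr raddfB /= !tr_dot -/d -/(F m) (dot_skew v _ skM) opprK.
rewrite -!scalemxAr -!scalemxAl !dotZr -scalerAl mul1r.
by rewrite exprS mulN1r mulNr scalerDr mulrDr -mulr2n subrr.
Qed.
End Brackets.

(** * Pfaffians *)

Section Positions.
Variables (d m : nat).
Hypothesis dm : d = m.*2.

Fact pos_subproof (ib : 'I_m * bool) : (ib.2 + ib.1.*2 < d)%N.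
Proof. by case: ib => [[i /= lt_i] b]; rewrite dm; case: b => /=; lia. Qed.
Definition pos ib : 'I_d := Ordinal (pos_subproof ib).
Fact half_subproof (q : 'I_d) : (q./2 < m)%N.
Proof. by have := ltn_ord q; rewrite {2}dm; lia. Qed.
Definition pos_inv (q : 'I_d) : 'I_m * bool := (Ordinal (half_subproof q), odd q).

Lemma posK : cancel pos pos_inv.
Proof.
case=> i b; rewrite /pos_inv /=; congr (_, _); last by rewrite oddD odd_double oddb addbF.
by apply: val_inj; rewrite /= half_bit_double.
Qed.
Lemma pos_invK : cancel pos_inv pos.
Proof. by move=> q; apply: val_inj; rewrite /= odd_double_half. Qed.

Lemma pos_bij : bijective pos. Proof. by exists pos_inv; [apply: posK|apply: pos_invK]. Qed.

Lemma prod_pos (R : comNzRingType) (F : 'I_d -> R) :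
  \prod_q F q = \prod_i (F (pos (i, false)) * F (pos (i, true))).
Proof.
rewrite (reindex pos) /=; last exact: onW_bij pos_bij.
transitivity (\prod_i \prod_b F (pos (i, b))).
  by rewrite pair_bigA; apply: eq_bigr => -[i b].
by apply: eq_bigr => i _; rewrite big_bool mulrC.
Qed.

Lemma prod_pairs (R : comNzRingType) (F : 'I_d -> 'I_d -> R) :
  \prod_(p : 'I_d * 'I_d | ~~ odd p.1 && (p.2 == p.1.+1 :> nat)) F p.1 p.2 =
  \prod_i F (pos (i, false)) (pos (i, true)).
Proof.
rewrite (reindex_onto (fun i => (pos (i, false), pos (i, true)))
          (fun p => (pos_inv p.1).1)) /=.
  by apply: eq_bigl => i; rewrite -val_eqE /= !add0n odd_double doubleK add1n !eqxx.
case=> p q /= /andP[/negbTE op /eqP qE]; congr (_, _); apply: val_inj => /=.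
  by rewrite add0n -{2}(odd_double_half p) op.
by rewrite add1n qE -{2}(odd_double_half p) op.
Qed.
End Positions.

Lemma sum_perm_fix0 (R : nmodType) n (F : 'S_n.+1 -> R) :
  \sum_(s : 'S_n.+1 | s ord0 == ord0) F s = \sum_s F (lift_perm ord0 ord0 s).
Proof.
have rK (s : 'S_n.+1) (s0 : s ord0 = ord0) k :
    lift ord0 (odflt k (unlift ord0 (s (lift ord0 k)))) = s (lift ord0 k).
  case: unliftP => [j -> //|e]; have := neq_lift ord0 k.
  by rewrite -(inj_eq (@perm_inj _ s)) e s0 eqxx.
pose r (s : 'S_n.+1) : {ffun 'I_n -> 'I_n} :=
  [ffun k => odflt k (unlift ord0 (s (lift ord0 k)))].
rewrite (reindex_onto (lift_perm ord0 ord0) (fun s => insubd (1%g : 'S_n) (r s))) /=.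
  apply: eq_bigl => s; rewrite lift_perm_id eqxx; apply/eqP/permP => k.
  have rE : r (lift_perm ord0 ord0 s) = pval s.
    by apply/ffunP => j; rewrite ffunE lift_perm_lift liftK pvalE.
  by rewrite rE valKd.
move=> s /eqP s0; have rI : injectiveb (r s).
  apply/injectiveP => j k; rewrite !ffunE => /(congr1 (lift ord0)).
  by rewrite !rK // => /perm_inj/lift_inj.
apply/permP => k; case: (unliftP ord0 k) => [j|] ->; last by rewrite lift_perm_id s0.
by rewrite lift_perm_lift -pvalE insubdK // ffunE rK.
Qed.

Section PfaffianSum.
Variables (R : comNzRingType).

(** Defined for arbitrary functions [s], because the expansion in [pfsum_congr] runs over all of
    them before non-permutations drop out. *)
Definition pfterm d m (dm : d = m.*2) (M : 'M[R]_d) (s : 'I_d -> 'I_d) : R :=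
  \prod_(i < m) M (s (pos dm (i, false))) (s (pos dm (i, true))).

Definition pfsum d m (dm : d = m.*2) (M : 'M[R]_d) : R :=
  \sum_(s : 'S_d) (-1) ^+ s * pfterm dm M s.

(** A Cauchy-Binet argument. Expanding the entries gives a sum over all index functions f; summing
    over s first produces a determinant with columns chosen by f. It vanishes if f is not injective,
    and is det g times a sign if f is a permutation. *)
Lemma pfsum_congr d m (dm : d = m.*2) (g M : 'M[R]_d) :
  pfsum dm (g *m M *m g^T) = \det g * pfsum dm M.
Proof.
pose F := {ffun 'I_d -> 'I_d}.
have E (s : 'S_d) : pfterm dm (g *m M *m g^T) s =
    \sum_(f : F) (\prod_q g (s q) (f q)) * pfterm dm M f.
  pose h (i : 'I_m) (kl : 'I_d * 'I_d) := g (s (pos dm (i, false))) kl.1 *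
    g (s (pos dm (i, true))) kl.2 * M kl.1 kl.2.
  transitivity (\prod_i \sum_kl h i kl).
    apply: eq_bigr => i _; transitivity (\sum_l \sum_k h i (k, l)); last first.
      by rewrite exchange_big pair_bigA; apply: eq_bigr => -[k l].
    rewrite mxE; apply: eq_bigr => l _ /=; rewrite !mxE mulr_suml.
    by apply: eq_bigr => k _; rewrite /h /= mulrAC.
  rewrite bigA_distr_bigA.
  pose fw (f : F) : {ffun 'I_m -> 'I_d * 'I_d} :=
    [ffun i => (f (pos dm (i, false)), f (pos dm (i, true)))].
  pose bw (p : {ffun 'I_m -> 'I_d * 'I_d}) : F :=
    [ffun q => let ib := pos_inv dm q in if ib.2 then (p ib.1).2 else (p ib.1).1].
  rewrite (reindex fw) /=; last first.
    apply: onW_bij; exists bw => [f|p]; apply/ffunP => z.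
      rewrite !ffunE; case e: (pos_inv dm z) => [i b] /=.
      by rewrite -[z in RHS](pos_invK dm) e !ffunE; case: b {e}.
    by rewrite !ffunE !posK /=; case: (p z).
  apply: eq_bigr => f _; rewrite (prod_pos dm) /pfterm -big_split.
  by apply: eq_bigr => i _; rewrite /h ffunE.
rewrite /pfsum; under eq_bigr => s _ do rewrite E mulr_sumr.
rewrite exchange_big (bigID (fun f : F => injectiveb f)) /= addrC big1 ?add0r; last first.
  move=> f /injectivePn[i1 [i2 ne ef]].
  transitivity (\det (\matrix_(q, r) g r (f q)) * pfterm dm M f).
    rewrite mulr_suml; apply: eq_bigr => s _; rewrite mulrA; congr (_ * _ * _).
    by apply: eq_bigr => q _; rewrite mxE.
  by rewrite (determinant_alternate ne) ?mul0r // => j; rewrite !mxE ef.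
rewrite (reindex (@pval _)) /=; last first.
  exists (insubd (1%g : 'S_d)) => [s _|f Uf]; last exact: insubdK.
  by apply: val_inj; apply: insubdK; apply: valP.
rewrite mulr_sumr; apply: eq_big => [s|t _]; first exact: valP s.
rewrite -[in RHS]det_tr mulr_suml (reindex_inj (mulgI t)) /=; apply: eq_bigr => s _.
have -> : \prod_q g ((t * s)%g q) (pval t q) = \prod_q g^T q (s q).
  rewrite [RHS](reindex_perm t); apply: eq_bigr => q _.
  by rewrite permM pvalE mxE.
rewrite odd_permM signr_addb [_ ^+ t * _]mulrC mulrACA; congr (_ * (_ * _)).
by apply: eq_bigr => i _; rewrite !pvalE.
Qed.

Variables (d m : nat) (dm : d = m.*2) (M : 'M[R]_d.+2).
Variable dm' : d.+2 = m.+1.*2.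
Let o1 : 'I_d.+2 := lift ord0 ord0.
Let l2 (i : 'I_d) : 'I_d.+2 := lift ord0 (lift ord0 i).
Hypothesis skM : forall i j, M j i = - M i j.
Hypothesis M01 : M ord0 o1 = 1.
Hypothesis M02 : forall i, M ord0 (l2 i) = 0.

Let w (s : 'S_d.+2) := (-1) ^+ s * pfterm dm' M s.

Let P0 (i : 'I_m.+1) := pos dm' (i, false).
Let P1 (i : 'I_m.+1) := pos dm' (i, true).

Let P_neq i j : P0 i != P1 j.
Proof. by rewrite (inj_eq (bij_inj (pos_bij dm'))) xpair_eqE andbF. Qed.

Let P0_eq i j : (P0 i == P0 j) = (i == j).
Proof. by rewrite (inj_eq (bij_inj (pos_bij dm'))) xpair_eqE eqxx andbT. Qed.

Let P1_eq i j : (P1 i == P1 j) = (i == j).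
Proof. by rewrite (inj_eq (bij_inj (pos_bij dm'))) xpair_eqE eqxx andbT. Qed.

Let flip i : 'S_d.+2 := tperm (P0 i) (P1 i).
Let swap i : 'S_d.+2 := (tperm (P0 ord0) (P0 i) * tperm (P1 ord0) (P1 i))%g.

(** The sign of the transposition cancels the sign of the skew entry. *)
Let w_flip i s : w (flip i * s)%g = w s.
Proof.
have E : pfterm dm' M (flip i * s)%g = - pfterm dm' M s.
  rewrite /pfterm (bigD1 i) //= [in RHS](bigD1 i) //= -/(P0 i) -/(P1 i) !permM tpermL tpermR.
  rewrite skM -mulNr; congr (_ * _); apply: eq_bigr => j ne; rewrite -/(P0 j) -/(P1 j).
  by rewrite !permM !tpermD ?P0_eq ?P1_eq ?P_neq // 1?eq_sym ?P_neq // eq_sym.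
by rewrite /w odd_permM odd_tperm P_neq E signr_addb expr1 mulrN mulN1r mulNr opprK.
Qed.

Let swap0 i j : swap i (P0 j) = P0 (tperm ord0 i j).
Proof.
rewrite permM; have P10 k l : P1 k != P0 l by rewrite eq_sym.
case: tpermP => [->|->|/eqP n0 /eqP n1].
- by rewrite tpermL tpermD.
- by rewrite tpermR tpermD.
by rewrite !tpermD // P0_eq eq_sym.
Qed.

Let swap1 i j : swap i (P1 j) = P1 (tperm ord0 i j).
Proof.
rewrite permM [tperm (P0 _) _ _]tpermD //.
case: tpermP => [->|->|/eqP n0 /eqP n1]; rewrite ?tpermL ?tpermR //.
by rewrite tpermD // P1_eq eq_sym.
Qed.

(** Exchanging two pairs is an even permutation and only reorders the factors. *)
Let w_swap i s : w (swap i * s)%g = w s.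
Proof.
have E : pfterm dm' M (swap i * s)%g = pfterm dm' M s.
  rewrite /pfterm [RHS](reindex_perm (tperm ord0 i)); apply: eq_bigr => j _.
  by rewrite -/(P0 j) -/(P1 j) !(permM (swap i)) swap0 swap1.
by rewrite /w E !odd_permM !odd_tperm P0_eq P1_eq addbb addFb.
Qed.

(** Permutations are sorted by the position a at which they take the value 0. Flips and swaps carry
    any class to the class a = 0, so all d + 2 = 2 (m + 1) classes contribute equally. In that class
    the shape of the first row of M leaves only the permutations fixing 1 as well. *)
Lemma pfsum_block :
  pfsum dm' M = (2 * m.+1)%N%:R * pfsum dm (\matrix_(i, j) M (l2 i) (l2 j)).
Proof.
pose Z := \sum_(s : 'S_d.+2 | s ord0 == ord0) w s.
have P00 : P0 ord0 = ord0 by apply: val_inj.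
transitivity (\sum_(a : 'I_d.+2) Z).
  rewrite /pfsum -/(w _) (partition_big (fun s : 'S_d.+2 => (s^-1)%g ord0) xpredT) //=.
  apply: eq_bigr => a _.
  have [h ha wh] : exists2 h : 'S_d.+2, h a = ord0 & forall s, w (h * s)%g = w s.
    rewrite -(pos_invK dm' a); case: (pos_inv dm' a) => i [].
      exists (flip i * swap i)%g => [|s]; last by rewrite -mulgA w_flip w_swap.
      by rewrite permM tpermR swap0 tpermR.
    exists (swap i) => [|s]; last by rewrite w_swap.
    by rewrite swap0 tpermR.
  rewrite (reindex_inj (mulgI h)) /=; apply: eq_big => [s|s _]; last exact: wh.
  by rewrite -ha -(inj_eq (@perm_inj _ (h * s)%g)) permKV permM eq_sym.
rewrite sumr_const card_ord -[LHS]mulr_natl; congr (_ * _).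
  by apply: (congr1 (fun n => n%:R)); rewrite dm; lia.
have -> : Z = \sum_(s : 'S_d.+1) w (lift_perm ord0 ord0 s) by rewrite /Z sum_perm_fix0.
have P10 : P1 ord0 = o1 by apply: val_inj.
rewrite (bigID (fun s : 'S_d.+1 => s ord0 == ord0)) /= [X in _ + X]big1 ?addr0; last first.
  move=> s s0; rewrite /w /pfterm (bigD1 ord0) //= -/(P0 _) -/(P1 _) P00 P10.
  rewrite lift_perm_id lift_perm_lift; case: (unliftP ord0 (s ord0)) s0 => [j|] -> //.
  by rewrite -/(l2 j) M02 mul0r mulr0.
rewrite sum_perm_fix0; apply: eq_bigr => s _.
rewrite /w !odd_lift_perm /=; congr (_ * _).
rewrite /pfterm big_ord_recl -/(P0 _) -/(P1 _) P00 P10 lift_perm_id.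
rewrite lift_perm_lift lift_perm_id M01 mul1r; apply: eq_bigr => i _.
have lP b : pos dm' (lift ord0 i, b) = l2 (pos dm (i, b)).
  by apply: val_inj; rewrite /= /bump /=; lia.
by rewrite !lP !lift_perm_lift mxE.
Qed.
End PfaffianSum.

Lemma rmorph_scale (K : fieldType) (S T : comAlgType K) (h : {rmorphism S -> T}) c x :
  (forall c : K, h c%:A = c%:A) -> h (c *: x) = c *: h x.
Proof. by move=> hC; rewrite -mulr_algl rmorphM /= hC mulr_algl. Qed.

Section Pfaffian.
Variables (K : fieldType) (S : comAlgType K).

Lemma pfaffianE d m (dm : d = m.*2) (M : 'M[S]_d) :
  pfaffian M = ((2 ^ m * m`!)%:R^-1 : K) *: pfsum dm M.
Proof.
rewrite /pfaffian {1 2}dm doubleK; congr (_ *: _); apply: eq_bigr => s _.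
by congr (_ * _); rewrite (prod_pairs dm (fun p q => M (s p) (s q))).
Qed.

Lemma pfaffian_congr d (g M : 'M[S]_d) : ~~ odd d ->
  pfaffian (g *m M *m g^T) = \det g * pfaffian M.
Proof.
move=> ed; have dm : d = (d./2).*2 by rewrite even_halfK.
by rewrite !(pfaffianE dm) pfsum_congr scalerAr.
Qed.

Lemma pfaffian_block d (M : 'M[S]_d.+2) : ~~ odd d -> [pchar K] =i pred0 ->
  (forall i j, M j i = - M i j) ->
  M ord0 (lift ord0 ord0) = 1 ->
  (forall i, M ord0 (lift ord0 (lift ord0 i)) = 0) ->
  pfaffian M = pfaffian (\matrix_(i, j) M (lift ord0 (lift ord0 i)) (lift ord0 (lift ord0 j))).
Proof.
move=> ed K0 skM M01 M02; have dm : d = (d./2).*2 by rewrite even_halfK.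
have dm' : d.+2 = (d./2).+1.*2 by rewrite doubleS -dm.
rewrite (pfaffianE dm) (pfaffianE dm').
rewrite (pfsum_block dm dm' skM M01 M02) mulr_natl -scaler_nat scalerA.
have nz n : (0 < n)%N -> n%:R != 0 :> K by move=> n0; rewrite ((pcharf0P K).1 K0) -lt0n.
have -> : (2 ^ d./2.+1 * (d./2).+1`! = 2 * d./2.+1 * (2 ^ d./2 * (d./2)`!))%N.
  by rewrite expnS factS; ring.
by rewrite natrM invfM mulrAC mulVf ?mul1r // nz.
Qed.

Lemma pfaffian_map (T : comAlgType K) (h : {rmorphism S -> T}) d (M : 'M[S]_d) :
  (forall c : K, h c%:A = c%:A) -> pfaffian (map_mx h M) = h (pfaffian M).
Proof.
move=> hC; rewrite /pfaffian rmorph_scale //; congr (_ *: _).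
rewrite rmorph_sum; apply: eq_bigr => s _; rewrite rmorphM rmorph_sign rmorph_prod.
by congr (_ * _); apply: eq_bigr => p _; rewrite mxE.
Qed.

Lemma psihat_map (T : comAlgType K) (h : {rmorphism S -> T}) N (A : 'M[S]_N) v :
  (forall c : K, h c%:A = c%:A) ->
  psihat (map_mx h A) (map_mx h v) = h (psihat A v).
Proof.
move=> hC; rewrite /psihat -pfaffian_map // map_block_mx; congr (pfaffian (block_mx _ _ _ _)).
  by rewrite map_mxN map_trmx.
by rewrite map_mx0.
Qed.

Definition bordered N (A : 'M[S]_N) (v : 'cV[S]_N) : 'M[S]_(N + 1) :=
  block_mx A v (- v^T) 0.

Lemma bordered_skew N (A : 'M[S]_N) v : A^T = - A -> (bordered A v)^T = - bordered A v.
Proof.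
move=> skA; rewrite /bordered tr_block_mx opp_block_mx skA trmx0 oppr0 opprK.
by rewrite linearN /= trmxK.
Qed.

Lemma skew_ulsub N (M : 'M[S]_(N + 1)) : M^T = - M -> (ulsubmx M)^T = - ulsubmx M.
Proof. by move=> skM; rewrite trmx_ulsub skM; apply/matrixP => i j; rewrite !mxE. Qed.

Lemma skew_bordered N (M : 'M[S]_(N + 1)) : (2 : K) != 0 -> M^T = - M ->
  M = bordered (ulsubmx M) (ursubmx M).
Proof.
move=> nz2 skM; rewrite /bordered -{1}(submxK M); congr (block_mx _ _ _ _).
  by rewrite -[dlsubmx M]trmxK trmx_dlsub skM; apply/matrixP => i j; rewrite !mxE.
by apply/matrixP => i j; rewrite !mxE !ord1 skew_ii.
Qed.
End Pfaffian.

Section Kconst.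
Variables (K : fieldType) (S : comAlgType K).
Definition kconst : S -> kpoly S := polyC.
HB.instance Definition _ := GRing.RMorphism.copy kconst (polyC : S -> {poly S}).
Lemma kconst_alg (c : K) : kconst c%:A = c%:A.
Proof. by rewrite kpoly_algE. Qed.
End Kconst.

Section BorderedDerivation.
Variables (K : fieldType) (S : comAlgType K) (N : nat) (D : S -> S).
Hypothesis dD : derivation D.
Variables (A : 'M[S]_N) (v : 'cV[S]_N).

Lemma der_bordered : map_mx D (bordered A v) =
  block_mx (map_mx D A) (map_mx D v) (- (map_mx D v)^T) 0.
Proof.
rewrite map_block_mx derNx // derTx; congr block_mx.
by apply/matrixP => i j; rewrite !mxE der0.
Qed.

Lemma der_bordered_rot (B : 'M[S]_N) : B^T = - B ->
  map_mx D A = A *m B - B *m A -> map_mx D v = - (B *m v) ->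
  let X : 'M_(N + 1) := block_mx (- B) 0 0 0 in
  map_mx D (bordered A v) = X *m bordered A v + bordered A v *m X^T.
Proof.
move=> skB DA Dv /=; rewrite der_bordered DA Dv /bordered tr_block_mx !mulmx_block.
have NBT : (- B)^T = B by rewrite linearN /= skB opprK.
have BvT : (- (B *m v))^T = v^T *m B by rewrite linearN /= trmx_mul skB mulmxN opprK.
rewrite add_block_mx NBT BvT !trmx0 !mulmx0 !mul0mx !addr0 !add0r !mulNmx.
by rewrite [- _ + _]addrC.
Qed.

Lemma der_bordered_translation (x z : 'cV[S]_N) : A^T = - A ->
  map_mx D A = v *m x^T - x *m v^T -> map_mx D v = A *m z ->
  let X : 'M_(N + 1) := block_mx 0 x z^T 0 in
  map_mx D (bordered A v) = X *m bordered A v + bordered A v *m X^T.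
Proof.
move=> skA DA Dv /=; rewrite der_bordered DA Dv /bordered tr_block_mx !mulmx_block.
rewrite add_block_mx trmxK !trmx0 !mulmx0 !mul0mx !addr0 !add0r.
rewrite trmx_mul skA !mulmxN !mulNmx opprK addrC.
congr block_mx; apply/matrixP => i j; rewrite !ord1 mxE [RHS]mxE [X in _ = _ + X]mxE.
by rewrite -/(dot z v) -/(dot v z) dotC subrr.
Qed.
End BorderedDerivation.

Section PathCoefficients.
Variables (K : fieldType) (N : nat) (S : comAlgType K).
Variable P : coord_idx N -> kpoly S.

(** Evaluation along a path modulo t^2: the value at the start, and the differential applied to the
    initial velocity. *)
Lemma ev_kpoly_coef f :
  (ev P f : {poly S})`_0 = ev (fun s => (P s : {poly S})`_0) f /\
  (ev P f : {poly S})`_1 =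
    dev (fun s => (P s : {poly S})`_0) (fun s => (P s : {poly S})`_1) f.
Proof.
elim/Sa_ind: f => [c|f g [f0 f1] [g0 g1]|s f [f0 f1]].
- by rewrite !ev_alg dev_alg kpoly_algE !coefC.
- by rewrite rmorphD !coefD f0 f1 g0 g1 rmorphD devD.
rewrite rmorphM /= ev_coord coef0M coefM !big_ord_recl big_ord0 /= subn0 subnn addr0.
by rewrite f0 f1 rmorphM /= ev_coord devM dev_coord ev_coord addrC.
Qed.
End PathCoefficients.

Section Congruence.
Variables (K : fieldType) (S : comAlgType K) (n : nat).
Implicit Types X M : 'M[S]_n.

Definition inf_congr X M : 'M[kpoly S]_n :=
  (1%:M + 'X *: map_mx polyC X) *m map_mx (@kconst K S) M *m
  (1%:M + 'X *: map_mx polyC X)^T.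

Lemma inf_congrE X M : inf_congr X M = map_mx polyC M +
  'X *: (map_mx polyC (X *m M + M *m X^T) + 'X *: map_mx polyC (X *m M *m X^T)).
Proof.
rewrite /inf_congr linearD /= trmx1 linearZ /= map_trmx.
rewrite mulmxDl mul1mx mulmxDr mulmx1 !map_mxD !map_mxM /=.
rewrite -!scalemxAl mulmxDl -!scalemxAr -!scalemxAl -!map_mxM /= -/(kconst _).
by rewrite -addrA; congr (_ + _); rewrite -!scalerDr addrA.
Qed.

Lemma inf_congr_coef0 X M i j : (inf_congr X M i j : {poly S})`_0 = M i j.
Proof. by rewrite inf_congrE !mxE coefD coefXM coefC /= addr0. Qed.

Lemma inf_congr_coef1 X M i j :
  (inf_congr X M i j : {poly S})`_1 = (X *m M + M *m X^T) i j.
Proof.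
rewrite inf_congrE; move: (X *m M + M *m X^T) (X *m M *m X^T) => Y Z.
by rewrite !mxE coefD coefXM coefD coefXM !coefC /= add0r addr0.
Qed.

Lemma charcoef1 X : charcoef X 1 = \tr X.
Proof.
have := der_det (1%:M + 'X *: map_mx polyC X : 'M[kpoly S]_n) (@derivation_deriv K S).
move/(congr1 (coefp 0)); rewrite /= coef_deriv mulr1n -/(charcoef X 1) => ->.
have -> : map_mx (@deriv S : kpoly S -> kpoly S) (1%:M + 'X *: map_mx polyC X) = map_mx polyC X.
  apply/matrixP => i j; rewrite !mxE derivD derivM derivX derivC mulr0 addr0 mul1r.
  by case: eqP => _; rewrite ?mulr0n ?mulr1n ?deriv0 ?derivC add0r.
have c0 := coef_adj X 0; rewrite expr0 scale1r /= in c0.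
rewrite -[in RHS](mul1mx X) -c0.
rewrite /mxtrace coef_sum; apply: eq_bigr => i _; rewrite !mxE coef_sum.
by apply: eq_bigr => j _; rewrite !mxE coefMC.
Qed.
End Congruence.

Section Tauhat.
Variables (K : fieldType) (N : nat).
Hypothesis nz2 : (2 : K) != 0.
Local Notation Sa := (Sa K N).
Local Notation A := (genA K N).
Local Notation v := (genv K N).

(* The t-coefficient of Pf (g M g^T) = det g Pf M at g = 1 + t X. *)
Lemma der_tauhat (D : Sa -> Sa) (X : 'M[Sa]_(N + 1)) : derivation D -> odd N -> \tr X = 0 ->
  map_mx D (bordered A v) = X *m bordered A v + bordered A v *m X^T ->
  D (tauhat K N) = 0.
Proof.
move=> dD oddN trX DM; pose M' := inf_congr X (bordered A v).
have skM' : M'^T = - M'.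
  rewrite /M' /inf_congr !trmx_mul trmxK map_trmx bordered_skew ?genA_skew // map_mxN.
  by rewrite mulNmx mulmxN mulmxA.
have M'E := skew_bordered nz2 skM'.
have skA' : (ulsubmx M')^T = - ulsubmx M' by apply: skew_ulsub.
have E : ev (pt (ulsubmx M') (ursubmx M')) (tauhat K N) = chpoly X * kconst (tauhat K N).
  rewrite /tauhat -psihat_map; last exact: ev_alg.
  rewrite ev_genA // ev_genv /psihat -/(bordered _ _) -M'E pfaffian_congr; last first.
    by rewrite addn1 /= negbK.
  by congr (_ * _); exact: (pfaffian_map _ (@kconst_alg K Sa)).
have [_] := ev_kpoly_coef (pt (ulsubmx M') (ursubmx M')) (tauhat K N).
rewrite E coefMC -/(charcoef X 1) charcoef1 trX mul0r => e.
rewrite -[tauhat K N]ev_gen chain_rule // [RHS]e.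
have ulE (M : 'M[kpoly Sa]_(N + 1)) i j : ulsubmx M i j = M (lshift 1 i) (lshift 1 j).
  by rewrite !mxE.
have urE (M : 'M[kpoly Sa]_(N + 1)) i j : ursubmx M i j = M (lshift 1 i) (rshift N j).
  by rewrite !mxE.
have P0 : (fun s => (pt (ulsubmx M') (ursubmx M') s : {poly Sa})`_0) =1 pt A v.
  by case=> [p|i]; rewrite /= ?ulE ?urE inf_congr_coef0 ?block_mxEul ?block_mxEur.
rewrite /dev; apply: eq_bigr => s _; rewrite (eq_ev P0); congr (_ * _).
by case: s => [p|i]; rewrite /= ?ulE ?urE inf_congr_coef1 -DM [in RHS]mxE ?block_mxEul ?block_mxEur.
Qed.

Lemma central_tauhat (zeta : seq K) : odd N ->
  Poisson_center (@Hcl_bracket K N zeta) (tauhat K N).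
Proof.
move=> oddN; apply/(Poisson_centerP _ nz2); split=> [B skB|x].
  set B' := map_mx (in_alg Sa) B; have skB' : B'^T = - B' by rewrite map_trmx skB map_mxN.
  apply: (der_tauhat (X := block_mx (- B') 0 0 0) (derivation_bracket _ _)) => //.
    rewrite mxtrace_block mxtrace0 addr0 raddfN /=; apply/eqP; rewrite oppr_eq0; apply/eqP.
    by rewrite /mxtrace big1 // => i _; rewrite skew_ii.
  apply: der_bordered_rot => //; first exact: derivation_bracket.
  - exact: bracket_so_A.
  - exact: bracket_so_v.
pose x' := map_mx (in_alg Sa) x.
(* Every term of [Gmx] has a left factor A; removing it writes the velocity - G x of v as A z, the
   form that an infinitesimal congruence of the bordered matrix can produce. *)
pose z := - (\sum_(j < size zeta) (zeta`_j)%:A *: resolv A (det_sqrtV A) j) *m x'.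
apply: (der_tauhat (X := block_mx 0 x' z^T 0) (derivation_bracket _ _)) => //.
  by rewrite mxtrace_block !mxtrace0 addr0.
apply: der_bordered_translation; [exact: derivation_bracket|exact: genA_skew| |].
  exact: bracket_vec_A.
rewrite bracket_vec_v // /z mulNmx mulmxN; congr (- _); rewrite mulmxA; congr (_ *m _).
by rewrite /Gmx mulmx_sumr; apply: eq_bigr => j _; rewrite -scalemxAr.
Qed.
End Tauhat.

(** * Invariance of central elements along paths *)

Section KpolyEval.
Variables (K : fieldType) (S : comAlgType K).

Definition keval (c : S) : kpoly S -> S := horner_eval c.
HB.instance Definition _ c := GRing.RMorphism.copy (keval c) (horner_eval c).

Lemma keval_alg c (a : K) : keval c a%:A = a%:A.
Proof. by rewrite kpoly_algE /keval /horner_eval hornerC. Qed.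

Lemma keval_const c a : keval c (kconst a) = a.
Proof. by rewrite /keval /horner_eval hornerC. Qed.

Lemma keval_constx c m n (M : 'M[S]_(m, n)) : map_mx (keval c) (map_mx (@kconst K S) M) = M.
Proof. by apply/matrixP => i j; rewrite !mxE keval_const. Qed.

Lemma deriv_kconstx m n (M : 'M[S]_(m, n)) :
  map_mx (@deriv S : kpoly S -> kpoly S) (map_mx (@kconst K S) M) = 0.
Proof. by apply/matrixP => i j; rewrite !mxE derivC. Qed.

Lemma map_skew (T T' : pzRingType) (g : {rmorphism T -> T'}) n (M : 'M[T]_n) :
  M^T = - M -> (map_mx g M)^T = - map_mx g M.
Proof. by move=> skM; rewrite map_trmx skM map_mxN. Qed.

Lemma kevalX c : keval c 'X = c. Proof. exact: hornerX. Qed.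

Lemma natr_unit_eq0 n (a : S) : [pchar K] =i pred0 -> a *+ n.+1 = 0 -> a = 0.
Proof.
move=> K0; rewrite -scaler_nat => /(congr1 (fun z : S => (n.+1%:R^-1 : K) *: z)).
by rewrite scalerA mulVf ?scale1r ?scaler0 // ((pcharf0P K).1 K0).
Qed.

Lemma deriv_eq0 (p : {poly S}) : [pchar K] =i pred0 -> p^`() = 0 -> p = (p`_0)%:P.
Proof.
move=> K0 dp; apply/polyP => -[|k]; rewrite coefC //=.
by have /(congr1 (coefp k)) := dp; rewrite /= coef_deriv coef0 => /(natr_unit_eq0 K0).
Qed.
End KpolyEval.

Definition inv2 (K : fieldType) : K := 2^-1.

Section Centrality.
Variables (K : fieldType) (N : nat).
Hypothesis K0 : [pchar K] =i pred0.
Variable h : Sa K N.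
Hypothesis ch : Poisson_center (@Hcl_bracket K N [::]) h.

Let nz2 : (2 : K) != 0. Proof. by rewrite ((pcharf0P K).1 K0). Qed.

Section Point.
Variables (S : comAlgType K) (A : 'M[S]_N) (v : 'cV[S]_N).
Hypothesis skA : A^T = - A.
Implicit Types (B : 'M[S]_N) (u : 'cV[S]_N).

Lemma dev_mor (T : comAlgType K) (g : {rmorphism T -> S}) (P Q : coord_idx N -> T) f :
  (forall c : K, g c%:A = c%:A) -> g (dev P Q f) = dev (g \o P) (g \o Q) f.
Proof.
by move=> gC; rewrite rmorph_sum; apply: eq_bigr => s _; rewrite rmorphM ev_mor.
Qed.

Let dir B u := pt (B *m A - A *m B + v *m u^T - u *m v^T) (B *m v).
Let L B u := dev (pt A v) (dir B u) h.

Let LD B B' u u' : L (B + B') (u + u') = L B u + L B' u'.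
Proof.
rewrite /L /dev -big_split; apply: eq_bigr => s _; rewrite /= -mulrDr; congr (_ * _).
rewrite /dir.
have -> : (B + B') *m A - A *m (B + B') + v *m (u + u')^T - (u + u') *m v^T =
    (B *m A - A *m B + v *m u^T - u *m v^T) + (B' *m A - A *m B' + v *m u'^T - u' *m v^T).
  have -> : (u + u')^T = u^T + u'^T by rewrite linearD.
  rewrite !(mulmxDl, mulmxDr).
  move: (B *m A) (B' *m A) (A *m B) (A *m B') (v *m u^T) (v *m u'^T) (u *m v^T) (u' *m v^T).
  by move=> *; apply/matrixP => i j; rewrite !mxE; ring.
by rewrite mulmxDl; case: s => [p|i]; rewrite /= mxE.
Qed.

Let LZ a B u : L (a *: B) (a *: u) = a * L B u.
Proof.
rewrite /L /dev mulr_sumr; apply: eq_bigr => s _; rewrite mulrCA; congr (_ * _).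
rewrite /dir; have -> : (a *: u)^T = a *: u^T by rewrite linearZ.
rewrite -!(scalemxAl, scalemxAr).
move: (B *m A) (A *m B) (v *m u^T) (u *m v^T) (B *m v) => *.
by case: s => [p|i]; rewrite /= !mxE; ring.
Qed.

Let L0 : L 0 0 = 0. Proof. by have := LZ 0 0 0; rewrite !scaler0 mul0r. Qed.

Let L_so (C : 'M[K]_N) : C^T = - C -> L (map_mx (in_alg S) C) 0 = 0.
Proof.
move=> skC; pose D := @Hcl_bracket K N [::] (so_elt C).
have : D h = 0 by rewrite /D Hcl_bracket_antisym ch oppr0.
rewrite /D Hcl_bracket_dev => /(congr1 (ev (pt A v))); rewrite dev_mor; last exact: ev_alg.
rewrite rmorph0 => e; rewrite -[RHS]oppr0 -{}e /L /dev -sumrN.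
have mC n (X : 'M[K]_(N, n)) : map_mx (ev (pt A v)) (map_mx (in_alg (Sa K N)) X) = map_mx (in_alg S) X.
  by apply/matrixP => i j; rewrite !mxE ev_alg.
have Q : ev (pt A v) \o (fun s => D (poly_coord K s)) =1
    pt (A *m map_mx (in_alg S) C - map_mx (in_alg S) C *m A) (- (map_mx (in_alg S) C *m v)).
  move=> s /=; rewrite -(@pt_gen K N s) -[D _]/((D \o pt _ _) s) map_pt bracket_so_A // bracket_so_v //.
  rewrite -[ev _ _]/((ev (pt A v) \o pt _ _) s) map_pt map_mxB map_mxN !map_mxM /= mC.
  by rewrite ev_genA // ev_genv.
apply: eq_bigr => s _; rewrite Q -mulrN; congr (_ * _).
  by apply: eq_ev => t /=; rewrite ev_coord.
by rewrite /dir trmx0 mulmx0 mul0mx addr0 subr0; case: s {Q} => [p|i]; rewrite /= !mxE ?opprK ?opprB.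
Qed.

Let L_vec (x : 'cV[K]_N) : L 0 (map_mx (in_alg S) x) = 0.
Proof.
pose D := @Hcl_bracket K N [::] (vec_elt x).
have : D h = 0 by rewrite /D Hcl_bracket_antisym ch oppr0.
rewrite /D Hcl_bracket_dev => /(congr1 (ev (pt A v))); rewrite dev_mor; last exact: ev_alg.
rewrite rmorph0 => <-; rewrite /L /dev.
have mx : map_mx (ev (pt A v)) (map_mx (in_alg (Sa K N)) x) = map_mx (in_alg S) x.
  by apply/matrixP => i j; rewrite !mxE ev_alg.
have Q : ev (pt A v) \o (fun s => D (poly_coord K s)) =1
    pt (v *m (map_mx (in_alg S) x)^T - map_mx (in_alg S) x *m v^T) 0.
  move=> s /=; rewrite -(@pt_gen K N s) -[D _]/((D \o pt _ _) s) map_pt bracket_vec_A // bracket_vec_v //.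
  rewrite -[ev _ _]/((ev (pt A v) \o pt _ _) s) map_pt map_mxB map_mxN !map_mxM /= -!map_trmx mx.
  rewrite ev_genv /Gmx big_ord0; case: s => [p|i] //=; by rewrite !mxE big1 ?oppr0 // => j _; rewrite !mxE rmorph0 mul0r.
apply: eq_bigr => s _; rewrite Q; congr (_ * _).
  by apply: eq_ev => t /=; rewrite ev_coord.
by rewrite /dir !mulmx0 !mul0mx subr0 add0r.
Qed.

(** The direction is linear over [S] in (B, u). For entries in [K] it is, up to sign, the
    Hamiltonian direction of [so_elt] or [vec_elt], which kills h; linearity extends this to all
    entries in [S]. *)
Lemma central_dev B u : B^T = - B ->
  dev (pt A v) (pt (B *m A - A *m B + v *m u^T - u *m v^T) (B *m v)) h = 0.
Proof.
move=> skB; rewrite -/(L B u).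
have Lsum I (r : seq I) (F : I -> 'M[S]_N) (G : I -> 'cV[S]_N) :
    (forall i, L (F i) (G i) = 0) -> L (\sum_(i <- r) F i) (\sum_(i <- r) G i) = 0.
  move=> FG; elim: r => [|i r IH]; first by rewrite !big_nil L0.
  by rewrite !big_cons LD FG IH addr0.
rewrite -[B]addr0 -[u]add0r LD.
have -> : L 0 u = 0.
  have -> : u = \sum_(i < N) u i 0 *: map_mx (in_alg S) (delta_mx i 0).
    by rewrite {1}(matrix_sum_delta u); apply: eq_bigr => i _; rewrite big_ord1 map_delta_mx.
  have {1}-> : 0 = \sum_(i < N) u i 0 *: (0 : 'M[S]_N) by rewrite big1 // => i _; rewrite scaler0.
  by apply: Lsum => i; rewrite LZ L_vec mulr0.
(* Both orders of each pair occur, whence the factor 1/2; the sign comes from the order of the terms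
   in [so_mx]. *)
have -> : B = \sum_(i < N) \sum_(j < N) (- 2^-1 *: B i j) *: map_mx (in_alg S) (so_mx K i j).
  have BT : B^T = \sum_i \sum_j B i j *: delta_mx j i.
    rewrite {1}(matrix_sum_delta B^T) exchange_big; apply: eq_bigr => i _.
    by apply: eq_bigr => j _; rewrite mxE.
  pose c : S := (- 2^-1 : K)%:A; transitivity (c *: (B^T - B)).
    rewrite skB -opprD -mulr2n scalerN -scaler_nat scalerA -scaleNr /c.
    by rewrite mulr_natr scalerMnl -mulr_natr mulNr mulVf // scaleN1r opprK scale1r.
  rewrite BT {2}(matrix_sum_delta B) -sumrB scaler_sumr; apply: eq_bigr => i _.
  rewrite -sumrB scaler_sumr; apply: eq_bigr => j _.
  by rewrite -scalerBr scalerA /c mulr_algl map_mxB !map_delta_mx.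
have {1}-> : 0 = \sum_(i < N) \sum_(j < N) (- 2^-1 *: B i j) *: (0 : 'cV[S]_N).
  by rewrite big1 // => i _; rewrite big1 // => j _; rewrite scaler0.
rewrite addr0; apply: (Lsum _ _ (fun i => \sum_j _) (fun i => \sum_j _)) => i.
by apply: Lsum => j; rewrite LZ L_so ?mulr0 // so_mx_skew.
Qed.
End Point.

(** [B] and [u] may vary along the path. By [central_dev] over [kpoly S] the formal derivative of h
    along it is 0, so h is constant in characteristic 0. *)
Lemma path_const (S : comAlgType K) (A B : 'M[kpoly S]_N) (v u : 'cV[kpoly S]_N) a b :
  A^T = - A -> B^T = - B ->
  map_mx (@deriv S : kpoly S -> kpoly S) A = B *m A - A *m B + v *m u^T - u *m v^T ->
  map_mx (@deriv S : kpoly S -> kpoly S) v = B *m v ->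
  ev (pt (map_mx (keval a) A) (map_mx (keval a) v)) h =
  ev (pt (map_mx (keval b) A) (map_mx (keval b) v)) h.
Proof.
move=> skA skB dA dv; pose p : kpoly S := ev (pt A v) h.
have pE c : ev (pt (map_mx (keval c) A) (map_mx (keval c) v)) h = keval c p.
  by rewrite /p (ev_mor _ _ (keval_alg c)); apply: eq_ev => s; rewrite map_pt.
have : (p : {poly S})^`() = 0.
  rewrite -[LHS]/((@deriv S : kpoly S -> kpoly S) p) /p (chain_rule _ _ (derivation_deriv S)).
  by rewrite (eq_dev _ _ (map_pt _ _ _)) dA dv central_dev.
by move/(deriv_eq0 K0) => e; rewrite !pE /keval /horner_eval e !hornerC.
Qed.

(** The velocity of A depends only on v and u, both fixed, so the path is a straight line. *)
Lemma translation_inv (S : comAlgType K) (A : 'M[S]_N) (v u : 'cV[S]_N) : A^T = - A ->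
  ev (pt (A + (v *m u^T - u *m v^T)) v) h = ev (pt A v) h.
Proof.
move=> skA; pose k n m (M : 'M[S]_(m, n)) := map_mx (@kconst K S) M.
pose At := k _ _ A + 'X *: (k _ _ v *m (k _ _ u)^T - k _ _ u *m (k _ _ v)^T).
have H c : ev (pt (A + c *: (v *m u^T - u *m v^T)) v) h = ev (pt (map_mx (keval c) At) (map_mx (keval c) (k _ _ v))) h.
  rewrite /At map_mxD map_mxZ map_mxB !map_mxM /= !map_trmx !keval_constx.
  by rewrite kevalX.
rewrite -[in RHS](addr0 A) -(scale0r (v *m u^T - u *m v^T)) -[in LHS](scale1r (v *m u^T - _)) !H.
apply: (path_const (B := 0) (u := k _ _ u)); rewrite ?trmx0 ?oppr0 //.
- rewrite /At linearD /= linearZ /= linearB /= !trmx_mul !trmxK.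
  by rewrite (map_skew _ skA) opprD -scalerN opprB.
- have dd := derivation_deriv S; rewrite /At derDx // deriv_kconstx add0r derZx //.
  rewrite derivX scale1r derDx // derNx // !derMx // !derTx // !deriv_kconstx.
  by rewrite !(trmx0, mulmx0, mul0mx, addr0, oppr0, scaler0, add0r).
- by rewrite /k deriv_kconstx mul0mx.
Qed.

(* 1 + E + E^2 / 2 = exp E when E^3 = 0. *)
Definition unip (S : comAlgType K) n (E : 'M[S]_n) : 'M[S]_n :=
  1%:M + E + (inv2 K)%:A *: (E *m E).

Lemma unip_map (S T : comAlgType K) (g : {rmorphism S -> T}) n (E : 'M[S]_n) :
  (forall c : K, g c%:A = c%:A) -> map_mx g (unip E) = unip (map_mx g E).
Proof. by move=> gC; rewrite /unip !map_mxD map_mx1 map_mxZ gC map_mxM. Qed.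

Lemma der_unip (T : comAlgType K) (D : T -> T) n (E : 'M[T]_n) X : derivation D ->
  D X = 1 -> map_mx D E = 0 -> E *m E *m E = 0 ->
  map_mx D (unip (X *: E)) = E *m unip (X *: E).
Proof.
move=> dD DX DE E3.
have -> : unip (X *: E) = 1%:M + X *: E + ((inv2 K)%:A * (X * X)) *: (E *m E).
  by rewrite /unip -scalemxAr -scalemxAl !scalerA mulrA.
have DcX : D ((inv2 K)%:A * (X * X)) = X.
  rewrite !(derM dD) (derC dD) mul0r add0r DX mul1r mulr1 -mulr2n.
  by rewrite mulr_algl -scaler_nat scalerA mulVf // scale1r.
rewrite !derDx // der1x // !derZx // derMx // DE DX DcX mul0mx mulmx0.
rewrite !(scaler0, add0r, addr0) scale1r !mulmxDr mulmx1 -!scalemxAr mulmxA E3.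
by rewrite scaler0 addr0.
Qed.

Lemma unipotent_inv (S : comAlgType K) (A E : 'M[S]_N) (v : 'cV[S]_N) :
  A^T = - A -> E^T = - E -> E *m E *m E = 0 ->
  ev (pt (unip E *m A *m (unip E)^T) (unip E *m v)) h = ev (pt A v) h.
Proof.
move=> skA skE E3; pose kc := map_mx (@kconst K S).
pose kE : 'M[kpoly S]_N := map_mx (@kconst K S) E.
pose kA : 'M[kpoly S]_N := map_mx (@kconst K S) A.
pose kv : 'cV[kpoly S]_N := map_mx (@kconst K S) v.
pose g : 'M[kpoly S]_N := @unip (kpoly S) N ('X *: kE).
have skkA : kA^T = - kA by apply: map_skew.
have skkE : kE^T = - kE by apply: map_skew.
have kE3 : kE *m kE *m kE = 0 by rewrite /kE -!map_mxM E3 map_mx0.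
have H c : ev (pt (unip (c *: E) *m A *m (unip (c *: E))^T) (unip (c *: E) *m v)) h =
    ev (pt (map_mx (keval c) (g *m kA *m g^T)) (map_mx (keval c) (g *m kv))) h.
  rewrite !map_mxM -map_trmx unip_map; last exact: keval_alg.
  by rewrite map_mxZ /= kevalX !keval_constx.
have u0 : unip (0 : 'M[S]_N) = 1%:M by rewrite /unip mul0mx scaler0 !addr0.
have := H 0; rewrite scale0r u0 mul1mx trmx1 mulmx1 mul1mx => ->.
have := H 1; rewrite scale1r => ->.
have dd := derivation_deriv S.
have dg : map_mx (@deriv S : kpoly S -> kpoly S) g = kE *m g.
  by apply: der_unip => //; rewrite ?derivX ?deriv_kconstx.
apply: (path_const (B := kE) (u := 0)) => //.
- by rewrite !trmx_mul trmxK skkA mulNmx mulmxN mulmxA.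
- rewrite !derMx // derTx // dg !deriv_kconstx mulmx0 addr0 trmx0 mulmx0 mul0mx subr0 addr0.
  by rewrite (trmx_mul kE) skkE mulmxN mulmxN !mulmxA.
- by rewrite derMx // dg deriv_kconstx mulmx0 addr0 mulmxA.
Qed.
End Centrality.

Lemma size_polyD_le (R : nzSemiRingType) (p q : {poly R}) m :
  (size p <= m)%N -> (size q <= m)%N -> (size (p + q)%R <= m)%N.
Proof. by move=> sp sq; rewrite (leq_trans (size_polyD _ _)) // geq_max sp. Qed.

Lemma size_polyB_le (R : nzRingType) (p q : {poly R}) m :
  (size p <= m)%N -> (size q <= m)%N -> (size (p - q)%R <= m)%N.
Proof. by move=> sp sq; rewrite size_polyD_le ?size_polyN. Qed.

Lemma size_sub_lead (R : nzRingType) (p q : {poly R}) m :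
  (size p <= m.+1)%N -> (size q <= m.+1)%N -> p`_m = q`_m -> (size (p - q)%R <= m)%N.
Proof.
move=> sp sq pq; apply/leq_sizeP => i; rewrite leq_eqVlt coefB => /predU1P[<-|lt_mi].
  by rewrite pq subrr.
by rewrite !nth_default ?subr0 // ?(leq_trans sq) // (leq_trans sp).
Qed.

(** * Scaling of v and the torus *)

Section Kmap.
Variables (K : fieldType) (S T : comAlgType K) (g : {rmorphism S -> T}).

Definition kmap : kpoly S -> kpoly T := map_poly g.
HB.instance Definition _ := GRing.RMorphism.copy kmap (map_poly g : {poly S} -> {poly T}).

Lemma kmap_alg : (forall c : K, g c%:A = c%:A) -> forall c : K, kmap c%:A = c%:A.
Proof. by move=> gC c; rewrite !kpoly_algE /kmap map_polyC /= gC. Qed.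

Lemma kmap_const a : kmap (kconst a) = kconst (g a).
Proof. exact: map_polyC. Qed.

Lemma kmapX : kmap 'X = 'X. Proof. exact: map_polyX. Qed.

Lemma kmap_coef p i : (kmap p : {poly T})`_i = g (p : {poly S})`_i.
Proof. exact: coef_map. Qed.

Lemma size_kmap (p : kpoly S) : (size (kmap p : {poly T}) <= size (p : {poly S}))%N.
Proof. exact: size_poly. Qed.
End Kmap.

Section Vdegree.
Variables (K : fieldType) (N : nat).
Hypothesis nz2 : (2 : K) != 0.
Local Notation Sa := (Sa K N).

(* Lam f is f (A, X v), so that its size is the degree of f in v, plus one. *)
Definition Lam : Sa -> kpoly Sa :=
  ev (pt (map_mx (@kconst K Sa) (genA K N)) ('X *: map_mx (@kconst K Sa) (genv K N))).
HB.instance Definition _ := GRing.RMorphism.copy Lam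
  (ev (pt (map_mx (@kconst K Sa) (genA K N)) ('X *: map_mx (@kconst K Sa) (genv K N)))).

Lemma Lam_alg (c : K) : Lam c%:A = c%:A. Proof. exact: ev_alg. Qed.

Lemma LamD f g : Lam (f + g) = Lam f + Lam g. Proof. exact: rmorphD. Qed.

Lemma LamB f g : Lam (f - g) = Lam f - Lam g. Proof. exact: rmorphB. Qed.

Lemma Lam_ev (S : comAlgType K) (A : 'M[S]_N) v f : A^T = - A ->
  kmap (ev (pt A v)) (Lam f) = ev (pt (map_mx (@kconst K S) A) ('X *: map_mx (@kconst K S) v)) f.
Proof.
move=> skA; rewrite /Lam (ev_mor _ _ (kmap_alg (ev_alg _))); apply: eq_ev => s.
rewrite map_pt map_mxZ /= kmapX -!map_mx_comp.
have E m n (M : 'M[Sa]_(m, n)) : map_mx (kmap (ev (pt A v)) \o @kconst K Sa) M =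
    map_mx (@kconst K S) (map_mx (ev (pt A v)) M).
  by apply/matrixP => i j; rewrite !mxE /= kmap_const.
by rewrite !E ev_genA // ev_genv.
Qed.

Lemma Lam1 f : keval 1 (Lam f) = f.
Proof.
rewrite /Lam (ev_mor _ _ (keval_alg 1)) (eq_ev (map_pt _ _ _)) map_mxZ /= kevalX scale1r.
by rewrite !keval_constx ev_gen.
Qed.

End Vdegree.

Section DerivationAlgebra.
Variables (K : fieldType) (S : comAlgType K).

Lemma derivation_scale D (a : S) : derivation D -> derivation (fun p : S => a * D p).
Proof.
move=> dD; split=> [p q|p q|c]; first by rewrite (derD' dD) mulrDr.
  by rewrite (derM dD) mulrDr mulrA [in RHS]mulrCA.
by rewrite (derC dD) mulr0.
Qed.

Lemma derivation_sub (D D' : S -> S) : derivation D -> derivation D' -> derivation (fun p : S => D p - D' p).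
Proof.
move=> dD dD'; split=> [p q|p q|c].
- by rewrite (derD' dD) (derD' dD') opprD addrACA.
- by rewrite (derM dD) (derM dD') mulrBl mulrBr opprD addrACA.
- by rewrite (derC dD) (derC dD') subrr.
Qed.
End DerivationAlgebra.

Lemma coef_Xderiv (R : nzRingType) (p : {poly R}) k : ('X * p^`())`_k = p`_k *+ k.
Proof. by rewrite coefXM; case: k => [|k]; rewrite ?mulr0n // coef_deriv. Qed.

Section Kconst2.
Variables (K : fieldType) (S : comAlgType K).
Definition kconst2 (a : S) : kpoly (kpoly S) := kconst (kconst a).
HB.instance Definition _ := GRing.RMorphism.copy kconst2 (@kconst K (kpoly S) \o @kconst K S).
End Kconst2.

Section Torus.
Variables (K : fieldType) (N : nat).
Hypothesis K0 : [pchar K] =i pred0.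
Variable h : Sa K N.
Hypothesis ch : Poisson_center (@Hcl_bracket K N [::]) h.
Variables (S : comAlgType K) (A C E : 'M[S]_N) (v : 'cV[S]_N).
Hypothesis skA : A^T = - A.
Hypothesis skC : C^T = - C.
Hypothesis skE : E^T = - E.
Hypothesis comEA : E *m A = A *m E.
Hypothesis comEC : E *m C - C *m E = - C.
Hypothesis Ev : E *m v = v.

Local Notation k2 := (@kconst2 K S).
Let mu : kpoly (kpoly S) := @kconst K (kpoly S) ('X : {poly S}).

(* The point (A + mu C, lam v), where the rotation by E scales mu and lam by
   inverse factors, so that only the monomials (mu lam)^j survive. *)
Definition torus_orbit : kpoly (kpoly S) :=
  ev (pt (map_mx k2 A + mu *: map_mx k2 C) ('X *: map_mx k2 v)) h.

Let D0 (q : kpoly S) : kpoly S := 'X * (q : {poly S})^`().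
Let D (p : kpoly (kpoly S)) : kpoly (kpoly S) := 'X * (p : {poly (kpoly S)})^`() - map_poly D0 p.

Let dD0 : derivation D0.
Proof. exact: derivation_scale (derivation_deriv S). Qed.
Let dD : derivation D.
Proof.
apply: derivation_sub; first exact: derivation_scale (derivation_deriv (kpoly S)).
exact: derivation_map dD0.
Qed.

(** The operator [D] is lam d/dlam - mu d/dmu. At the orbit point it acts as the rotation by E, so
    it kills the orbit, while it multiplies mu^j lam^k by k - j. The outer variable is lam, the
    inner one mu. *)
Lemma torus_orbit_coef j k : j != k ->
  ((torus_orbit : {poly (kpoly S)})`_k : {poly S})`_j = 0.
Proof.
have D0c a : D0 (kconst a) = 0 by rewrite /D0 derivC mulr0.
have Dc q : D (kconst q) = - kconst (D0 q).
  rewrite /D derivC mulr0 sub0r; congr (- _); apply/polyP => i.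
  by rewrite coef_map_id0 ?(der0 dD0) // !coefC; case: eqP => // _; rewrite (der0 dD0).
have Dk2 m n (M : 'M[S]_(m, n)) : map_mx D (map_mx k2 M) = 0.
  by apply/matrixP => a b; rewrite !mxE Dc D0c /kconst polyC0 oppr0.
have Dmu : D mu = - mu by rewrite Dc /D0 derivX mulr1.
have DX : D 'X = 'X.
  rewrite /D derivX mulr1 (_ : map_poly D0 _ = 0) ?subr0 //.
  apply/polyP => i; rewrite coef_map_id0 ?(der0 dD0) // coefX coef0.
  by rewrite (der_nat dD0).
have D_eq0 : D torus_orbit = 0.
  rewrite /torus_orbit (chain_rule _ _ dD) (eq_dev _ _ (map_pt _ _ _)).
  rewrite (derDx dD) !(derZx dD) !Dk2 Dmu DX !scaler0 !addr0 add0r.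
  have dE : map_mx k2 E *m (map_mx k2 A + mu *: map_mx k2 C) -
      (map_mx k2 A + mu *: map_mx k2 C) *m map_mx k2 E = - mu *: map_mx k2 C.
    rewrite mulmxDr mulmxDl -scalemxAr -scalemxAl -!map_mxM /= comEA.
    by rewrite opprD addrACA subrr add0r -scalerBr -map_mxB comEC map_mxN scalerN scaleNr.
  have dEv : map_mx k2 E *m ('X *: map_mx k2 v) = 'X *: map_mx k2 v.
    by rewrite -scalemxAr -map_mxM /= Ev.
  have := @central_dev _ _ K0 _ ch _ (map_mx k2 A + mu *: map_mx k2 C) ('X *: map_mx k2 v) _ (map_mx k2 E) 0.
  rewrite trmx0 mulmx0 mul0mx subr0 addr0 dE dEv; apply; last exact: map_skew.
  by rewrite linearD /= linearZ /= !map_skew // scalerN -opprD.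
have /(congr1 (fun p : {poly (kpoly S)} => (p`_k : {poly S})`_j)) := D_eq0.
rewrite coefB coef_Xderiv coef_map_id0 ?(der0 dD0) // coefB coefMn coef_Xderiv !coef0.
set a := _`_j; have [lt_jk|lt_kj|//] := ltngtP j k => /eqP + _.
  rewrite -mulrnBr 1?ltnW // -(ltn_predK (m := 0) (n := (k - j)%N)) ?subn_gt0 //.
  by move/eqP/(natr_unit_eq0 K0).
rewrite subr_eq0 eq_sym -subr_eq0 -mulrnBr 1?ltnW //.
rewrite -(ltn_predK (m := 0) (n := (j - k)%N)) ?subn_gt0 //.
by move/eqP/(natr_unit_eq0 K0).
Qed.
End Torus.

(** * Degrees in v *)

Section Naturality.
Variables (K : fieldType) (S T : comAlgType K) (h : {rmorphism S -> T}) (N : nat).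
Implicit Types (A : 'M[S]_N) (v : 'cV[S]_N).

Lemma charcoef_map A k : charcoef (map_mx h A) k = h (charcoef A k).
Proof.
rewrite /charcoef -coef_map -det_map_mx.
apply: (congr1 (fun M : 'M[{poly T}]_N => (\det M)`_k)).
rewrite map_mxD map_mx1 map_mxZ /= map_polyX -!map_mx_comp; congr (_ + _ *: _).
by apply/matrixP => i j; rewrite !mxE /= map_polyC.
Qed.

Lemma bmx_map A k : bmx (map_mx h A) k = map_mx h (bmx A k).
Proof.
elim: k => [|k IH]; first by rewrite map_mx1.
rewrite !bmxS map_mxD map_mxM map_scalar_mx charcoef_map IH.
by congr (_ + scalar_mx _); rewrite [RHS]rmorphM rmorph_sign.
Qed.

Lemma dot_map (x y : 'cV[S]_N) : dot (map_mx h x) (map_mx h y) = h (dot x y).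
Proof. by rewrite /dot map_trmx -map_mxM mxE. Qed.

Lemma psi_map A v k : psi k (map_mx h A) (map_mx h v) = h (psi k A v).
Proof. by rewrite /psi bmx_map -map_mxM dot_map. Qed.
End Naturality.

Section VdegreeGenerators.
Variables (K : fieldType) (N : nat).
Hypothesis nz2 : (2 : K) != 0.
Local Notation Sa := (Sa K N).
Local Notation kc := (@kconst K Sa).

Lemma psi_scale (S : comAlgType K) (A : 'M[S]_N) v a k :
  psi k A (a *: v) = a ^+ 2 * psi k A v.
Proof. by rewrite /psi -scalemxAr dotZl dotZr mulrA. Qed.

Lemma ev_tau (S : comAlgType K) (A : 'M[S]_N) v k : A^T = - A ->
  ev (pt A v) (tau K N k) = psi k.-1 A v.
Proof. by move=> skA; rewrite /tau -psi_map ev_genA // ev_genv. Qed.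

Lemma ev_tauhat (S : comAlgType K) (A : 'M[S]_N) v : A^T = - A ->
  ev (pt A v) (tauhat K N) = psihat A v.
Proof. by move=> skA; rewrite /tauhat -psihat_map ?ev_genA ?ev_genv //; apply: ev_alg. Qed.

(** Scaling v is congruence by diag (1, ..., 1, a), of determinant a; N odd makes the bordered size
    even. *)
Lemma psihat_scale (S : comAlgType K) (A : 'M[S]_N) v a : odd N ->
  psihat A (a *: v) = a * psihat A v.
Proof.
move=> oddN; pose g : 'M[S]_(N + 1) := block_mx 1%:M 0 0 a%:M.
have -> : psihat A (a *: v) = pfaffian (g *m block_mx A v (- v^T) 0 *m g^T).
  rewrite /psihat /g tr_block_mx !trmx1 !trmx0 tr_scalar_mx !mulmx_block.
  rewrite !(mul0mx, mulmx0, mul1mx, mulmx1, addr0, add0r) mul_mx_scalar mul_scalar_mx.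
  by congr pfaffian; congr block_mx; rewrite linearZ /= scalerN.
by rewrite pfaffian_congr ?addn1 ?negbK // /g det_ublock det1 mul1r det_scalar1.
Qed.

Lemma kconst_genA_skew : (map_mx kc (genA K N))^T = - map_mx kc (genA K N).
Proof. exact: map_skew (genA_skew K N). Qed.

Lemma Lam_tau k : Lam (tau K N k) = 'X ^+ 2 * kconst (tau K N k).
Proof. by rewrite /Lam /= ev_tau ?kconst_genA_skew // psi_scale psi_map. Qed.

Lemma Lam_tauhat : odd N -> Lam (tauhat K N) = 'X * kconst (tauhat K N).
Proof.
move=> oddN; rewrite /Lam /= ev_tauhat ?kconst_genA_skew // psihat_scale // psihat_map //.
exact: kconst_alg.
Qed.

Lemma mderiv_derivation i : derivation (mderiv i : Sa -> Sa).
Proof.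
split=> [p q|p q|c]; [exact: mderivD|exact: mderivM|].
by rewrite alg_mpolyC mderivC.
Qed.

Lemma size_Lam_eq1 (f : Sa) : [pchar K] =i pred0 ->
  (forall i, mderiv (enum_rank (inr i : coord_idx N)) f = 0) ->
  (size (Lam f : {poly Sa}) <= 1)%N.
Proof.
move=> K0 df; have dL : (Lam f : {poly Sa})^`() = 0.
  rewrite -[LHS]/((@deriv Sa : kpoly Sa -> kpoly Sa) (Lam f)) /Lam /=.
  rewrite (chain_rule _ _ (derivation_deriv Sa)) /dev big1 // => -[p|i] _ /=.
    by rewrite mxE derivC mulr0.
  by rewrite df rmorph0 mul0r.
by rewrite (deriv_eq0 K0 dL) size_polyC leq_b1.
Qed.

Lemma mderiv_genA i : map_mx (mderiv (enum_rank (inr i : coord_idx N))) (genA K N) = 0.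
Proof.
have dd := mderiv_derivation (enum_rank (inr i : coord_idx N)).
apply/matrixP => a b; rewrite mxE genA_so_elt // so_elt_sum ?so_mx_skew // (der_sum dd).
by rewrite mxE big1 // => p _; rewrite (derZ dd) mderiv_coord scaler0.
Qed.

Lemma size_Lam_celt zeta i : [pchar K] =i pred0 ->
  (size (Lam (celt N zeta i.+1) : {poly Sa}) <= 1)%N.
Proof.
move=> K0; apply: size_Lam_eq1 => // j; have dd := mderiv_derivation (enum_rank (inr j : coord_idx N)).
rewrite /celt (der_cPoly nz2 (genA_skew K N) dd).
by rewrite mderiv_genA big1 ?mulr0 // => m _; rewrite mulmx0 mxtrace0 scaler0.
Qed.
End VdegreeGenerators.

Section EvalMpoly.
Variables (K : fieldType) (m : nat).

Definition evm (S : comAlgType K) (F : 'I_m -> S) (q : {mpoly K[m]}) : S :=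
  mmap (in_alg S) F q.
HB.instance Definition _ (S : comAlgType K) (F : 'I_m -> S) :=
  GRing.RMorphism.copy (evm F) (mmap (in_alg S) F).

Lemma evm_alg (S : comAlgType K) (F : 'I_m -> S) (c : K) : evm F c%:A = c%:A.
Proof. by rewrite alg_mpolyC /evm mmapC. Qed.

Lemma evm_C (S : comAlgType K) (F : 'I_m -> S) (c : K) : evm F c%:MP = c%:A.
Proof. by rewrite -alg_mpolyC evm_alg. Qed.

Lemma evmD (S : comAlgType K) (F : 'I_m -> S) p q : evm F (p + q) = evm F p + evm F q.
Proof. exact: rmorphD. Qed.

Lemma evmM (S : comAlgType K) (F : 'I_m -> S) p q : evm F (p * q) = evm F p * evm F q.
Proof. exact: rmorphM. Qed.

Lemma evm0 (S : comAlgType K) (F : 'I_m -> S) : evm F 0 = 0.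
Proof. exact: rmorph0. Qed.

Lemma evmZ (S : comAlgType K) (F : 'I_m -> S) c q : evm F (c *: q) = c *: evm F q.
Proof. by rewrite [LHS]rmorph_scale //; apply: evm_alg. Qed.

Lemma evmX (S : comAlgType K) (F : 'I_m -> S) i : evm F 'X_i = F i.
Proof. by rewrite /evm mmapX mmap1U. Qed.

Lemma evm_mor (S T : comAlgType K) (g : {rmorphism S -> T}) (F : 'I_m -> S) q :
  (forall c : K, g c%:A = c%:A) -> g (evm F q) = evm (g \o F) q.
Proof.
move=> gC; elim/mpoly_var_ind: q => [c|p q IHp IHq|i p IH].
- by rewrite !evm_C gC.
- by rewrite !rmorphD /= IHp IHq.
- by rewrite !rmorphM /= !evmX IH.
Qed.

Lemma eq_evm (S : comAlgType K) (F G : 'I_m -> S) : F =1 G -> evm F =1 evm G.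
Proof.
move=> FG q; elim/mpoly_var_ind: q => [c|p q IHp IHq|i p IH].
- by rewrite !evm_C.
- by rewrite !rmorphD /= IHp IHq.
- by rewrite !rmorphM /= !evmX FG IH.
Qed.

Lemma evm_comp n (g : m.-tuple {mpoly K[n]}) q : q \mPo g = evm (tnth g) q.
Proof.
elim/mpoly_var_ind: q => [c|p q IHp IHq|i p IH].
- by rewrite comp_mpolyC evm_C alg_mpolyC.
- by rewrite comp_mpolyD IHp IHq rmorphD.
- by rewrite rmorphM /= comp_mpolyXU IH rmorphM /= evmX (tnth_nth 0).
Qed.

Lemma evm_id q : evm (fun i => 'X_i : {mpoly K[m]}) q = q.
Proof.
elim/mpoly_var_ind: q => [c|p q IHp IHq|i p IH]; first by rewrite evm_C alg_mpolyC.
  by rewrite rmorphD /= IHp IHq.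
by rewrite rmorphM /= evmX IH.
Qed.

Variable w : 'I_m -> nat.

(* omega q is q (t^{w_i} X_i): its size is the w-weighted degree of q, plus one. *)
Definition omega_var (i : 'I_m) : kpoly {mpoly K[m]} := 'X ^+ w i * @kconst K {mpoly K[m]} 'X_i.
Definition omega : {mpoly K[m]} -> kpoly {mpoly K[m]} := evm omega_var.
HB.instance Definition _ := GRing.RMorphism.copy omega (evm omega_var).

Lemma omegaC c : omega c%:MP = (kconst (c%:MP : {mpoly K[m]})).
Proof. by rewrite /omega evm_C kpoly_algE alg_mpolyC. Qed.

Lemma omegaD p q : omega (p + q) = omega p + omega q. Proof. exact: evmD. Qed.

Lemma omegaXM i p : omega ('X_i * p) = 'X ^+ w i * (@kconst K {mpoly K[m]} 'X_i * omega p).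
Proof. by rewrite /omega evmM evmX /omega_var mulrA. Qed.

Lemma omega1 q : keval 1 (omega q) = q.
Proof.
rewrite /omega (evm_mor _ _ (keval_alg 1)) -[RHS]evm_id; apply: eq_evm => i /=.
by rewrite rmorphM rmorphXn /= kevalX expr1n mul1r keval_const.
Qed.

Lemma omega_coef_sum q d : (size (omega q : {poly {mpoly K[m]}}) <= d)%N ->
  q = \sum_(i < d) (omega q : {poly {mpoly K[m]}})`_i.
Proof.
move=> sq; have := omega1 q; rewrite /keval /horner_eval (horner_coef_wide _ sq) => {1}<-.
by apply: eq_bigr => i _; rewrite expr1n mulr1.
Qed.

(** A leading coefficient relative to a prescribed degree: [a] may be 0, which makes the notion
    compatible with sums and products. *)
Definition top (S : comAlgType K) d (f : kpoly S) (a : S) :=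
  (size (f : {poly S}) <= d.+1)%N /\ (f : {poly S})`_d = a.

Lemma topD (S : comAlgType K) d (f g : kpoly S) a b :
  top d f a -> top d g b -> top d (f + g) (a + b).
Proof.
move=> [sf <-] [sg <-]; split; last by rewrite coefD.
by rewrite (leq_trans (size_polyD _ _)) // geq_max sf sg.
Qed.

Lemma top0 (S : comAlgType K) d : @top S d 0 0.
Proof. by split; rewrite ?coef0 // size_poly0. Qed.

Lemma top_lt (S : comAlgType K) d (f : kpoly S) :
  (size (f : {poly S}) <= d)%N -> top d f 0.
Proof. by move=> sf; split; [apply: leqW|rewrite nth_default]. Qed.

Lemma topM (S : comAlgType K) d e (f g : kpoly S) a b :
  top d f a -> top e g b -> top (d + e) (f * g) (a * b).
Proof.
move=> [sf <-] [sg <-]; split.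
  have H a' b' : (a' <= d.+1 -> b' <= e.+1 -> (a' + b').-1 <= (d + e).+1)%N by lia.
  exact: leq_trans (size_polyMleq _ _) (H _ _ sf sg).
rewrite coefM (bigD1 (inord d)) //= inordK ?ltnS ?leq_addr // addKn big1 ?addr0 // => i.
rewrite -val_eqE /= inordK ?ltnS ?leq_addr // neq_ltn => /orP[lt_id|lt_di].
  by rewrite [(g : {poly S})`_ _]nth_default ?mulr0 // (leq_trans sg) //; lia.
by rewrite [(f : {poly S})`_ _]nth_default ?mul0r // (leq_trans sf).
Qed.

(** Only the part of q of weighted degree d reaches degree d, and it sees only the leading
    coefficients of the F_i. *)
Lemma top_evm (S : comAlgType K) (F : 'I_m -> kpoly S) (a : 'I_m -> S) q d :
  (forall i, top (w i) (F i) (a i)) ->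
  (size (omega q : {poly {mpoly K[m]}}) <= d.+1)%N ->
  top d (evm F q) (evm a (omega q : {poly {mpoly K[m]}})`_d).
Proof.
move=> Fa; have H p e : top e (evm F (omega p : {poly {mpoly K[m]}})`_e)
    (evm a (omega p : {poly {mpoly K[m]}})`_e).
  elim/mpoly_var_ind: p e => [c|p r IHp IHr|i p IH] e.
  - rewrite omegaC coefC; case: e => [|e] /=; last by rewrite evm0 evm0; apply: top0.
    rewrite evm_C evm_C kpoly_algE; split; first by rewrite size_polyC leq_b1.
    by rewrite coefC.
  - rewrite omegaD coefD evmD evmD; exact: topD (IHp e) (IHr e).
  - rewrite omegaXM coefXnM.
    case: ltnP => [_|le_we]; first by rewrite evm0 evm0; apply: top0.
    rewrite coefCM evmM evmM evmX evmX -{1}(subnKC le_we); exact: topM (Fa i) (IH _).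
move=> sq; have -> : evm F q = \sum_(i < d.+1) evm F (omega q : {poly {mpoly K[m]}})`_i.
  by rewrite {1}(omega_coef_sum sq) (big_morph (evm F) (evmD F) (evm0 F)).
rewrite big_ord_recr /= -[X in top _ _ X]add0r; apply: topD (H q d).
elim/big_ind: _ => [|f g f0 g0|i _]; first exact: top0.
  by rewrite -[0]addr0; exact: topD f0 g0.
exact: top_lt (leq_trans (proj1 (H q i)) (ltn_ord i)).
Qed.
End EvalMpoly.

(** * The slice *)

Lemma congr_col_mx (R : comPzRingType) (n q : nat) (J : 'M[R]_(n, q)) (x : 'cV[R]_q) (B : 'M_q) :
  col_mx J x^T *m B *m (col_mx J x^T)^T =
  block_mx (J *m B *m J^T) (J *m B *m x) (x^T *m B *m J^T) (x^T *m B *m x).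
Proof. by rewrite tr_col_mx trmxK mul_col_mx mul_col_row. Qed.

Section Slice.
Variables (K : fieldType) (S : comAlgType K) (n : nat).
Variables (ep ph : 'cV[S]_2).
Hypothesis dot_ph : dot ph ph = 0.
Hypothesis dot_ep : dot ep ep = 0.
Hypothesis dot_pe : dot ph ep = 1.
Implicit Types (A : 'M[S]_n) (w y : 'cV[S]_n).

(* The skew matrices killed by f: [sl A w] sends e to w. *)
Definition sl A w : 'M[S]_(2 + n) := block_mx 0 (- (ph *m w^T)) (w *m ph^T) A.
Definition cone_e : 'cV[S]_(2 + n) := col_mx ep 0.
Definition cone_f : 'cV[S]_(2 + n) := col_mx ph 0.
Definition emb y : 'cV[S]_(2 + n) := col_mx 0 y.
Local Notation e := cone_e.
Local Notation f := cone_f.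

Lemma dot_col (a b : 'cV[S]_2) y z : dot (col_mx a y) (col_mx b z) = dot a b + dot y z.
Proof. by rewrite /dot tr_col_mx mul_row_col mxE. Qed.

Lemma dot_ee : dot e e = 0. Proof. by rewrite dot_col dot_ep dot0r addr0. Qed.
Lemma dot_ff : dot f f = 0. Proof. by rewrite dot_col dot_ph dot0r addr0. Qed.
Lemma dot_fe : dot f e = 1. Proof. by rewrite dot_col dot_pe dot0r addr0. Qed.
Lemma dot_ef : dot e f = 1. Proof. by rewrite dotC dot_fe. Qed.
Lemma dot_e_emb y : dot e (emb y) = 0. Proof. by rewrite dot_col dot0r dot0l addr0. Qed.
Lemma dot_f_emb y : dot f (emb y) = 0. Proof. by rewrite dot_col dot0r dot0l addr0. Qed.
Lemma dot_emb y z : dot (emb y) (emb z) = dot y z. Proof. by rewrite dot_col dot0r add0r. Qed.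

Lemma sl_skew A w : A^T = - A -> (sl A w)^T = - sl A w.
Proof.
move=> skA; rewrite /sl tr_block_mx opp_block_mx skA trmx0 oppr0 opprK linearN /=.
by rewrite !trmx_mul !trmxK.
Qed.

Lemma sl_e A w : sl A w *m e = emb w.
Proof.
rewrite /sl /e mul_block_col !mulmx0 !addr0 mul0mx mul_dot dot_pe scale1r //.
Qed.

Lemma sl_f A w : sl A w *m f = 0.
Proof.
by rewrite /sl /f mul_block_col !mulmx0 !addr0 mul0mx mul_dot dot_ph scale0r col_mx0.
Qed.

Lemma sl_emb A w y : sl A w *m emb y = emb (A *m y) - dot w y *: f.
Proof.
rewrite /sl /emb mul_block_col !mulmx0 !add0r mulNmx mul_dot /f scale_col_mx scaler0.
by rewrite opp_col_mx add_col_mx oppr0 add0r addr0.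
Qed.

(** A unipotent column operation clears the upper right block; the lower right block stays 1 + tA
    because (f, f) = 0. *)
Lemma charcoef_sl A w k : charcoef (sl A w) k = charcoef A k.
Proof.
pose P (q1 q2 : nat) (M : 'M[S]_(q1, q2)) : 'M[{poly S}]_(q1, q2) := map_mx polyC M.
rewrite /charcoef; congr (polyseq _)`_k; rewrite -!/(P _ _ _).
pose U : 'M[{poly S}]_(2 + n) := block_mx 1%:M ('X *: P _ _ (ph *m w^T)) 0 1%:M.
have detU : \det U = 1 by rewrite det_ublock !det1 mulr1.
set M := 1%:M + 'X *: P (2 + n)%N _ _.
transitivity (\det (M *m U)); first by rewrite det_mulmx detU mulr1.
have -> : M =
    block_mx 1%:M (- ('X *: P _ _ (ph *m w^T))) ('X *: P _ _ (w *m ph^T)) (1%:M + 'X *: P _ _ A).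
  rewrite /M /P /sl map_block_mx map_mx0 map_mxN scale_block_mx scaler0 scalerN.
  by rewrite (scalar_mx_block 2 n 1) add_block_mx !add0r addr0.
rewrite mulmx_block !mulmx0 !mul1mx !mulmx1 !addr0 subrr det_lblock det1 mul1r.
rewrite -scalemxAl -scalemxAr /P -map_mxM mulmxA -(mulmxA w) [_ *m ph]mx11_scalar -/(dot ph ph).
by rewrite dot_ph mul_mx_scalar scale0r mul0mx map_mx0 !scaler0 add0r.
Qed.

(** Follows the chain e -> w -> A w, ... under [sl A w]: on the copy of V_n it acts as A up to a
    multiple of f, and f is killed. *)
Lemma bmx_sl_e A w k : bmx (sl A w) k.+2 *m e =
  ((-1) ^+ k.+2 * charcoef A k.+2) *: e + emb (bmx A k.+1 *m w) - dot w (bmx A k *m w) *: f.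
Proof.
have embD y z : emb (y + z) = emb y + emb z by rewrite /emb add_col_mx addr0.
have embZ a y : emb (a *: y) = a *: emb y by rewrite /emb scale_col_mx scaler0.
have E1 : bmx (sl A w) 1 *m e = ((-1) ^+ 1 * charcoef A 1) *: e + emb w.
  by rewrite bmxS /= mulmx1 mulmxDl sl_e mul_scalar_mx charcoef_sl addrC.
elim: k => [|k IH]; rewrite bmxS mulmxDl mul_scalar_mx charcoef_sl -mulmxA.
  rewrite E1 mulmxDr -scalemxAr sl_e sl_emb addrC mul1mx -addrA; congr (_ + _).
  rewrite addrA -embZ -embD bmxS mulmx1 mulmxDl mul_scalar_mx; congr (emb _ - _).
  by rewrite addrC.
rewrite IH mulmxBr mulmxDr -!scalemxAr sl_e sl_f scaler0 subr0 sl_emb addrC -addrA.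
congr (_ + _); rewrite addrA -embZ -embD [bmx A k.+2]bmxS mulmxDl mul_scalar_mx -mulmxA.
by rewrite [X in emb X]addrC.
Qed.

(** Pairing with e retains only the f-component of [bmx_sl_e], where the index of [bmx] is lower by
    2; this causes the shift of psi by one and the sign. *)
Lemma psi_sl A w k : psi k.+1 (sl A w) e = - psi k A w.
Proof.
rewrite /psi doubleS bmx_sl_e dotBr dotDr !dotZr dot_ee mulr0 add0r dot_e_emb.
by rewrite dot_ef mulr1 add0r.
Qed.

Lemma psi0_sl A w : psi 0 (sl A w) e = 0.
Proof. by rewrite /psi mul1mx dot_ee. Qed.

(* The rows are f, the last unit vector of the bordered space, a basis of the
   copy of V_n, and e. *)
Definition slice_basis : 'M[S]_(2 + (n + 1)) :=
  let H : 'M[S]_(n + 1, 2 + n) := col_mx (row_mx 0 1%:M) e^T in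
  col_mx (block_mx f^T 0 0 1%:M : 'M_(1 + 1, (2 + n) + 1)) (row_mx H 0 : 'M_(n + 1, (2 + n) + 1)).

(** In the basis [slice_basis] the first row of the bordered matrix is (0, 1, 0, ..., 0), since
    [sl A w] kills f and (f, e) = 1. So [pfaffian_block] removes two rows and leaves the bordered
    matrix of (A, w). *)
Lemma psihat_sl A w : [pchar K] =i pred0 -> A^T = - A -> odd n ->
  \det slice_basis * psihat (sl A w) e = psihat A w.
Proof.
move=> K0 skA oddn; rewrite /psihat.
pose B := sl A w; have skB : B^T = - B by apply: sl_skew.
have nz2 : (2 : K) != 0 by rewrite ((pcharf0P K).1 K0).
pose M : 'M[S]_((2 + n) + 1) := block_mx B e (- e^T) 0.
have skM : M^T = - M by apply: (bordered_skew e skB).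
pose g := slice_basis.
have eT : e^T *m e = 0 by rewrite [LHS]mx11_scalar -/(dot e e) dot_ee raddf0.
transitivity (pfaffian (g *m M *m g^T)).
  by symmetry; apply: (pfaffian_congr g M); rewrite /= addn1 /= oddn.
have skgM : (g *m M *m g^T)^T = - (g *m M *m g^T).
  by rewrite !trmx_mul trmxK skM mulNmx mulmxN mulmxA.
pose G1 : 'M[S]_(1 + 1, (2 + n) + 1) := block_mx f^T 0 0 1%:M.
pose H : 'M[S]_(n + 1, 2 + n) := col_mx (row_mx 0 1%:M) e^T.
pose G2 : 'M[S]_(n + 1, (2 + n) + 1) := row_mx H 0.
have gMg : g *m M *m g^T =
    block_mx (G1 *m M *m G1^T) (G1 *m M *m G2^T) (G2 *m M *m G1^T) (G2 *m M *m G2^T).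
  rewrite /g /slice_basis -/H -/G1 -/G2.
  by rewrite (mul_col_mx G1 G2 M) (tr_col_mx G1 G2) mul_col_row.
have fB : f^T *m B = 0 by rewrite -[B]trmxK -trmx_mul skB mulNmx sl_f oppr0 trmx0.
have fe : f^T *m e = 1%:M by rewrite [LHS]mx11_scalar -/(dot f e) dot_fe.
have ef : e^T *m f = 1%:M by rewrite [LHS]mx11_scalar -/(dot e f) dot_ef.
have G1M : G1 *m M = block_mx 0 1%:M (- e^T) 0.
  by rewrite /G1 /M mulmx_block fB fe !(mul0mx, mulmx0, mul1mx, addr0, add0r).
have X00 : G1 *m M *m G1^T = block_mx 0 1%:M (- 1%:M) 0 :> 'M_(1 + 1).
  rewrite G1M /G1 tr_block_mx mulmx_block trmxK !trmx0 trmx1 mulNmx ef.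
  by rewrite !(mul0mx, mulmx0, mulmx1, addr0, add0r).
have X01 : G1 *m M *m G2^T = col_mx 0 (- (H *m e)^T).
  rewrite G1M /G2 tr_row_mx trmx0 mul_block_col !(mul0mx, mulmx0, addr0) mulNmx.
  by rewrite trmx_mul.
pose J : 'M[S]_(n, 2 + n) := row_mx 0 1%:M.
have JB : J *m B = row_mx (w *m ph^T) A.
  by rewrite /J mul_row_block !mul0mx !mul1mx !add0r.
have JBe : J *m B *m e = w by rewrite -mulmxA sl_e mul_row_col mul0mx mul1mx add0r.
have X11 : G2 *m M *m G2^T = block_mx A w (- w^T) 0.
  rewrite /G2 /M tr_row_mx trmx0 mul_row_block !mul0mx !addr0 mul_row_col mulmx0 addr0.
  rewrite /H -/J congr_col_mx JBe.
  have -> : e^T *m B *m J^T = - w^T.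
    move/(congr1 trmx): JBe; rewrite trmx_mul (trmx_mul J) skB mulNmx mulmxN mulmxA.
    by move=> <-; rewrite opprK.
  have -> : e^T *m B *m e = 0 by rewrite -mulmxA [LHS]mx11_scalar -/(dot e _) sl_e dot_e_emb raddf0.
  congr block_mx; rewrite JB /J tr_row_mx trmx0 trmx1 mul_row_col mulmx0 mulmx1 add0r //.
pose M' : 'M[S]_((n + 1).+2) := g *m M *m g^T.
pose lo (i : 'I_(1 + 1)) : 'I_((n + 1).+2) := lshift (n + 1) i.
pose hi (i : 'I_(n + 1)) : 'I_((n + 1).+2) := rshift (1 + 1) i.
have Mll i j : M' (lo i) (lo j) = block_mx 0 1%:M (- 1%:M) 0 i j :> S.
  by rewrite -X00 /M' gMg; exact: block_mxEul.
have Mlh i j : M' (lo i) (hi j) = col_mx 0 (- (H *m e)^T) i j.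
  by rewrite -X01 /M' gMg; exact: block_mxEur.
have Mhh i j : M' (hi i) (hi j) = block_mx A w (- w^T) 0 i j.
  by rewrite -X11 /M' gMg; exact: block_mxEdr.
have o0 : ord0 = lo (lshift 1 ord0) by apply: val_inj.
have o1 : lift ord0 ord0 = lo (rshift 1 ord0) by apply: val_inj.
have o2 i : lift ord0 (lift ord0 i) = hi i by apply: val_inj.
rewrite -/M' (pfaffian_block (M := M')) //.
- congr pfaffian; apply/matrixP => i j; rewrite mxE !o2; exact: Mhh.
- by rewrite addn1 /= oddn.
- by move=> i j; apply: skew_ji.
- by rewrite o1 o0 Mll block_mxEur mxE.
- by move=> i; rewrite o2 o0 Mlh (@col_mxEu _ 1 1) mxE.
Qed.
End Slice.

Section SliceGeometry.
Variables (K : fieldType) (S : comAlgType K) (n : nat).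
Variables (ep ph : 'cV[S]_2).
Hypothesis dot_ph : dot ph ph = 0.
Hypothesis dot_ep : dot ep ep = 0.
Hypothesis dot_pe : dot ph ep = 1.
Hypothesis ep_ph : ep *m ph^T + ph *m ep^T = 1%:M.
Hypothesis nz2 : (2 : K) != 0.
Implicit Types (A B : 'M[S]_n) (w y : 'cV[S]_n).
Local Notation e := (cone_e n ep).
Local Notation f := (cone_f n ph).
Local Notation sl := (sl ph).
Local Notation emb := (@emb K S n).

Definition lower A : 'M[S]_(2 + n) := block_mx 0 0 0 A.

Lemma lower_skew A : A^T = - A -> (lower A)^T = - lower A.
Proof. by move=> skA; rewrite /lower tr_block_mx skA !trmx0 opp_block_mx !oppr0. Qed.

Lemma lower_col (a : 'cV[S]_2) A : lower A *m col_mx a 0 = 0.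
Proof. by rewrite /lower mul_block_col !mul0mx !mulmx0 !addr0 col_mx0. Qed.

Lemma emb_wedge w y : emb w *m (emb y)^T - emb y *m (emb w)^T = lower (w *m y^T - y *m w^T).
Proof.
rewrite /emb /lower !tr_col_mx !trmx0 !mul_col_row !mul0mx !mulmx0.
by rewrite opp_block_mx add_block_mx !oppr0 !addr0.
Qed.

Lemma slE A w : sl A w = lower A + (emb w *m f^T - f *m (emb w)^T).
Proof.
rewrite /emb /cone_f !tr_col_mx !trmx0 !mul_col_row !mul0mx !mulmx0.
by rewrite /lower opp_block_mx !add_block_mx !(oppr0, addr0, add0r).
Qed.

Lemma tr_skew_mul N (M : 'M[S]_N) (x : 'cV[S]_N) : M^T = - M -> x^T *m M = - (M *m x)^T.
Proof. by move=> skM; rewrite trmx_mul skM mulmxN opprK. Qed.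

Lemma wedge_skew N (x y : 'cV[S]_N) : (x *m y^T - y *m x^T)^T = - (x *m y^T - y *m x^T).
Proof. by rewrite linearB /= !trmx_mul !trmxK opprB. Qed.

Lemma sl_rotation A w B : B^T = - B ->
  lower (- B) *m sl A w - sl A w *m lower (- B) = sl (A *m B - B *m A) (- (B *m w)).
Proof.
move=> skB; rewrite /lower /sl !mulmx_block opp_block_mx add_block_mx.
rewrite !(mul0mx, mulmx0, addr0, add0r, oppr0) !mulNmx !mulmxN !opprK.
rewrite linearN /= trmx_mul skB mulmxN opprK !mulmxA.
by rewrite mulmxN [- _ + _]addrC.
Qed.

(** The translation by y for V_n is obtained upstairs from the rotation Y, which fixes e, corrected
    by a translation along u that brings the direction back to the slice. *)
Lemma sl_translation A w y : A^T = - A ->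
  let Y := emb y *m e^T - e *m (emb y)^T in let u := - (sl A w *m emb y) in
  Y *m sl A w - sl A w *m Y + e *m u^T - u *m e^T = sl (w *m y^T - y *m w^T) 0.
Proof.
move=> skA /=; have skM := sl_skew ph w skA; have := sl_e dot_pe A w.
rewrite [sl _ 0]slE -emb_wedge.
move: (sl A w) skM => M skM Me.
rewrite mulmxBl mulmxBr -(mulmxA (emb y)) -(mulmxA e) !tr_skew_mul // !mulmxA Me.
have -> : emb 0 = 0 by rewrite /emb col_mx0.
rewrite trmx0 mulmx0 mul0mx subrr addr0.
have -> : (- (M *m emb y))^T = - (M *m emb y)^T by rewrite linearN.
rewrite !mulmxN mulNmx !opprK.
move: (emb y *m _) (e *m _) (M *m _ *m _) (emb w *m _) => a b c d.
by apply/matrixP => i j; rewrite !mxE; ring.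
Qed.

Definition boost : 'M[S]_(2 + n) := e *m f^T - f *m e^T.

Lemma boost_skew : boost^T = - boost. Proof. exact: wedge_skew. Qed.

Lemma boost_e : boost *m e = e.
Proof. by rewrite mulmxBl !mul_dot dot_fe // dot_ee // scale1r scale0r subr0. Qed.

Lemma sl0E A : sl A 0 = lower A.
Proof. by rewrite /sl trmx0 mulmx0 oppr0 mul0mx. Qed.

Lemma boost_comm A : A^T = - A -> boost *m sl A 0 = sl A 0 *m boost.
Proof.
move=> skA; rewrite sl0E mulmxBl mulmxBr -!mulmxA !tr_skew_mul ?lower_skew // !mulmxA.
by rewrite /e /f !lower_col !trmx0 !oppr0 !mul0mx !mulmx0.
Qed.

Lemma boost_comm_sl w : boost *m sl 0 w - sl 0 w *m boost = - sl 0 w.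
Proof.
have skC : (sl 0 w)^T = - sl 0 w by apply: sl_skew; rewrite trmx0 oppr0.
have ce := sl_e dot_pe 0 w; have cf := sl_f dot_ph 0 w.
rewrite mulmxBl mulmxBr -(mulmxA e) -(mulmxA f) !tr_skew_mul // !mulmxA ce cf trmx0 mul0mx.
rewrite oppr0 mulmx0 subr0 sub0r mulmxN opprK slE /lower block_mx0 add0r.
by rewrite opprB.
Qed.

Lemma plane_coord (v : 'cV[S]_2) : v = dot ph v *: ep + dot ep v *: ph.
Proof. by rewrite -!mul_dot -mulmxDl ep_ph mul1mx. Qed.

(** The upper left block is a skew 2 x 2 matrix killing [ph], hence 0; the mixed blocks are
    recovered from [ep_ph] in the same way. *)
Lemma sl_of_skew (M : 'M[S]_(2 + n)) : M^T = - M -> M *m f = 0 ->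
  M = sl (drsubmx M) (dlsubmx M *m ep).
Proof.
move=> skM Mf; have := Mf; rewrite -{1}(submxK M) mul_block_col !mulmx0 !addr0.
rewrite -(col_mx0 _ _ _) => /eq_col_mx [aph cph].
move: skM; rewrite -{1 2}(submxK M) tr_block_mx opp_block_mx => /eq_block_mx [ska cT _ _].
have bE : ursubmx M = - (dlsubmx M)^T by rewrite cT opprK.
rewrite -{1}(submxK M) /sl; congr block_mx.
- rewrite -[ulsubmx M]mulmx1 -ep_ph mulmxDr !mulmxA aph mul0mx addr0.
  rewrite [ulsubmx M *m ep]plane_coord dot_trmx ska mulNmx aph oppr0 dot0l scale0r add0r.
  by rewrite dot_skew0 // scale0r mul0mx.
- rewrite bE; congr (- _); rewrite trmx_mul mulmxA -[LHS]mul1mx -ep_ph mulmxDl -(mulmxA ep) -trmx_mul.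
  by rewrite cph trmx0 mulmx0 add0r.
- by rewrite -[LHS]mulmx1 -ep_ph mulmxDr !mulmxA cph mul0mx addr0.
Qed.
End SliceGeometry.

Section IsotropicPlane.
Variables (K : numClosedFieldType) (S : comAlgType K).

Definition ep : 'cV[S]_2 := \col_i (if i == ord0 then 1 else 'i : K)%:A.
Definition ph : 'cV[S]_2 := \col_i (if i == ord0 then inv2 K else - ('i * inv2 K))%:A.

Lemma inv2K : 2 * inv2 K = 1. Proof. by rewrite mulfV ?pnatr_eq0. Qed.

Lemma inv2_sqrC : ('i * inv2 K) * 'i = - inv2 K.
Proof. by rewrite mulrAC -expr2 sqrCi mulN1r. Qed.

Let inv2D : inv2 K + inv2 K = 1. Proof. by rewrite -mulr2n -[RHS]inv2K mulr_natl. Qed.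

Lemma dot2 (c d : 'I_2 -> K) :
  dot (\col_i (c i)%:A) (\col_i (d i)%:A : 'cV[S]_2) = (c ord0 * d ord0 + c ord_max * d ord_max)%:A.
Proof.
rewrite /dot mxE big_ord_recl big_ord1 !mxE -!in_algE -!rmorphM -rmorphD /=.
by congr (_ + c _ * d _)%:A; apply: val_inj.
Qed.

Lemma dot_ph_ph : dot ph ph = 0.
Proof.
rewrite dot2 /= mulrNN mulrA inv2_sqrC mulNr subrr scale0r //.
Qed.

Lemma dot_ep_ep : dot ep ep = 0.
Proof. by rewrite dot2 /= mulr1 -expr2 sqrCi subrr scale0r. Qed.

Lemma dot_ph_ep : dot ph ep = 1.
Proof. by rewrite dot2 /= mulr1 mulNr inv2_sqrC opprK inv2D scale1r. Qed.

Lemma ep_ph_id : ep *m ph^T + ph *m ep^T = 1%:M.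
Proof.
apply/matrixP => i j; rewrite !mxE !big_ord1 !mxE -!in_algE -!rmorphM -rmorphD -(rmorph_nat (in_alg S)) /=.
congr _%:A; case: (unliftP ord0 i) => [i'|] ->; case: (unliftP ord0 j) => [j'|] -> //=.
- rewrite !ord1 eqxx /=; rewrite mulrN mulrA -expr2 sqrCi mulN1r opprK mulNr.
  by rewrite inv2_sqrC opprK inv2D.
- by rewrite mulr1 addrC mulrC addrC mulrC subrr.
- by rewrite mul1r mulrC addrC subrr.
- by rewrite mul1r mulr1 inv2D.
Qed.
End IsotropicPlane.

(** * Restriction to the slice *)

Section SliceMap.
Variables (K : numClosedFieldType) (n : nat).
Variables (S T : comAlgType K) (g : {rmorphism S -> T}).
Hypothesis gC : forall c : K, g c%:A = c%:A.

Lemma map_ep : map_mx g (ep S) = ep T.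
Proof. by apply/colP => i; rewrite !mxE gC. Qed.

Lemma map_ph : map_mx g (ph S) = ph T.
Proof. by apply/colP => i; rewrite !mxE gC. Qed.

Lemma map_cone_e : map_mx g (cone_e n (ep S)) = cone_e n (ep T).
Proof. by rewrite map_col_mx map_ep map_mx0. Qed.

Lemma map_sl (A : 'M[S]_n) w : map_mx g (sl (ph S) A w) = sl (ph T) (map_mx g A) (map_mx g w).
Proof. by rewrite /sl map_block_mx map_mx0 map_mxN !map_mxM -!map_trmx map_ph. Qed.
End SliceMap.

Lemma slZ (K : fieldType) (S : comAlgType K) n (p : 'cV[S]_2) (w : 'cV[S]_n) a :
  sl p 0 (a *: w) = a *: sl p 0 w.
Proof.
rewrite /sl scale_block_mx !scaler0 scalerN -scalemxAl; congr block_mx.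
by rewrite linearZ /= -scalemxAr.
Qed.

Lemma slD (K : fieldType) (S : comAlgType K) n (p : 'cV[S]_2) (A : 'M[S]_n) w :
  sl p A w = sl p A 0 + sl p 0 w.
Proof. by rewrite /sl add_block_mx trmx0 mulmx0 mul0mx oppr0 !add0r addr0. Qed.

Section Rho.
Variables (K : numClosedFieldType) (n : nat).
Local Notation A := (genA K n).
Local Notation w := (genv K n).

Let K0 : [pchar K] =i pred0. Proof. exact: pchar_num. Qed.
Let nz2 : (2 : K) != 0. Proof. by rewrite pnatr_eq0. Qed.

Definition slice_pt (S : comAlgType K) (A : 'M[S]_n) w : coord_idx (2 + n) -> S :=
  pt (sl (ph S) A w) (cone_e n (ep S)).

Definition rho (f : Sa K (2 + n)) : Sa K n := ev (slice_pt A w) f.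
HB.instance Definition _ := GRing.RMorphism.copy rho (ev (slice_pt A w)).

Lemma rho_alg (c : K) : rho c%:A = c%:A. Proof. exact: ev_alg. Qed.

Lemma ev_rho (S : comAlgType K) (B : 'M[S]_n) u f : B^T = - B ->
  ev (pt B u) (rho f) = ev (slice_pt B u) f.
Proof.
move=> skB; rewrite (ev_mor _ _ (ev_alg _)); apply: eq_ev => s.
rewrite map_pt map_cone_e ?map_sl ?ev_genA ?ev_genv //; exact: ev_alg.
Qed.

Variable h : Sa K (2 + n).
Hypothesis ch : Poisson_center (@Hcl_bracket K (2 + n) [::]) h.

Lemma der_slice (D : Sa K n -> Sa K n) : derivation D ->
  D (rho h) = dev (slice_pt A w) (pt (sl (ph _) (map_mx D A) (map_mx D w)) 0) h.
Proof.
move=> dD; rewrite (chain_rule _ _ dD); apply: eq_dev => s; rewrite map_pt.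
have De : map_mx D (ep (Sa K n)) = 0 by apply/colP => i; rewrite !mxE (derC dD).
have Dp : map_mx D (ph (Sa K n)) = 0 by apply/colP => i; rewrite !mxE (derC dD).
congr (pt _ _ s); last by rewrite map_col_mx De map_const_mx (der0 dD) col_mx0.
rewrite /sl map_block_mx map_const_mx (der0 dD) (derNx dD) !(derMx dD) !derTx Dp.
by rewrite mul0mx trmx0 mulmx0 addr0 add0r.
Qed.

(** Each Hamiltonian direction for N, pushed to the slice, is by [sl_rotation] or [sl_translation]
    an admissible direction for N + 2 that does not move e. *)
Lemma rho_central : Poisson_center (@Hcl_bracket K n [::]) (rho h).
Proof.
have skA := genA_skew K n.
have skS : (sl (ph _) A w)^T = - sl (ph _) A w := sl_skew _ _ skA.
apply/Poisson_centerP => //; split=> [B skB|x].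
  have skB' : (map_mx (in_alg (Sa K n)) B)^T = - map_mx (in_alg (Sa K n)) B.
    by rewrite map_trmx skB map_mxN.
  rewrite der_slice ?bracket_so_A ?bracket_so_v //; last exact: derivation_bracket.
  rewrite -(sl_rotation (ph _) A w skB').
  have skL : (lower (- map_mx (in_alg (Sa K n)) B))^T = - lower (- map_mx (in_alg (Sa K n)) B).
    by apply: lower_skew; rewrite linearN /= skB'.
  have := central_dev K0 ch (cone_e n (ep _)) skS 0 skL.
  by rewrite trmx0 mulmx0 mul0mx addr0 subr0 lower_col.
rewrite der_slice ?bracket_vec_A ?bracket_vec_v //; last exact: derivation_bracket.
rewrite /Gmx big_ord0 mul0mx oppr0.
set y := map_mx _ x; rewrite -(sl_translation (dot_ph_ep _) w y skA) /=.
pose Y := emb y *m (cone_e n (ep (Sa K n)))^T - cone_e n (ep _) *m (emb y)^T.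
have skY : Y^T = - Y by apply: wedge_skew.
have Ye : Y *m cone_e n (ep _) = 0.
  by rewrite mulmxBl !mul_dot dot_ee ?dot_ep_ep // dotC dot_e_emb !scale0r subrr.
have := central_dev K0 ch (cone_e n (ep _)) skS (- (sl (ph _) A w *m emb y)) skY.
by rewrite Ye.
Qed.
End Rho.

Section RhoTorus.
Variables (K : numClosedFieldType) (n : nat).
Variable h : Sa K (2 + n).
Hypothesis ch : Poisson_center (@Hcl_bracket K (2 + n) [::]) h.

Let K0 : [pchar K] =i pred0. Proof. exact: pchar_num. Qed.
Let nz2 : (2 : K) != 0. Proof. by rewrite pnatr_eq0. Qed.

Section SlicePoint.
Variables (S : comAlgType K) (A : 'M[S]_n) (w : 'cV[S]_n).
Hypothesis skA : A^T = - A.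
Local Notation e := (cone_e n (ep S)).
Local Notation sl := (sl (ph _)).
Local Notation kc := (map_mx (@kconst K S)).

Definition slice_orbit : kpoly (kpoly S) := torus_orbit h (sl A 0) (sl 0 w) e.

Let orbit_coef j k : j != k -> ((slice_orbit : {poly (kpoly S)})`_k : {poly S})`_j = 0.
Proof.
have sk0 : (sl (0 : 'M[S]_n) w)^T = - sl 0 w by apply: sl_skew; rewrite trmx0 oppr0.
apply: (torus_orbit_coef K0 ch (E := boost n (ep S) (ph S))) => //.
- exact: sl_skew.
- exact: boost_skew.
- exact: boost_comm.
- exact: boost_comm_sl (dot_ph_ph S) (dot_ph_ep S) w.
- exact: boost_e (dot_ep_ep S) (dot_ph_ep S).
Qed.

Let orbit_diag j :
  ((keval 1 slice_orbit : kpoly S) : {poly S})`_j = ((slice_orbit : {poly (kpoly S)})`_j : {poly S})`_j.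
Proof.
pose M := maxn (size (slice_orbit : {poly (kpoly S)})) j.+1.
rewrite /keval /horner_eval (@horner_coef_wide _ M) ?leq_maxl // coef_sum.
have lt_jM : (j < M)%N by rewrite leq_maxr.
rewrite (bigD1 (Ordinal lt_jM)) //= expr1n mulr1 big1 ?addr0 // => i ne.
by rewrite expr1n mulr1 orbit_coef // eq_sym.
Qed.

Let k2E p q (M : 'M[S]_(p, q)) :
  map_mx (@kconst2 K S) M = map_mx (@kconst K (kpoly S)) (kc M).
Proof. by apply/matrixP => i j; rewrite !mxE. Qed.

Let kcE : kc e = cone_e n (ep (kpoly S)).
Proof. by apply: map_cone_e; apply: kconst_alg. Qed.

Let kc_sl (B : 'M[S]_n) u : kc (sl B u) = sl (kc B) (kc u).
Proof. by apply: map_sl; apply: kconst_alg. Qed.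

Lemma orbit_rho : keval 1 slice_orbit = kmap (ev (pt A w)) (Lam (rho h)).
Proof.
rewrite Lam_ev // ev_rho ?map_skew // /slice_orbit /torus_orbit.
rewrite (ev_mor _ _ (keval_alg 1)); apply: eq_ev => s; rewrite map_pt.
rewrite map_mxD !map_mxZ /= kevalX scale1r keval_const !k2E !keval_constx kcE.
by rewrite !kc_sl !map_mx0 -slZ -slD.
Qed.

(** Since [sl] is affine in w, the orbit at lam = 1 is [Lam (rho h)] in the variable mu. Only the
    monomials (mu lam)^j survive, so its coefficient in degree j is one of lam^j, which is bounded
    by the degree of h in v. *)
Lemma coef_Lam_rho j m : (size (Lam h : {poly (Sa K (2 + n))}) <= m)%N -> (m <= j)%N ->
  (kmap (ev (pt A w)) (Lam (rho h)) : {poly S})`_j = 0.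
Proof.
move=> sh le_mj; rewrite -orbit_rho orbit_diag.
have -> : slice_orbit = kmap (ev (pt (kc (sl A 0) + 'X *: kc (sl 0 w)) (kc e))) (Lam h).
  have skC : (kc (sl A 0) + 'X *: kc (sl 0 w))^T = - (kc (sl A 0) + 'X *: kc (sl 0 w)).
    rewrite linearD linearZ /= !map_skew ?scalerN ?opprD //; apply: sl_skew => //.
    by rewrite trmx0 oppr0.
  rewrite (Lam_ev nz2 _ _ skC) /slice_orbit /torus_orbit; apply: eq_ev => s.
  by rewrite map_mxD map_mxZ /= !k2E.
by rewrite kmap_coef (nth_default _ (leq_trans sh le_mj)) rmorph0 coef0.
Qed.

(** The diagonal coefficients, all that survive, are those of [Lam (rho h)]. So the whole orbit
    vanishes, in particular at mu = 1 and lam = l. *)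
Lemma rho0_slice (l : S) : rho h = 0 -> ev (pt (sl A w) (l *: e)) h = 0.
Proof.
move=> rh0; have H0 : slice_orbit = 0.
  apply/polyP => k; apply/polyP => j; rewrite !coef0.
  have [->|/orbit_coef//] := eqVneq j k.
  by rewrite -orbit_diag orbit_rho rh0 !rmorph0 coef0.
have := congr1 (keval 1) (congr1 (keval (kconst l)) H0); rewrite !rmorph0 => <-.
rewrite /slice_orbit /torus_orbit !(ev_pt_mor _ _ _ (keval_alg _)).
rewrite !map_mxD !map_mxZ /= kevalX !keval_const !k2E !keval_constx kevalX scale1r.
by rewrite -slD.
Qed.
End SlicePoint.

Lemma size_Lam_rho m : (size (Lam h : {poly (Sa K (2 + n))}) <= m)%N ->
  (size (Lam (rho h) : {poly (Sa K n)}) <= m)%N.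
Proof.
move=> sh; apply/leq_sizeP => j le_mj.
have := coef_Lam_rho (genv K n) (genA_skew K n) sh le_mj.
by rewrite kmap_coef /= ev_gen.
Qed.
End RhoTorus.

(** * Vanishing on the null cone *)

Section ConeVanishing.
Variables (K : numClosedFieldType) (n : nat).
Variable h : Sa K (2 + n).
Hypothesis ch : Poisson_center (@Hcl_bracket K (2 + n) [::]) h.
Hypothesis rho0 : rho h = 0.

Let K0 : [pchar K] =i pred0. Proof. exact: pchar_num. Qed.
Let nz2 : (2 : K) != 0. Proof. by rewrite pnatr_eq0. Qed.

Variable S : comAlgType K.
Local Notation e := (cone_e n (ep S)).
Local Notation f := (cone_f n (ph S)).

(** The translation along u = A f / l makes the matrix kill f, using (f, A f) = 0; the point then
    lies over the slice. *)
Lemma ray_vanish (A : 'M[S]_(2 + n)) (l l' : S) : l * l' = 1 -> A^T = - A ->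
  ev (pt A (l *: e)) h = 0.
Proof.
move=> ll' skA; pose u := l' *: (A *m f).
rewrite -(translation_inv K0 ch (l *: e) u skA).
set M := A + _; have skM : M^T = - M.
  by rewrite /M linearD /= wedge_skew skA [RHS]opprD.
rewrite (sl_of_skew (ep_ph_id S) nz2 skM); first apply: rho0_slice => //.
  by move/(congr1 drsubmx): skM; rewrite -trmx_drsub => ->; apply/matrixP => i j; rewrite !mxE.
rewrite /M mulmxDl mulmxBl !mul_dot /u !dotZl dotC dot_skew0 // mulr0 scale0r sub0r.
by rewrite dot_ef ?dot_ph_ep // mulr1 scalerA ll' scale1r subrr.
Qed.

(** With l = (f, v) invertible, exp E for y = - z / l removes the component z of v in V_n, and (v,
    v) = 0 forces the f-component to vanish with it. What remains is l e. *)
Lemma cone_vanish (A : 'M[S]_(2 + n)) (v : 'cV[S]_(2 + n)) (l' : S) : A^T = - A ->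
  dot f v * l' = 1 -> dot v v = 0 -> ev (pt A v) h = 0.
Proof.
move=> skA; set l := dot f v => ll' v0.
pose y : 'cV[S]_n := - l' *: dsubmx v; pose E := emb y *m f^T - f *m (emb y)^T.
have skE : E^T = - E by apply: wedge_skew.
have fy : dot f (emb y) = 0 by apply: dot_f_emb.
have ff : dot f f = 0 by apply: dot_ff (dot_ph_ph S).
have EE : E *m E = - dot y y *: (f *m f^T).
  rewrite {2}/E mulmxBr !mulmxA /E !mulmxBl !mul_dot ff fy dotC fy dot_emb.
  by rewrite !scale0r !mul0mx sub0r subrr subr0 -scalemxAl scaleNr.
have E3 : E *m E *m E = 0.
  rewrite -mulmxA EE -scalemxAr mulmxA /E mulmxBl !mul_dot ff dotC fy !scale0r.
  by rewrite subrr mul0mx scaler0.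
rewrite -(unipotent_inv K0 ch v skA skE E3).
have -> : unip E *m v = l *: e.
  rewrite /unip EE !mulmxDl mul1mx -!scalemxAl !mul_dot -/l mulNmx mul_dot.
  pose z := dsubmx v; pose m := dot (ep S) (usubmx v).
  have lE : l = dot (ph S) (usubmx v) by rewrite /l -{1}[v]vsubmxK /cone_f dot_col dot0l addr0.
  have vE : v = l *: e + m *: f + emb z.
    rewrite -{1}[v]vsubmxK /cone_e /cone_f /emb !scale_col_mx !add_col_mx !scaler0 !add0r addr0.
    by rewrite lE /m -(plane_coord (ep_ph_id S)).
  have zz : dot z z = - (l * m + l * m).
    have := v0; rewrite vE !dotDl !dotDr !dotZl !dotZr dot_ee ?dot_ep_ep // dot_ff ?dot_ph_ph //.
    rewrite dot_fe ?dot_ph_ep // dot_ef ?dot_ph_ep // dot_emb dot_e_emb dot_f_emb.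
    rewrite (dotC (emb z)) dot_e_emb (dotC (emb z)) dot_f_emb.
    by move/eqP; rewrite !(mulr0, mulr1, addr0, add0r) addr_eq0 => /eqP; move: (dot z z) => q; move=> /(congr1 -%R); rewrite opprK => <-; ring.
  have yv : dot (emb y) v = - l' * dot z z.
    by rewrite -{1}[v]vsubmxK /emb dot_col dot0l add0r dotZl.
  have yy : dot y y = l' * l' * dot z z by rewrite dotZl dotZr; ring.
  have cc : (inv2 K)%:A + (inv2 K)%:A = 1 :> S.
    by rewrite -scalerDl -mulr2n -mulr_natl inv2K scale1r.
  have ly : l *: emb y = - emb z.
    by rewrite /emb !scale_col_mx scaler0 opp_col_mx oppr0 scalerA mulrN ll' scaleN1r.
  rewrite ly yv yy zz {1}vE; move: (inv2 K)%:A cc => c cc.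
  move: (e) (f) (emb z) => a b d; apply/colP => i; rewrite !mxE.
  (* With l l' = 1 and c = 1/2 the bracket is 1 - 2 + 1 = 0. *)
  transitivity (l * a i 0 + m * b i 0 * (1 - (l * l' + l * l') + (c + c) * (l * l') * (l * l'))); first by ring.
  by rewrite ll' cc !mulr1 opprD addrA subrr sub0r addNr mulr0 addr0.
apply: (ray_vanish ll'); rewrite !trmx_mul trmxK skA mulNmx mulmxN mulmxA //.
Qed.
End ConeVanishing.

(** * Division by tau_1 *)

Lemma Sa_mul_eq0 (K : fieldType) N (a b : Sa K N) : a * b = 0 -> a = 0 \/ b = 0.
Proof.
move=> ab; have := @mulf_eq0 {mpoly K[#|coord_idx N|]} a b.
by rewrite (_ : _ * _ = 0) // eqxx => /esym/orP[]/eqP; [left|right].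
Qed.

Section ZeroPolynomial.
Variables (K : numClosedFieldType) (N : nat).
Local Notation idx := (coord_idx N).
Implicit Types (f : Sa K N) (P : idx -> K^o).

Lemma poly_zeros (p : {poly K}) : (forall c, p.[c] = 0) -> p = 0.
Proof.
move=> p0; apply: (@roots_geq_poly_eq0 _ p [seq i%:R | i <- iota 0 (size p)]).
- by apply/allP => c _; rewrite /root p0.
- rewrite map_inj_uniq ?iota_uniq // => i j /eqP; rewrite eqr_nat => /eqP //.
- by rewrite size_map size_iota.
Qed.

(** Restrict f to the line through P in the coordinate direction s0 and differentiate at 0. *)
Lemma ev_mderiv_eq0 f s0 : (forall P, ev P f = 0) ->
  forall P, ev P (mderiv (enum_rank s0) f) = 0.
Proof.
move=> f0 P; pose Q s : kpoly K^o := @kconst K K^o (P s) + 'X * (s0 == s)%:R.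
have Q0 : ev Q f = 0.
  apply: (@poly_zeros (ev Q f)) => c; rewrite -[LHS]/(keval (c : K^o) (ev Q f)).
  by rewrite (ev_mor _ _ (keval_alg _)) f0.
have /(congr1 (@deriv K : kpoly K^o -> kpoly K^o)) := Q0.
rewrite (chain_rule _ _ (derivation_deriv K^o)) deriv0 => /(congr1 (keval (0 : K^o))).
rewrite rmorph0 (dev_mor _ _ _ (keval_alg _)) => <-.
rewrite /dev (bigD1 s0) //= big1 ?addr0 => [|s ne].
  rewrite derivD derivC add0r derivM derivX eqxx mul1r derivC mulr0 addr0 rmorph1 mulr1.
  apply: eq_ev => s /=; rewrite rmorphD rmorphM /= keval_const kevalX mul0r addr0 //.
by rewrite derivD derivC add0r derivM eq_sym (negPf ne) mulr0 add0r deriv0 mulr0 rmorph0 mulr0.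
Qed.

(** By [ev_mderiv_eq0] all derivatives vanish at 0 too, and in characteristic 0 they determine the
    coefficients. *)
Lemma ev_eq0 f : (forall P, ev P f = 0) -> f = 0.
Proof.
move=> f0; apply/mpolyP => m; rewrite mcoeff0.
have [d] := ubnP (mdeg m); elim: d f f0 m => // d IH f f0 m.
have [-> _|m0] := eqVneq m 0%MM.
  rewrite -[RHS](f0 (fun=> 0)); elim/Sa_ind: (f) => [c|p q IHp IHq|s p IHp].
  - by rewrite ev_alg alg_mpolyC mcoeffC eqxx mulr1 -[RHS]/(c * 1) mulr1.
  - by rewrite mcoeffD rmorphD /= IHp IHq.
  - rewrite (rmorphM (mcoeff 0%MM)) rmorphM /= ev_coord mul0r /poly_coord mcoeffX.
    by rewrite mnm1_eq0 mul0r.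
have [i mi] : exists i, m i != 0%N.
  by apply/existsP; apply: contraNT m0 => /existsPn mz; apply/eqP/mnmP => i; rewrite mnm0E; apply/eqP; rewrite -[_ == _]negbK.
rewrite -lep1mP in mi; rewrite -(submK mi) mdegD mdeg1 addn1 ltnS => lt_md.
have := IH (mderiv i f); rewrite -(enum_valK i) => /(_ (ev_mderiv_eq0 _ f0) _ lt_md).
by rewrite enum_valK mcoeff_deriv => /eqP; rewrite mulrn_eq0 => /eqP.
Qed.
End ZeroPolynomial.

Section ConeDivision.
Variables (K : numClosedFieldType) (N : nat) (i0 i1 : 'I_N).
Hypothesis ne01 : i1 != i0.
Local Notation idx := (coord_idx N).
Local Notation s0 := (inr i0 : idx).

Let nz2 : (2 : K) != 0. Proof. by rewrite pnatr_eq0. Qed.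

(** Independence of v_{i0} is stated through values at [K]-points only; by [ev_eq0] these are enough
    for the division. *)
Definition indep_of (f : Sa K N) := forall P P' : idx -> K^o,
  (forall s, s != s0 -> P s = P' s) -> ev P f = ev P' f.

Definition other_squares : Sa K N := \sum_(i | i != i0) poly_coord K (inr i) ^+ 2.

Lemma tau1E : tau K N 1 = poly_coord K s0 ^+ 2 + other_squares.
Proof.
rewrite /tau /psi mul1mx /dot mxE (bigD1 i0) //= !mxE -expr2; congr (_ + _).
by apply: eq_bigr => i _; rewrite !mxE -expr2.
Qed.

Lemma indep_other : indep_of other_squares.
Proof.
move=> P P' PP'; rewrite !rmorph_sum; apply: eq_bigr => i ne /=.
by rewrite !rmorphXn /= !ev_coord PP'.
Qed.

Lemma indep_mul f g : indep_of f -> indep_of g -> indep_of (f * g).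
Proof. by move=> fi gi P P' PP'; rewrite !rmorphM /= (fi _ _ PP') (gi _ _ PP'). Qed.

Lemma indep_add f g : indep_of f -> indep_of g -> indep_of (f + g).
Proof. by move=> fi gi P P' PP'; rewrite !rmorphD /= (fi _ _ PP') (gi _ _ PP'). Qed.

(** Division by tau_1, a monic quadratic polynomial in v_{i0}. *)
Lemma tau1_div (h : Sa K N) : exists g r0 r1, [/\ indep_of r0, indep_of r1 &
  h = tau K N 1 * g + r0 + r1 * poly_coord K s0].
Proof.
have ialg c : indep_of c%:A by move=> P P' _; rewrite !ev_alg.
elim/Sa_ind: h => [c|p q [g [r0 [r1 [i_0 i_1 ->]]]] [g' [r0' [r1' [i_0' i_1' ->]]]]|s p [g [r0 [r1 [i_0 i_1 ->]]]]].
- exists 0, c%:A, 0; split=> //; first by have := ialg 0; rewrite scale0r.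
  by rewrite mulr0 mul0r add0r addr0.
- exists (g + g'), (r0 + r0'), (r1 + r1'); split; try exact: indep_add.
  by ring.
have [->|ne] := eqVneq s s0.
  exists (poly_coord K s0 * g + r1), (- (1%:A * other_squares * r1)), r0; split => //.
    by move=> P P' PP'; rewrite !rmorphN /= (indep_mul (indep_mul (ialg 1) indep_other) i_1 PP').
  by rewrite tau1E scale1r; ring.
have ind : indep_of (poly_coord K s) by move=> P P' PP'; rewrite !ev_coord PP'.
exists (poly_coord K s * g), (poly_coord K s * r0), (poly_coord K s * r1).
by split; [exact: indep_mul|exact: indep_mul|ring].
Qed.

(** Let q be the sum of the other squares. Given the other coordinates, both v_{i0} = s and v_{i0} =
    -s with s^2 = -q lie on the cone, and C takes the same value at both. So r0 and r1 s vanish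
    where C != 0; hence C r0 = 0 and C q r1 = 0 as polynomials, and the remainder is 0. *)
Lemma cone_division (h C : Sa K N) : C != 0 -> indep_of C ->
  (forall (A : 'M[K^o]_N) (v : 'cV[K^o]_N), A^T = - A -> dot v v = 0 ->
     ev (pt A v) C <> 0 -> ev (pt A v) h = 0) ->
  exists g, h = tau K N 1 * g.
Proof.
move=> nzC iC h0; have [g [r0 [r1 [i_0 i_1 hE]]]] := tau1_div h.
have hP (P : idx -> K^o) : ev P (tau K N 1) = 0 -> ev P C <> 0 -> ev P h = 0.
  move=> tP CP; pose A := map_mx (ev P) (genA K N); pose v := map_mx (ev P) (genv K N).
  have PE f : ev P f = ev (pt A v) f by apply: mor_ev => c; apply: ev_alg.
  rewrite PE; apply: h0; rewrite -?PE //; first by rewrite map_skew ?genA_skew.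
  by rewrite /v dot_map -tP /tau /psi mul1mx.
have key (P : idx -> K^o) : ev P C <> 0 -> ev P r0 = 0 /\ ev P other_squares * ev P r1 = 0.
  move=> CP; pose q : K := ev P other_squares; pose s : K := sqrtC (- q).
  have ss : s * s = - q by rewrite -expr2 sqrtCK.
  pose Q (c : K) (t : idx) : K^o := if t == s0 then c else P t.
  have QP c f : indep_of f -> ev (Q c) f = ev P f.
    by move=> fi; apply: fi => t /negPf ne; rewrite /Q ne.
  have Qs c : c * c = - q -> ev P r0 + ev P r1 * (c : K^o) = 0.
    move=> cc; have tQ : ev (Q c) (tau K N 1) = 0.
      rewrite tau1E rmorphD rmorphXn /= ev_coord QP; last exact: indep_other.
      by rewrite {1}/Q eqxx expr2 -[c * c]/((c : K) * c) cc addNr.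
    have := hP (Q c) tQ; rewrite (QP _ C) // => /(_ CP).
    by rewrite hE !rmorphD !rmorphM /= tQ mul0r add0r (QP _ r0) // (QP _ r1) // ev_coord /Q eqxx.
  have e1 := Qs s ss; have e2 : ev P r0 + ev P r1 * (- s : K^o) = 0 by apply: Qs; rewrite mulrNN.
  have r00 : ev P r0 = 0.
    apply: (mulfI nz2); rewrite mulr0 -[RHS]addr0 -{1}e1 -e2; move: (ev P r0) (ev P r1) => a b.
    rewrite -[2 * a]/(2 * (a : K)); ring.
  split=> //; move: e1; rewrite r00 add0r => /(congr1 (fun z : K => z * - s)).
  by rewrite mul0r -mulrA mulrN [X in _ * - X]ss opprK mulrC.
have eqs : (C * r0 = 0) /\ (C * (other_squares * r1) = 0).
  split; apply: ev_eq0 => P; rewrite !rmorphM /=.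
    by have [->|/eqP/key[-> _]] := eqVneq (ev P C) 0; rewrite ?mul0r ?mulr0.
  by have [->|/eqP/key[_ ->]] := eqVneq (ev P C) 0; rewrite ?mul0r ?mulr0.
have nzQ : other_squares != 0.
  apply: contra_neq (oner_neq0 K^o) => Q0.
  pose P (t : idx) : K^o := (t == inr i1)%:R.
  have := congr1 (ev P) Q0; rewrite rmorph0 rmorph_sum (bigD1 i1) //= big1 => [|i /andP[_ ne]].
    by rewrite rmorphXn /= ev_coord /P eqxx expr1n addr0.
  by rewrite rmorphXn /= ev_coord /P (inj_eq inr_inj) (negPf ne) expr0n.
exists g; rewrite hE.
case: eqs => /Sa_mul_eq0[/eqP|->]; first by rewrite (negPf nzC).
case/Sa_mul_eq0=> [/eqP|/Sa_mul_eq0[/eqP|->]]; rewrite ?(negPf nzC) ?(negPf nzQ) //.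
by rewrite mul0r !addr0.
Qed.
End ConeDivision.

Lemma skew2_comm (K : fieldType) (S : comAlgType K) (M M' : 'M[S]_2) : (2 : K) != 0 ->
  M^T = - M -> M'^T = - M' -> M *m M' = M' *m M.
Proof.
move=> nz2 skM skM'; apply/matrixP => i j; rewrite !mxE !big_ord_recl !big_ord0 !addr0.
have E (X : 'M[S]_2) : X^T = - X -> exists a, forall k l, X k l = (l%:R - k%:R) * a.
  move=> skX; exists (X ord0 (lift ord0 ord0)) => k l; case: (unliftP ord0 k) => [k'|] ->; case: (unliftP ord0 l) => [l'|] ->;
    rewrite ?ord1 /bump /=.
  - by rewrite skew_ii // subrr mul0r.
  - by rewrite (skew_ji ord0 _ skX) sub0r mulN1r.
  - by rewrite subr0 mul1r.
  - by rewrite skew_ii // subrr mul0r.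
have [a Ea] := E M skM; have [b Eb] := E M' skM'; rewrite !Ea !Eb; ring.
Qed.

Section Ray.
Variables (K : fieldType) (N : nat).
Hypothesis K0 : [pchar K] =i pred0.
Variable h : Sa K N.
Hypothesis ch : Poisson_center (@Hcl_bracket K N [::]) h.

(** The rotation B fixes A and moves X u with velocity c X u. So c X times the derivative of h along
    the ray is 0, and both factors cancel. *)
Lemma ray_const (S : comAlgType K) (A B : 'M[S]_N) (u : 'cV[S]_N) (c : K) a b :
  c != 0 -> A^T = - A -> B^T = - B -> B *m A = A *m B -> B *m u = c%:A *: u ->
  ev (pt A (a *: u)) h = ev (pt A (b *: u)) h.
Proof.
move=> nzc skA skB BA Bu; pose kc p q (M : 'M[S]_(p, q)) := map_mx (@kconst K S) M.
pose p : kpoly S := ev (pt (kc _ _ A) ('X *: kc _ _ u)) h.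
have pE x : ev (pt A (x *: u)) h = keval x p.
  by rewrite /p (ev_pt_mor _ _ _ (keval_alg x)) map_mxZ /= kevalX !keval_constx.
have dp : (p : {poly S})^`() = dev (pt (kc _ _ A) ('X *: kc _ _ u)) (pt 0 (kc _ _ u)) h.
  rewrite -[LHS]/((@deriv S : kpoly S -> kpoly S) p) /p (chain_rule _ _ (derivation_deriv S)).
  rewrite (eq_dev _ _ (map_pt _ _ _)) (derZx (derivation_deriv S)) !deriv_kconstx derivX.
  by rewrite scale1r scaler0 addr0.
have skkA : (kc _ _ A)^T = - kc _ _ A by apply: map_skew.
have skkB : (kc _ _ B)^T = - kc _ _ B by apply: map_skew.
have := central_dev K0 ch ('X *: kc _ _ u : 'cV[kpoly S]_N) skkA 0 skkB.
rewrite trmx0 mulmx0 mul0mx subr0 addr0 -!map_mxM /= BA subrr -scalemxAr -map_mxM /= Bu map_mxZ /= -/(kc _ _ _).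
rewrite kconst_alg => d0; have {}dp : (p : {poly S})^`() = 0.
  have : ((c%:A : kpoly S) * ('X : kpoly S)) * ((p : {poly S})^`() : kpoly S) = 0.
    rewrite dp -[RHS]d0 /dev mulr_sumr; apply: eq_bigr => s _; rewrite mulrCA; congr (_ * _).
    by case: s => [q|i]; rewrite /= !mxE ?mulr0 // mulrA [c%:A * _]mulrC.
  rewrite -mulrA mulr_algl => /(congr1 (fun q => c^-1 *: q)); rewrite scaler0 scalerA mulVf // scale1r => Xp.
  by apply/polyP => k; have /(congr1 (fun q : {poly S} => q`_k.+1)) := Xp; rewrite coefXM !coef0.
by rewrite !pE (deriv_eq0 K0 dp) /keval /horner_eval !hornerC.
Qed.
End Ray.

Section RhoKernel.
Variables (K : numClosedFieldType) (n : nat).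
Variable h : Sa K (2 + n).
Hypothesis ch : Poisson_center (@Hcl_bracket K (2 + n) [::]) h.
Hypothesis rho0 : rho h = 0.

Let K0 : [pchar K] =i pred0. Proof. exact: pchar_num. Qed.
Let nz2 : (2 : K) != 0. Proof. by rewrite pnatr_eq0. Qed.

(** Only the first two coordinates of v enter; this lets (f, v) serve as [C] once a third coordinate
    exists. *)
Lemma ev_dot_f (P : coord_idx (2 + n) -> K^o) :
  ev P (dot (cone_f n (ph _)) (genv K (2 + n))) = dot (ph _) (\col_i P (inr (lshift n i))).
Proof.
rewrite -(dot_map (ev P)) map_col_mx map_mx0 map_ph; last exact: ev_alg.
rewrite -[map_mx _ (genv _ _)]vsubmxK dot_col dot0l addr0; congr dot.
by apply/colP => i; rewrite !mxE /= ev_coord.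
Qed.

Lemma rho_kernel : exists g, h = tau K (2 + n) 1 * g.
Proof.
case: n h ch rho0 ev_dot_f => [|m] h' ch' rho0' evf.
  (* At N = 2 the form (f, v) involves every coordinate, so C = 1 is used and the line spanned by f
     is treated too. There h is constant by [ray_const]; through the value at v = 0 it equals the
     value at e, which is 0. *)
  apply: (@cone_division K (2 + 0) ord0 (lift ord0 ord0) _ h' 1) => //; rewrite ?oner_eq0 //.
    by move=> P P' _; rewrite !rmorph1.
  move=> A v skA v0 _; have [l0|nzl] := eqVneq (dot (cone_f 0 (ph K^o)) v) 0; last first.
    by apply: (cone_vanish ch' rho0' (l' := (dot (cone_f 0 (ph K^o)) v)^-1)) => //; apply: mulfV.
  pose B := boost 0 (ep K^o) (ph K^o).
  have skB : B^T = - B by apply: boost_skew.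
  have cBA : B *m A = A *m B by apply: skew2_comm.
  have Be : B *m cone_e 0 (ep K^o) = 1%:A *: cone_e 0 (ep K^o).
    by rewrite boost_e ?dot_ep_ep ?dot_ph_ep // !scale1r.
  have Bf : B *m cone_f 0 (ph K^o) = (-1)%:A *: cone_f 0 (ph K^o).
    by rewrite /B /boost mulmxBl !mul_dot dot_ff ?dot_ph_ph // dot_ef ?dot_ph_ep // scale0r sub0r scaleN1r scaleN1r scale1r.
  have -> : v = dot (ep K^o) (usubmx v) *: cone_f 0 (ph K^o).
    rewrite -[LHS]vsubmxK [usubmx v in LHS](plane_coord (ep_ph_id K^o)).
    have -> : dot (ph K^o) (usubmx v) = 0.
      by rewrite -l0 -[v in RHS]vsubmxK dot_col dot0l addr0.
    rewrite scale0r add0r scale_col_mx scaler0; congr col_mx.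
    by apply/colP => -[].
  rewrite (ray_const K0 ch' _ 0 _ skA skB cBA Bf) ?oppr_eq0 ?oner_eq0 // scale0r.
  rewrite -(scale0r (cone_e 0 (ep K^o))) (ray_const K0 ch' 0 1 _ skA skB cBA Be) ?oner_eq0 //.
  exact: (ray_vanish ch' rho0' (mulr1 1) skA).
pose C := dot (cone_f m.+1 (ph _)) (genv K (2 + m.+1)).
(* Division is with respect to the third coordinate, on which C = (f, v) does not depend. *)
apply: (@cone_division K (2 + m.+1) (rshift 2 ord0) (lshift m.+1 ord0) _ h' C) => //.
- apply: contra_neq (oner_neq0 K^o) => C0.
  have := evf (pt 0 (cone_e m.+1 (ep K^o))); rewrite -/C C0 rmorph0 => ->.
  rewrite -(dot_ph_ep K^o); congr dot; apply/colP => i; by rewrite [RHS]mxE /= (@col_mxEu _ 2).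
- move=> P P' PP'; rewrite /C !evf; congr dot; apply/colP => i; rewrite !mxE PP' //.
  by rewrite (inj_eq inr_inj) eq_lrshift.
move=> A v skA v0 /eqP; rewrite evf => nzl.
apply: (cone_vanish ch' rho0' (l' := (dot (cone_f m.+1 (ph K^o)) v)^-1)) => //; apply: mulfV.
by rewrite -[v]vsubmxK dot_col dot0l addr0; congr (dot _ _ != 0): nzl; apply/colP => i; rewrite !mxE.
Qed.
End RhoKernel.

(** * The center for zeta = 0 *)

Section CenterAlgebra.
Variables (K : fieldType) (N : nat) (zeta : seq K).
Hypothesis nz2 : (2 : K) != 0.
Local Notation center := (Poisson_center (@Hcl_bracket K N zeta)).

Lemma center_der f : center f <-> forall b, Hcl_bracket zeta b f = 0.
Proof. by split=> cf b; rewrite Hcl_bracket_antisym cf oppr0. Qed.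

Lemma center_alg c : center (c%:A : Sa K N).
Proof. by apply/center_der => b; apply: derC (derivation_bracket zeta b) c. Qed.

Lemma center_add f g : center f -> center g -> center (f + g).
Proof.
move=> /center_der cf /center_der cg; apply/center_der => b.
by rewrite (derD' (derivation_bracket zeta b)) cf cg addr0.
Qed.

Lemma center_mul f g : center f -> center g -> center (f * g).
Proof.
move=> /center_der cf /center_der cg; apply/center_der => b.
by rewrite (derM (derivation_bracket zeta b)) cf cg mulr0 mul0r addr0.
Qed.

Lemma center_sub f g : center f -> center g -> center (f - g).
Proof.
move=> cf cg; rewrite -scaleN1r -mulr_algl; apply: center_add => //.
by apply: center_mul => //; apply: center_alg.
Qed.

Lemma center_evm m (F : 'I_m -> Sa K N) q : (forall j, center (F j)) -> center (evm F q).
Proof.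
move=> cF; elim/mpoly_var_ind: q => [c|p q cp cq|i p cp].
- by rewrite evm_C; apply: center_alg.
- by rewrite evmD; apply: center_add cp cq.
- by rewrite evmM evmX; apply: center_mul (cF i) cp.
Qed.

Lemma center_cancel f g : f != 0 -> center f -> center (f * g) -> center g.
Proof.
move=> nzf /center_der cf /center_der cfg; apply/center_der => b.
have := cfg b; rewrite (derM (derivation_bracket zeta b)) cf mul0r add0r.
by case/Sa_mul_eq0 => // /eqP; rewrite (negPf nzf).
Qed.
End CenterAlgebra.

Section Generators.
Variables (K : fieldType) (N : nat).
Hypothesis K0 : [pchar K] =i pred0.

Let nz2 : (2 : K) != 0. Proof. by rewrite ((pcharf0P K).1 K0). Qed.

(** One index set for both parities: [uphalf N] exceeds [N./2] by one exactly when N is odd, and the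
    extra index carries the Pfaffian. *)
Definition gens (j : 'I_(uphalf N)) : Sa K N :=
  if (j < N./2)%N then tau K N j.+1 else tauhat K N.

Definition weight (j : 'I_(uphalf N)) : nat := if (j < N./2)%N then 2 else 1.

Lemma gens_odd (j : 'I_(uphalf N)) : (j < N./2)%N = false -> odd N.
Proof.
have : (j < odd N + N./2)%N by rewrite -uphalf_half.
by case: (odd N) => //= ->.
Qed.

Lemma center_gens j : Poisson_center (@Hcl_bracket K N [::]) (gens j).
Proof.
rewrite /gens; case: ifP => [_|/gens_odd oddN]; last exact: central_tauhat.
have := @central_tau_celt K N [::] nz2 j; rewrite /celt cPoly_explicit big_ord0 mulr0 addr0.
exact.
Qed.

Lemma top_Lam_gens j : top (weight j) (Lam (gens j)) (gens j).
Proof.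
rewrite /gens /weight; case: ifP => [_|/gens_odd oddN].
  rewrite Lam_tau // -[X in top _ _ X]mul1r; apply: (topM (d := 2) (e := 0)); split.
  - by rewrite size_polyXn.
  - by rewrite coefXn.
  - by rewrite size_polyC leq_b1.
  - by rewrite coefC.
rewrite Lam_tauhat // -[X in top _ _ X]mul1r; apply: (topM (d := 1) (e := 0)); split.
- by rewrite size_polyX.
- by rewrite coefX.
- by rewrite size_polyC leq_b1.
- by rewrite coefC.
Qed.

Lemma size_Lam_evm q m : (size (omega weight q : {poly {mpoly K[uphalf N]}}) <= m.+1)%N ->
  (size (Lam (evm gens q) : {poly Sa K N}) <= m.+1)%N.
Proof.
move=> sq; rewrite (evm_mor _ _ (@Lam_alg K N)).
by case: (top_evm top_Lam_gens sq).
Qed.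
End Generators.

Lemma pfaffian0 (K : fieldType) (S : comAlgType K) (M : 'M[S]_0) : pfaffian M = 1.
Proof.
rewrite /pfaffian /= expn0 mul1n invr1 scale1r (bigD1 1%g) //= [X in _ + X]big1 ?addr0 => [|s].
  by rewrite odd_perm1 expr0 mul1r big1 // => -[[]].
by move=> /eqP[]; apply/permP => -[].
Qed.

Section BaseOne.
Variables (K : fieldType).
Hypothesis K0 : [pchar K] =i pred0.
Let nz2 : (2 : K) != 0. Proof. by rewrite ((pcharf0P K).1 K0). Qed.

Lemma tauhat1 : tauhat K 1 = poly_coord K (inr ord0 : coord_idx 1).
Proof.
rewrite /tauhat; set c := poly_coord _ _.
have -> : genv K 1 = c *: (const_mx 1 : 'cV_1).
  by apply/colP => i; rewrite !mxE !ord1 mulr1.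
have skA := genA_skew K 1; rewrite psihat_scale // -[RHS]mulr1; congr (c * _).
rewrite /psihat; have skM := bordered_skew (const_mx 1) skA.
rewrite (@pfaffian_block _ _ 0) ?pfaffian0 //.
- by move=> i j; apply: skew_ji skM.
- have o0 : ord0 = lshift 1 ord0 :> 'I_(1 + 1) by apply: val_inj.
  have o1 : lift ord0 ord0 = rshift 1 ord0 :> 'I_(1 + 1) by apply: val_inj.
  rewrite o1 {1}o0; apply: etrans (block_mxEur _ _ _ _ _ _) _; exact: mxE.
- by case.
Qed.
End BaseOne.

Definition gens_free (K : fieldType) N :=
  forall q : {mpoly K[uphalf N]}, evm (@gens K N) q = 0 -> q = 0.

Definition gens_generate (K : fieldType) N := forall m (h : Sa K N),
  Poisson_center (@Hcl_bracket K N [::]) h -> (size (Lam h : {poly Sa K N}) <= m.+1)%N ->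
  exists q : {mpoly K[uphalf N]}, h = evm (@gens K N) q /\
    (size (omega (@weight N) q : {poly {mpoly K[uphalf N]}}) <= m.+1)%N.

Section SmallRank.
Variables (K : fieldType).
Hypothesis K0 : [pchar K] =i pred0.
Let nz2 : (2 : K) != 0. Proof. by rewrite ((pcharf0P K).1 K0). Qed.

Lemma size_omega_C m (w : 'I_m -> nat) c : (size (omega w c%:MP : {poly {mpoly K[m]}}) <= 1)%N.
Proof. by rewrite omegaC size_polyC leq_b1. Qed.

Lemma gens0_free : gens_free K 0.
Proof.
move=> q; have [c ->] : exists c, q = c%:MP.
  elim/mpoly_var_ind: q => [c|p q [c ->] [d ->]|[]//]; first by exists c.
  by exists (c + d); rewrite mpolyCD.
rewrite evm_C => /eqP; rewrite alg_mpolyC mpolyC_eq0 => /eqP->.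
exact: mpolyC0.
Qed.

Lemma gens0_generate : gens_generate K 0.
Proof.
move=> m h _ _; have [c ->] : exists c : K, h = c%:A.
  elim/Sa_ind: h => [c|p q [c ->] [d ->]|[[[[]]]//|[]//]]; first by exists c.
  by exists (c + d); rewrite scalerDl.
by exists c%:MP; rewrite evm_C; split=> //; apply: leq_trans (size_omega_C _ _) _.
Qed.

Let P1 (S : comAlgType K) (x : S) : coord_idx 1 -> S := fun=> x.

Let idx1 (s : coord_idx 1) : s = inr ord0.
Proof. by case: s => [[[i j]] /= +|i]; rewrite !ord1. Qed.

Let evP1 (S : comAlgType K) (x : S) : ev (P1 x) (tauhat K 1) = x.
Proof. by rewrite tauhat1 // ev_coord. Qed.

Lemma gens1_free : gens_free K 1.
Proof.
move=> q /(congr1 (ev (P1 ('X_ord0 : {mpoly K[1]})))); rewrite rmorph0.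
rewrite (evm_mor _ _ (ev_alg _)) => <-; rewrite -[LHS]evm_id; apply: eq_evm => j.
by rewrite /= evP1 ord1.
Qed.

(** The only coordinate is v, so q is h read as a polynomial in it, and its weighted degree is the
    degree in v. *)
Lemma gens1_generate : gens_generate K 1.
Proof.
move=> m h _ sh; exists (ev (P1 ('X_ord0 : {mpoly K[1]})) h); split.
  rewrite (ev_mor _ _ (evm_alg _)); rewrite -[LHS]ev_gen (eq_ev (@pt_gen K 1)); apply: eq_ev => s.
  by rewrite (idx1 s) /= evmX /gens /= tauhat1.
have -> : omega (@weight 1) (ev (P1 ('X_ord0 : {mpoly K[1]})) h) =
    kmap (ev (pt 0 (const_mx 'X_ord0 : 'cV[{mpoly K[1]}]_1))) (Lam h).
  rewrite Lam_ev ?trmx0 ?oppr0 // /omega (ev_mor _ _ (evm_alg _)).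
  apply: eq_ev => s; rewrite (idx1 s) /= !mxE evmX /omega_var /weight /= expr1 //.
exact: leq_trans (size_kmap _ _) sh.
Qed.
End SmallRank.

Lemma map_slice_basis (K : fieldType) (S T : comAlgType K) (g : {rmorphism S -> T}) n p q :
  map_mx g (@slice_basis K S n p q) = slice_basis n (map_mx g p) (map_mx g q).
Proof.
rewrite /slice_basis map_col_mx; congr col_mx.
  apply: etrans (@map_block_mx _ _ g 1 1 (2 + n) 1 _ _ _ _) _.
  by rewrite !map_mx0 map_mx1 -map_trmx map_col_mx map_mx0.
apply: etrans (@map_row_mx _ _ g (n + 1) (2 + n) 1 _ _) _.
by rewrite map_col_mx map_row_mx !map_mx0 map_mx1 -map_trmx map_col_mx map_mx0.
Qed.

Lemma tau1_neq0 (K : fieldType) N : [pchar K] =i pred0 -> tau K N.+1 1 != 0.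
Proof.
move=> K0; have nz2 : (2 : K) != 0 by rewrite ((pcharf0P K).1 K0).
apply: contra_neq (oner_neq0 K^o) => t0.
have := ev_tau nz2 (A := 0 : 'M[K^o]_N.+1) (delta_mx ord0 0) 1.
rewrite trmx0 oppr0 t0 rmorph0 => /(_ erefl) ->.
rewrite /psi mul1mx /dot mxE (bigD1 ord0) //= big1 ?addr0 => [|i /negPf ne].
  by rewrite !mxE eqxx mulr1.
by rewrite !mxE ne mul0r.
Qed.

Lemma mpoly_split (K : fieldType) m (q : {mpoly K[m.+1]}) : exists q1 q2,
  q = 'X_ord0 * q1 + evm (fun j : 'I_m => 'X_(lift ord0 j) : {mpoly K[m.+1]}) q2.
Proof.
elim/mpoly_var_ind: q => [c|p q [p1 [p2 ->]] [q1 [q2 ->]]|i p [p1 [p2 ->]]].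
- by exists 0, c%:MP; rewrite evm_C mulr0 add0r alg_mpolyC.
- by exists (p1 + q1), (p2 + q2); rewrite evmD; ring.
case: (unliftP ord0 i) => [j|] ->.
  by exists ('X_(lift ord0 j) * p1), ('X_j * p2); rewrite evmM evmX; ring.
exists ('X_ord0 * p1 + evm (fun j : 'I_m => 'X_(lift ord0 j) : {mpoly K[m.+1]}) p2), 0.
by rewrite evm0 addr0.
Qed.

Lemma size_omega_addX (K : fieldType) m (w : 'I_m.+1 -> nat) (q q1 : {mpoly K[m.+1]}) d :
  w ord0 = 2 -> (size (omega w q : {poly {mpoly K[m.+1]}}) <= d.+3)%N ->
  (size (omega w q1 : {poly {mpoly K[m.+1]}}) <= d.+1)%N ->
  (size (omega w (q + 'X_ord0 * q1) : {poly {mpoly K[m.+1]}}) <= d.+3)%N.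
Proof.
move=> w0 sq sq1; rewrite omegaD; apply: size_polyD_le sq _; rewrite omegaXM w0.
apply/leq_sizeP => k le_dk; rewrite coefXnM coefCM; case: ltnP => // le_2k.
by rewrite [_`_(k - _)]nth_default ?mulr0 // (leq_trans sq1) //; lia.
Qed.

Section Extension.
Variables (K : fieldType) (S T : comAlgType K) (r : {rmorphism S -> T}).
Hypothesis rC : forall c : K, r c%:A = c%:A.
Variables (m : nat) (F : 'I_m.+1 -> S) (G : 'I_m -> T) (c : 'I_m -> K).
Hypothesis nzc : forall j, c j != 0.
Hypothesis rF : forall j, r (F (lift ord0 j)) = c j *: G j.

(** Dividing by the scalars c_j makes this a section of [r] on polynomials in the generators. *)
Definition lift_mpoly : {mpoly K[m]} -> {mpoly K[m.+1]} :=
  evm (fun j => (c j)^-1 *: 'X_(lift ord0 j) : {mpoly K[m.+1]}).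

Lemma evm_lift_mpoly q : r (evm F (lift_mpoly q)) = evm G q.
Proof.
rewrite (evm_mor _ _ (evm_alg _)) (evm_mor _ _ rC); apply: eq_evm => j /=.
rewrite evmZ evmX (rmorph_scale _ _ rC) rF scalerA mulVf ?scale1r //.
Qed.

Lemma size_lift_mpoly (w : 'I_m -> nat) (wS : 'I_m.+1 -> nat) q d :
  (forall j, wS (lift ord0 j) = w j) ->
  (size (omega w q : {poly {mpoly K[m]}}) <= d.+1)%N ->
  (size (omega wS (lift_mpoly q) : {poly {mpoly K[m.+1]}}) <= d.+1)%N.
Proof.
move=> wE sq; rewrite /omega (evm_mor _ _ (evm_alg _)).
pose a j : {mpoly K[m.+1]} := (c j)^-1%:A * 'X_(lift ord0 j).
refine (proj1 (top_evm (w := w) (a := a) _ sq)) => j.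
rewrite /= evmZ evmX /omega_var wE -mulr_algl mulrCA kpoly_algE.
rewrite -[a j]mul1r -[X in top X]addn0; apply: topM; split.
- by rewrite size_polyXn.
- by rewrite coefXn eqxx.
- by rewrite -polyCM size_polyC leq_b1.
- by rewrite -polyCM coefC.
Qed.

Hypothesis domS : forall a b : S, a * b = 0 -> a = 0 \/ b = 0.
Hypothesis nzF : F ord0 != 0.
Hypothesis rF0 : r (F ord0) = 0.
Hypothesis freeG : forall q, evm G q = 0 -> q = 0.

(** Write q = X_0 q1 + q2. Applying r kills F_0, so freeness below gives q2 = 0; F_0 then cancels,
    and q1 is a relation of smaller degree. *)
Lemma free_extend q : evm F q = 0 -> q = 0.
Proof.
have [d] := ubnP (msize q); elim: d => // d IH in q *.
have [q1 [q2 ->]] := mpoly_split q => + q0.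
have q20 : q2 = 0.
  have := congr1 r q0; rewrite rmorph0 (evm_mor _ _ rC) evmD evmM evmX /=.
  rewrite rF0 mul0r add0r (evm_mor _ _ (evm_alg _)).
  pose Q := evm (fun j => c j *: 'X_j : {mpoly K[m]}) q2.
  have -> : evm (evm (r \o F) \o (fun j : 'I_m => 'X_(lift ord0 j))) q2 = evm G Q.
    rewrite /Q (evm_mor _ _ (evm_alg _)); apply: eq_evm => j /=.
    by rewrite evmX evmZ evmX /= rF.
  move/freeG => Q0; rewrite -[q2]evm_id -[RHS](evm0 (fun j => (c j)^-1 *: 'X_j : {mpoly K[m]})) -Q0.
  rewrite /Q (evm_mor _ _ (evm_alg _)); apply: eq_evm => j /=.
  by rewrite evmZ evmX scalerA divff ?scale1r.
move: q0; rewrite q20 rmorph0 addr0 evmM evmX.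
case/domS => [/eqP|q10]; first by rewrite (negPf nzF).
have [->|nz1] := eqVneq q1 0; first by rewrite mulr0.
have nzX : 'X_ord0 != 0 :> {mpoly K[m.+1]}.
  apply/eqP => /(congr1 (mcoeff U_(ord0))) /eqP.
  by rewrite mcoeffX eqxx mcoeff0 oner_eq0.
by rewrite msizeM // msizeX mdeg1 => lt_d; rewrite (IH q1) ?mulr0.
Qed.
End Extension.

Section Step.
Variables (K : numClosedFieldType) (n : nat).

Let K0 : [pchar K] =i pred0. Proof. exact: pchar_num. Qed.
Let nz2 : (2 : K) != 0. Proof. by rewrite pnatr_eq0. Qed.

Local Notation u := (uphalf n).
Let gensS : 'I_u.+1 -> Sa K (2 + n) := @gens K (2 + n).
Let weightS : 'I_u.+1 -> nat := @weight (2 + n).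

Lemma rho_tau0 : rho (tau K (2 + n) 1) = 0.
Proof.
rewrite /rho /= ev_tau ?sl_skew ?genA_skew //.
by rewrite [LHS]psi0_sl ?dot_ep_ep.
Qed.

Lemma rho_tauS k : rho (tau K (2 + n) k.+2) = - tau K n k.+1.
Proof.
rewrite /rho /= ev_tau ?sl_skew ?genA_skew //.
by rewrite [LHS]psi_sl ?dot_ph_ph ?dot_ep_ep ?dot_ph_ep.
Qed.

(** The scalars are -1 for the tau_k and the inverse of det [slice_basis] for the Pfaffian; that
    determinant is a constant since [ep] and [ph] have entries in [K]. *)
Lemma rho_gens : gens_free K n -> exists c : 'I_u -> K, (forall j, c j != 0) /\
  forall j, rho (gensS (lift ord0 j)) = c j *: @gens K n j.
Proof.
move=> free_n; pose d : K := \det (slice_basis n (ep K^o) (ph K^o)).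
exists (fun j => if (j < n./2)%N then -1 else d^-1).
have Ed (j : 'I_u) : (j < n./2)%N = false -> d != 0 /\ rho (tauhat K (2 + n)) = d^-1 *: tauhat K n.
  move=> jn; have oddn := gens_odd jn.
  have dE : \det (slice_basis n (ep (Sa K n)) (ph (Sa K n))) = d%:A.
    pose g : {rmorphism K^o -> Sa K n} := in_alg (Sa K n).
    have algC (c : K) : g c%:A = c%:A by rewrite /= [c%:A]mulr1.
    by rewrite -(map_ep algC) -(map_ph algC) -map_slice_basis det_map_mx.
  have E := psihat_sl (dot_ph_ph _) (dot_ep_ep _) (dot_ph_ep _) (genv K n) K0 (genA_skew K n) oddn.
  rewrite dE mulr_algl -ev_tauhat // ?sl_skew ?genA_skew // -/(tauhat K n) in E.
  (* Were d = 0, [psihat_sl] would give tauhat = 0 in rank n, against freeness there. *)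
  have nzd : d != 0.
    apply/eqP => d0; move: E; rewrite d0 scale0r => E.
    have := free_n 'X_j; rewrite evmX /gens jn -E => /(_ erefl)/(congr1 (mcoeff U_(j))).
    by rewrite mcoeffX eqxx mcoeff0 => /eqP; rewrite oner_eq0.
  split=> //; rewrite -E /rho /= scalerA mulVf // scale1r //.
split=> [j|j].
  by case: ifP => [_|/Ed[nzd _]]; rewrite ?invr_eq0 // oppr_eq0 oner_eq0.
rewrite /gensS /gens /= /bump /= add1n !ltnS.
case: ifP => [_|/Ed[_ ->]] //; by rewrite scaleN1r rho_tauS.
Qed.

Hypothesis free_n : gens_free K n.

Lemma free_step : gens_free K (2 + n).
Proof.
have [c [nzc rhoc]] := rho_gens free_n.
move=> q; apply: (free_extend (r := @rho K n) (@rho_alg K n) nzc rhoc _ _ _ free_n).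
- exact: Sa_mul_eq0.
- exact: tau1_neq0.
- exact: rho_tau0.
Qed.

(** Strong induction on the degree m: subtract a lift of the expression of rho h, divide by tau_1,
    and apply the induction hypothesis to the central quotient, of degree at most m - 2. *)
Lemma generate_step : gens_generate K n -> gens_generate K (2 + n).
Proof.
have [c [nzc rhoc]] := rho_gens free_n; move=> gen_n m.
have [d] := ubnP m; elim: d m => // d IH m; rewrite ltnS => le_md h ch sh.
have [q' [rh sq']] := gen_n m _ (rho_central ch) (size_Lam_rho ch sh).
pose q : {mpoly K[u.+1]} := lift_mpoly c q'.
have sq : (size (omega weightS q : {poly {mpoly K[u.+1]}}) <= m.+1)%N.
  by apply: size_lift_mpoly sq' => j; rewrite /weightS /weight /= /bump add1n.
pose h1 := h - evm gensS q.
have ch1 : Poisson_center (@Hcl_bracket K (2 + n) [::]) h1.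
  by apply: center_sub => //; apply: center_evm => // i; apply: center_gens.
have rh1 : rho h1 = 0.
  rewrite /h1 rmorphB /= (evm_lift_mpoly (r := @rho K n) _ nzc rhoc) ?rh ?subrr //.
  exact: rho_alg.
have [g h1E] := rho_kernel ch1 rh1.
have cg : Poisson_center (@Hcl_bracket K (2 + n) [::]) g.
  apply: (center_cancel (f := tau K (2 + n) 1)) => //; last by rewrite -h1E.
    exact: tau1_neq0.
  exact: (@center_gens K (2 + n) K0 ord0).
have sh1 : (size (Lam h1 : {poly Sa K (2 + n)}) <= m.+1)%N.
  rewrite LamB; apply: size_polyB_le; [exact: sh|exact: size_Lam_evm].
(* [Lam] of tau_1 is X^2 tau_1, so coefficient k of g is coefficient k + 2 of h1 divided by tau_1.
   For m < 2 this leaves g = 0. *)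
have Lg k : (m.+1 <= k.+2)%N -> (Lam g : {poly Sa K (2 + n)})`_k = 0.
  move=> le_mk; have : (Lam h1 : {poly Sa K (2 + n)})`_k.+2 = 0 by rewrite nth_default // (leq_trans sh1).
  rewrite h1E rmorphM /= Lam_tau // -mulrA coefXnM /= subn2 /= coefCM => /Sa_mul_eq0[/eqP|//].
  by rewrite (negPf (tau1_neq0 _ K0)).
have hE : h = evm gensS q + tau K (2 + n) 1 * g by rewrite -h1E addrC subrK.
have g0 : (m < 2)%N -> g = 0.
  move=> lt_m2; rewrite -(Lam1 g) (_ : Lam g = 0) ?rmorph0 //.
  by apply/polyP => k; rewrite coef0 Lg //; lia.
clear sh sq' sh1; case: m => [|[|m]] in le_md sq Lg g0 *; try by exists q; rewrite hE g0 // mulr0 addr0.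
have [||q1 [g1 sq1]] := IH m _ g cg; first by rewrite ltnW.
  by apply/leq_sizeP => k le_mk; apply: Lg.
exists (q + 'X_ord0 * q1 : {mpoly K[u.+1]}); split.
  by rewrite hE evmD evmM evmX -g1.
exact: (size_omega_addX (w := weightS)).
Qed.
End Step.

Lemma gens_free_generate (K : numClosedFieldType) N : gens_free K N /\ gens_generate K N.
Proof.
have K0 : [pchar K] =i pred0 := pchar_num K.
suff: (gens_free K N /\ gens_generate K N) /\ (gens_free K N.+1 /\ gens_generate K N.+1) by case.
elim: N => [|n [[free_n gen_n] IH]].
  split; first by split; [apply: gens0_free|apply: gens0_generate].
  by split; [apply: gens1_free|apply: gens1_generate].
by split=> //; split; [apply: free_step|apply: generate_step].
Qed.

(** * The center for general zeta *)

Lemma der_Gmx (K : fieldType) N (zeta : seq K) (D : Sa K N -> Sa K N) : (2 : K) != 0 ->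
  derivation D -> map_mx D (genA K N) = 0 -> map_mx D (Gmx N zeta) = 0.
Proof.
move=> nz2 dD DA; have skA := genA_skew K N.
have Df l : D (det_sqrtV (genA K N) l) = 0.
  have /= -> := congr1 (fun h => h l) (der_det_sqrtV nz2 skA dD).
  by case: l => [|l] //=; rewrite DA mulmx0 mxtrace0 oppr0.
have DP l : map_mx D ((- genA K N ^+ 2) ^+ l) = 0.
  elim: l => [|l IH]; first by rewrite expr0 der1x.
  by rewrite sqAS derNx // !derMx // DA IH !(mul0mx, mulmx0) !addr0 mul0mx oppr0.
rewrite /Gmx der_sumx // big1 // => j _; rewrite derZx // derC // scale0r add0r derMx // DA mul0mx add0r.
rewrite /resolv der_sumx // big1 ?mulmx0 ?scaler0 // => i _.
by rewrite derZx // Df scale0r add0r DP scaler0.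
Qed.

Section CoefficientDerivations.
Variables (K : fieldType) (N : nat).
Hypothesis K0 : [pchar K] =i pred0.
Let nz2 : (2 : K) != 0. Proof. by rewrite ((pcharf0P K).1 K0). Qed.
Local Notation Sa := (Sa K N).
Local Notation idx := (coord_idx N).
Local Notation A := (genA K N).
Local Notation v := (genv K N).
Implicit Types (Q : idx -> Sa) (f c : Sa).

Lemma ev_poly_coord f : ev (@poly_coord K N) f = f.
Proof. by rewrite -(eq_ev (@pt_gen K N)) ev_gen. Qed.

Definition der_along Q : Sa -> Sa := dev (@poly_coord K N) Q.

Lemma derivation_along Q : derivation (der_along Q).
Proof.
split=> [f g|f g|c]; [exact: devD| |exact: dev_alg].
by rewrite /der_along devM !ev_poly_coord.
Qed.

Lemma Lam_coord s : Lam (poly_coord K s) = pt (map_mx (@kconst K Sa) A) ('X *: map_mx (@kconst K Sa) v) s.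
Proof. exact: ev_coord. Qed.

Lemma Lam_genA : map_mx (@Lam K N) A = map_mx (@kconst K Sa) A.
Proof. by rewrite /Lam ev_genA // map_skew // genA_skew. Qed.

Lemma Lam_genv : map_mx (@Lam K N) v = 'X *: map_mx (@kconst K Sa) v.
Proof. by rewrite /Lam ev_genv. Qed.

Lemma Lam_const c : (forall i, mderiv (enum_rank (inr i : idx)) c = 0) -> Lam c = kconst c.
Proof.
move=> dc; have s1 := size_Lam_eq1 K0 dc.
have := Lam1 c; rewrite {1}(size1_polyC s1) => e; rewrite (size1_polyC s1).
by move: e; rewrite /keval /horner_eval hornerC => ->.
Qed.

Let Lpt := pt (map_mx (@kconst K Sa) A) ('X *: map_mx (@kconst K Sa) v).

(** The velocity of the point (A, X v) when (A, v) moves with velocity Q. *)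
Definition weighted Q (s : idx) : kpoly Sa :=
  match s with inl p => kconst (Q s) | inr i => ('X : kpoly Sa) * kconst (Q s) end.

Let Lpt_coord : Lpt =1 weighted (@poly_coord K N).
Proof.
move=> s; have := pt_gen K s; rewrite /Lpt; case: s => [p|i] /=; rewrite !mxE => <- //.
Qed.

Lemma coef_der_Lam Q f : map_poly (der_along Q) (Lam f) = dev Lpt (weighted Q) f.
Proof.
have dQ := derivation_along Q; have dm := derivation_map dQ.
pose M : kpoly Sa -> kpoly Sa := map_poly (der_along Q).
transitivity (dev Lpt (fun s => M (Lpt s)) f); first exact: (chain_rule Lpt f dm).
apply: (@eq_dev K N (kpoly Sa) Lpt _ (weighted Q) f) => s; rewrite /M.
have kcE a : map_poly (der_along Q) (kconst a) = kconst (der_along Q a) :> kpoly Sa.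
  by apply/polyP => i; rewrite coef_map_id0 ?(der0 dQ) // !coefC; case: eqP => // _; rewrite (der0 dQ).
have dX : map_poly (der_along Q) 'X = 0 :> kpoly Sa.
  by apply/polyP => i; rewrite coef_map_id0 ?(der0 dQ) // coefX coef0 (der_nat dQ).
rewrite Lpt_coord; case: s => [p|i] /=.
  by rewrite kcE /der_along dev_coord.
rewrite -[LHS]/((map_poly (der_along Q) : kpoly Sa -> kpoly Sa) _).
by rewrite (derM dm) kcE dX mul0r add0r /der_along dev_coord.
Qed.

Lemma Lam_der Q f : Lam (der_along Q f) = dev Lpt (@Lam K N \o Q) f.
Proof.
rewrite /der_along (dev_mor _ _ _ (@Lam_alg K N)) /dev; apply: eq_bigr => s _; congr (_ * _).
by apply: eq_ev => t; rewrite /= Lam_coord.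
Qed.

Lemma bracket_along zeta b f :
  Hcl_bracket zeta b f = der_along (fun s => Hcl_bracket zeta b (poly_coord K s)) f.
Proof. exact: Hcl_bracket_dev. Qed.

Lemma eq_along Q Q' f : Q =1 Q' -> der_along Q f = der_along Q' f.
Proof. exact: eq_dev. Qed.

Section ZetaCentral.
Variables (zeta : seq K) (f : Sa).
Hypothesis cf : Poisson_center (@Hcl_bracket K N zeta) f.

Let coordE D s : D (poly_coord K s) = pt (map_mx D A) (map_mx D v) s :> Sa.
Proof. by rewrite -(@pt_gen K N s) -[D _]/((D \o pt A v) s) map_pt. Qed.

Let kLam (M : 'M[Sa]_N) i j : map_mx (@Lam K N) M = map_mx (@kconst K Sa) M -> Lam (M i j) = kconst (M i j).
Proof. by move/matrixP/(_ i j); rewrite !mxE. Qed.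

Let kLamX (u : 'cV[Sa]_N) i :
  map_mx (@Lam K N) u = 'X *: map_mx (@kconst K Sa) u -> Lam (u i 0) = 'X * kconst (u i 0).
Proof. by move/colP/(_ i); rewrite !mxE. Qed.

(** The rotation field is independent of zeta and commutes with scaling of v, so it acts on each
    homogeneous component separately. *)
Lemma coef_center_so (B : 'M[K]_N) k : B^T = - B ->
  Hcl_bracket [::] (so_elt B) (Lam f : {poly Sa})`_k = 0.
Proof.
move=> skB; rewrite bracket_along.
pose Q s := Hcl_bracket zeta (so_elt B) (poly_coord K s).
pose BS := map_mx (in_alg Sa) B.
have QE z s : Hcl_bracket z (so_elt B) (poly_coord K s) = pt (A *m BS - BS *m A) (- (BS *m v)) s.
  by rewrite coordE bracket_so_A // bracket_so_v.
have -> : der_along (fun s => Hcl_bracket [::] (so_elt B) (poly_coord K s)) (Lam f : {poly Sa})`_k = der_along Q (Lam f : {poly Sa})`_k.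
  by apply: eq_along => s; rewrite /Q !QE.
have LB : map_mx (@Lam K N) BS = map_mx (@kconst K Sa) BS.
  by apply/matrixP => i j; rewrite !mxE Lam_alg kconst_alg.
have LQ : @Lam K N \o Q =1 weighted Q.
  move=> s; rewrite /= /weighted /Q !QE; case: s => [p|i] /=.
    by apply: kLam; rewrite !map_mxB !map_mxM /= Lam_genA LB.
  by apply: kLamX; rewrite !map_mxN !map_mxM /= Lam_genv LB scalerN -scalemxAr.
have : Lam (der_along Q f) = 0 by rewrite -bracket_along Hcl_bracket_antisym cf oppr0 rmorph0.
rewrite Lam_der (eq_dev _ _ LQ) -coef_der_Lam => /(congr1 (fun p : {poly Sa} => p`_k)).
by rewrite coef0 coef_map_id0 ?(der0 (derivation_along Q)).
Qed.

(** The A-part of the field of [vec_elt x] is linear in v and common to all zeta, so it raises the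
    degree by one; the zeta-dependent v-part is free of v, so it lowers the degree. The top degree
    therefore sees only the field for zeta = 0. The factor 'X in [key] avoids negative powers. *)
Lemma top_center_vec (x : 'cV[K]_N) k : (size (Lam f : {poly Sa}) <= k.+1)%N ->
  Hcl_bracket [::] (vec_elt x) (Lam f : {poly Sa})`_k = 0.
Proof.
move=> sf; rewrite bracket_along.
pose X := map_mx (in_alg Sa) x.
have LX : map_mx (@Lam K N) X = map_mx (@kconst K Sa) X.
  by apply/matrixP => i j; rewrite !mxE Lam_alg kconst_alg.
pose Q s := Hcl_bracket zeta (vec_elt x) (poly_coord K s).
pose Q0 s := Hcl_bracket [::] (vec_elt x) (poly_coord K s).
pose Q1 (s : idx) := match s with inl p => 0 | inr i => Q (inr i) end.
have QE z s : Hcl_bracket z (vec_elt x) (poly_coord K s) =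
    pt (v *m X^T - X *m v^T) (- (Gmx N z *m X)) s.
  by rewrite coordE bracket_vec_A // bracket_vec_v.
have Q0r i : Q0 (inr i) = 0 by rewrite /Q0 QE /= /Gmx big_ord0 mul0mx oppr0 mxE.
have LA (M := v *m X^T - X *m v^T) : map_mx (@Lam K N) M = 'X *: map_mx (@kconst K Sa) M.
  rewrite !map_mxB !map_mxM /= -!map_trmx Lam_genv LX.
  by rewrite linearZ /= -scalemxAl -scalemxAr scalerBr.
have LG i : Lam (Q (inr i)) = kconst (Q (inr i)).
  apply: Lam_const => j; rewrite /Q QE /=.
  have dm := @mderiv_derivation K N (enum_rank (inr j : idx)).
  have entry D (M : 'cV[Sa]_N) : map_mx D M = 0 -> D (M i 0) = 0 :> Sa.
    by move/colP/(_ i); rewrite !mxE.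
  apply: entry; rewrite (derNx dm) (derMx dm) (der_Gmx zeta nz2 dm) ?mderiv_genA // mul0mx add0r.
  by rewrite (der_algx dm) mulmx0 oppr0.
(* In degree k + 2 the second term vanishes. *)
have key : ('X : kpoly Sa) * Lam (der_along Q f) =
    ('X : kpoly Sa) ^+ 2 * (map_poly (der_along Q0) (Lam f) : kpoly Sa) +
    map_poly (der_along Q1) (Lam f).
  rewrite Lam_der !coef_der_Lam /dev !mulr_sumr -big_split; apply: eq_bigr => s _ /=.
  case: s => [p|i] /=.
    have -> : Q0 (inl p) = Q (inl p) by rewrite /Q0 /Q !QE.
    have -> : Lam (Q (inl p)) = ('X : kpoly Sa) * kconst (Q (inl p)).
      by rewrite /Q QE /=; have /matrixP/(_ (val p).1 (val p).2) := LA; rewrite !mxE.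
    by rewrite rmorph0 mulr0 addr0; ring.
  by rewrite LG Q0r rmorph0 !mulr0 add0r mulrCA.
have Qf : der_along Q f = 0 by rewrite -bracket_along Hcl_bracket_antisym cf oppr0.
move: key; rewrite Qf rmorph0 mulr0 => /(congr1 (fun p : {poly Sa} => p`_k.+2)).
rewrite coef0 coefD coefXnM /= subn2 /= !coef_map_id0 ?(der0 (derivation_along _)) //.
by rewrite (nth_default _ (leqW sf)) (der0 (derivation_along _)) addr0.
Qed.
End ZetaCentral.
End CoefficientDerivations.

(** Homogeneity of the k-th component: scaling v by X and then by Y is scaling by XY, and
    coefficients of the outer variable are compared. *)
Lemma Lam_coef (K : fieldType) N (f : Sa K N) k : [pchar K] =i pred0 ->
  Lam (Lam f : {poly Sa K N})`_k = 'X^k * kconst (Lam f : {poly Sa K N})`_k :> kpoly (Sa K N).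
Proof.
move=> K0; set S := Sa K N; pose R := kpoly (kpoly S).
pose c : R := 'X * @kconst K (kpoly S) 'X.
have k2E p q (M : 'M[S]_(p, q)) : map_mx (@kconst2 K S) M =
    map_mx (@kconst K (kpoly S)) (map_mx (@kconst K S) M).
  by apply/matrixP => i j; rewrite !mxE.
have km (T T' : comAlgType K) (g : {rmorphism T -> T'}) p q (M : 'M[T]_(p, q)) :
    map_mx (kmap g) (map_mx (@kconst K T) M) = map_mx (@kconst K T') (map_mx g M).
  by apply/matrixP => i j; rewrite !mxE [LHS]kmap_const.
have kX (T T' : comAlgType K) (g : {rmorphism T -> T'}) q (M : 'cV[kpoly T]_q) :
    map_mx (kmap g) ('X *: M) = 'X *: map_mx (kmap g) M.
  by rewrite map_mxZ /= kmapX.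
have eX q (M : 'cV[kpoly R]_q) : map_mx (keval c) ('X *: M) = c *: map_mx (keval c) M.
  by rewrite map_mxZ /= kevalX.
have kcX q (M : 'cV[kpoly S]_q) : map_mx (@kconst K (kpoly S)) ('X *: M) = @kconst K (kpoly S) 'X *: map_mx (@kconst K (kpoly S)) M.
  by rewrite map_mxZ.
have k2C (a : K) : kconst2 (a%:A : S) = a%:A by rewrite /kconst2 !kconst_alg.
have E : kmap (@Lam K N) (Lam f) = keval c (kmap (@kconst2 K S) (Lam f)).
  have -> : Lam f = ev (pt (map_mx (@kconst K S) (genA K N)) ('X *: map_mx (@kconst K S) (genv K N))) f by [].
  rewrite !(ev_pt_mor _ _ _ (kmap_alg _)); [|exact: k2C|exact: Lam_alg].
  rewrite (ev_pt_mor _ _ _ (keval_alg _)); apply: (@eq_ev K N R) => s.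
  by rewrite !kX eX !km !keval_constx (Lam_genA _ K0) Lam_genv kcX !k2E scalerA.
have := congr1 (fun p : {poly (kpoly S)} => p`_k) E; rewrite kmap_coef /= => ->.
rewrite /keval /horner_eval horner_poly coef_sum.
have cE i : c ^+ i = 'X^i * kconst ('X^i : kpoly S).
  by rewrite exprMn -rmorphXn.
have kE i : (kconst2 (Lam f : {poly S})`_i * c ^+ i : {poly (kpoly S)})`_k =
    if (i == k) then 'X^k * kconst (Lam f : {poly S})`_k else 0.
  rewrite cE mulrCA coefXnM coefCM coefC; case: ltngtP => [_|lt_ik|->]; rewrite ?mulr0 //.
    by rewrite subn_eq0 leqNgt lt_ik mulr0.
  by rewrite subnn mulrC.
rewrite (eq_bigr (fun i : 'I__ => if (i == k :> nat) then 'X^k * kconst (Lam f : {poly S})`_k else 0)) => [|i _]; last exact: kE.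
case: (ltnP k (size (Lam f : {poly S}))) => [lt_k|ge_k].
  by rewrite (bigD1 (Ordinal lt_k)) //= eqxx big1 ?addr0 // => i /negPf; rewrite -val_eqE /= => ->.
rewrite big1 => [|i _]; last by rewrite ltn_eqF // (leq_trans (ltn_ord i)).
by rewrite nth_default // rmorph0 mulr0.
Qed.

Section ZetaGenerators.
Variables (K : numClosedFieldType) (N : nat) (zeta : seq K).

Let K0 : [pchar K] =i pred0. Proof. exact: pchar_num. Qed.
Let nz2 : (2 : K) != 0. Proof. by rewrite pnatr_eq0. Qed.
Local Notation u := (uphalf N).
Local Notation center := (Poisson_center (@Hcl_bracket K N zeta)).

Definition zeta_gens (j : 'I_u) : Sa K N :=
  if (j < N./2)%N then tau K N j.+1 + celt N zeta j.+1 else tauhat K N.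

Lemma center_zeta_gens j : center (zeta_gens j).
Proof.
rewrite /zeta_gens; case: ifP => [_|/gens_odd oddN]; last exact: central_tauhat.
exact: central_tau_celt.
Qed.

(** c_j has degree 0 in v, below the degree 2 of tau_j. *)
Lemma top_Lam_zeta_gens j : top (weight j) (Lam (zeta_gens j)) (gens K j).
Proof.
have t := top_Lam_gens K0 j; rewrite /zeta_gens; case: ifP => jN; last first.
  by rewrite /gens jN in t *.
have gE : gens K j = tau K N j.+1 by rewrite /gens jN.
have wE : weight j = 2%N by rewrite /weight jN.
rewrite gE wE in t *; rewrite LamD -[X in top _ _ X]addr0.
apply: topD t _; apply: top_lt.
exact: leqW (size_Lam_celt N nz2 zeta j K0).
Qed.

(** By [top_evm] the top weighted component of a relation would be a relation among the generators
    for zeta = 0. *)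
Lemma zeta_gens_free (q : {mpoly K[u]}) : evm zeta_gens q = 0 -> q = 0.
Proof.
move=> q0; apply: contraTeq isT => nzq.
have nzo : omega (@weight N) q != 0.
  by apply: contra_neq nzq => o0; rewrite -(omega1 (@weight N) q) o0 rmorph0.
pose p : {poly {mpoly K[u]}} := omega (@weight N) q.
have sp : size p = (size p).-1.+1 by rewrite prednK // size_poly_gt0.
have [_] := top_evm top_Lam_zeta_gens (q := q) (d := (size p).-1) (eq_leq sp).
rewrite -(evm_mor _ _ (@Lam_alg K N)) q0 rmorph0 coef0 => /esym.
have [free_N _] := gens_free_generate K N.
by move=> /free_N/eqP; rewrite -[_`__]/(lead_coef p) lead_coef_eq0 (negPf nzo).
Qed.

Lemma zeta_gens_generate (f : Sa K N) : center f -> exists q, f = evm zeta_gens q.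
Proof.
have [_ gen_N] := gens_free_generate K N.
have [m] := ubnP (size (Lam f : {poly Sa K N})); elim: m f => // m IH f.
rewrite ltnS leq_eqVlt => /predU1P[sf cf|lt_f]; last exact: IH.
case: m => [|m] in IH sf.
  exists 0; rewrite evm0 -(Lam1 f) (_ : Lam f = 0) ?rmorph0 //.
  by apply/eqP; rewrite -size_poly_eq0 sf.
pose a := (Lam f : {poly Sa K N})`_m.
have ca : Poisson_center (@Hcl_bracket K N [::]) a.
  apply/Poisson_centerP => //; split=> [B skB|x]; first exact: (coef_center_so _ cf).
  by apply: (top_center_vec _ cf); rewrite ?sf.
have [|q [aE sq]] := gen_N m a ca.
  rewrite Lam_coef //; apply/leq_sizeP => i lt_mi.
  by rewrite coefXnM coefC; case: ltnP => // le_mi; rewrite subn_eq0 leqNgt lt_mi.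
have [sLq Lq] := top_evm top_Lam_zeta_gens sq.
have [_ aq] := top_evm (top_Lam_gens K0) sq.
have LE (F : 'I_u -> Sa K N) r : evm (fun j => Lam (F j)) r = Lam (evm F r).
  by rewrite [RHS](evm_mor _ _ (@Lam_alg K N)).
rewrite (LE zeta_gens) in sLq Lq; rewrite (LE (@gens K N)) in aq.
(* As [a] is homogeneous of degree m, the top part of q in the generators for zeta = 0 already gives
   [a]; hence q in the deformed generators has the same leading coefficient as f. *)
have aa : (Lam a : {poly Sa K N})`_m = a by rewrite Lam_coef // coefXnM ltnn subnn coefC.
rewrite -aE aa -Lq in aq.
have cfq : center (f - evm zeta_gens q).
  exact: center_sub cf (center_evm q center_zeta_gens).
have [|q' fE] := IH _ _ cfq.
  by rewrite LamB ltnS; apply: size_sub_lead (eq_leq sf) sLq aq.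
by exists (q' + q); rewrite evmD -fE subrK.
Qed.
End ZetaGenerators.

Lemma free_generators_of (K : numClosedFieldType) N (zeta : seq K) m (e : m = uphalf N)
    (g : m.-tuple (Sa K N)) :
  (forall j, tnth g j = zeta_gens zeta (cast_ord e j)) ->
  free_polynomial_generators (Poisson_center (@Hcl_bracket K N zeta)) g.
Proof.
move=> gE; subst m.
have E q : q \mPo g = evm (zeta_gens zeta) q.
  by rewrite evm_comp; apply: eq_evm => j; rewrite gE; congr zeta_gens; apply: val_inj.
split=> [p q|a].
  rewrite !E => pq; apply/eqP; rewrite -subr_eq0; apply/eqP.
  by apply: (@zeta_gens_free K N zeta); rewrite [LHS]rmorphB /= pq subrr.
split=> [/zeta_gens_generate[q ->]|[q ->]]; first by exists q.
rewrite E; exact: center_evm q (@center_zeta_gens K N zeta).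
Qed.

Lemma nth_map_enum_ord T (x : T) n (F : nat -> T) i : (i < n)%N ->
  nth x [seq F (j : 'I_n) | j <- enum 'I_n] i = F i.
Proof.
by move=> lt_in; rewrite (nth_map (Ordinal lt_in)) ?size_enum_ord // nth_enum_ord.
Qed.

Theorem theorem4p2 (R : realType) (N k : nat) (zeta : k.+1.-tuple R[i]) :
  (3 <= N)%N ->
  (forall n : nat, N = (2 * n)%N ->
     free_polynomial_generators
       (Poisson_center (@Hcl_bracket R[i] N zeta))
       [tuple tau R[i] N j.+1 + celt N zeta j.+1 | j < n])
  /\
  (forall n : nat, N = (2 * n).+1 ->
     free_polynomial_generators
       (Poisson_center (@Hcl_bracket R[i] N zeta))
       [tuple of rcons [tuple tau R[i] N j.+1 + celt N zeta j.+1 | j < n]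
                       (tauhat R[i] N)]).
Proof.
move=> _; split=> n NE.
  have e : n = uphalf N by rewrite NE mul2n uphalf_double.
  apply: (@free_generators_of R[i] N zeta n e) => j; rewrite tnth_mktuple /zeta_gens /=.
  by rewrite NE mul2n doubleK ltn_ord.
have e : n.+1 = uphalf N by rewrite NE mul2n uphalf_half /= odd_double uphalf_double.
apply: (@free_generators_of R[i] N zeta n.+1 e) => j.
have halfN : N./2 = n by rewrite NE mul2n /= uphalf_double.
rewrite (tnth_nth 0) /= nth_rcons size_map size_enum_ord /zeta_gens /= halfN.
case: (ltngtP j n) => [lt_jn|lt_nj|//].
  exact: (nth_map_enum_ord 0 (fun i => tau R[i] N i.+1 + celt N zeta i.+1) lt_jn).
by have := ltn_ord j; rewrite ltnS leqNgt lt_nj.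
Qed.
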